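(* For every integer $m\ge1$ and every real-valued function $a\in C^\infty(\mathbb{S})$, $Z_m(a)=0$ if and only if $a$ is of the form $$a(\theta)=\hat a_0+2\,\mathrm{Re}(\hat a_1e^{i\theta})\quad\text{with some }\hat a_0\in\mathbb{R}\text{ and }\hat a_1\in\mathbb{C}.$$
   Context: $\mathbb{S}=\{e^{i\theta}:\theta\in\mathbb{R}\}\subset\mathbb{C}$ is the unit circle; for a function $u$ on $\mathbb{S}$ one writes $u(\theta)$ for $u(e^{i\theta})$, and $\hat u_n$ ($n\in\mathbb{Z}$) are the Fourier coefficients, $u(\theta)=\sum_{n\in\mathbb{Z}}\hat u_n e^{in\theta}$. $\Lambda:C^\infty(\mathbb{S})\to C^\infty(\mathbb{S})$ is the Dirichlet-to-Neumann operator of the unit disk, i.e. $\Lambda e^{in\theta}=|n|e^{in\theta}$, and $D=-i\frac{d}{d\theta}$, i.e. $De^{in\theta}=ne^{in\theta}$. A function $a$ also denotes the operator of multiplication by $a$. For $a\in C^\infty(\mathbb{S})$ and an integer $m\ge1$, the operator $(a\Lambda)^{2m}-(aD)^{2m}$ is a smoothing operator on $\mathbb{S}$ (hence has a finite trace), and the Steklov zeta-invariant is $Z_m(a)=\mathrm{Tr}\big[(a\Lambda)^{2m}-(aD)^{2m}\big]$. *)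

(* Defs.v *)
From Stdlib Require Import Reals ZArith Lia Lra FunctionalExtensionality.
From Coquelicot Require Import Coquelicot.

Open Scope R_scope.

(* A function u on the unit circle is represented by the 2*PI-periodic
   function theta |-> u (e^{i theta}) of the angle. *)

Definition smooth_on_circle (u : R -> C) : Prop :=
  (forall t : R, u (t + 2 * PI) = u t) /\
  (forall (k : nat) (t : R),
      ex_derive_n (fun s => Re (u s)) k t /\
      ex_derive_n (fun s => Im (u s)) k t).

Definition real_valued (u : R -> C) : Prop := forall t : R, Im (u t) = 0.

(* e^{i n theta} *)
Definition expi (n : Z) (theta : R) : C :=
  (cos (IZR n * theta), sin (IZR n * theta)).

Definition fourier_coef (u : R -> C) (n : Z) : C :=
  (RtoC (/ (2 * PI)) *
     @RInt C_R_CompleteNormedModule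
       (fun t => (u t * expi (- n) t)%C) 0 (2 * PI))%C.

Definition CSeries (f : nat -> C) : C :=
  (Series (fun k => Re (f k)), Series (fun k => Im (f k))).

(* The non-negative and the negative indices are summed separately, so that
   no cancellation between the two tails is used.  As with [Series], the value
   is meaningful only when the sums converge. *)
Definition ZSeries (f : Z -> C) : C :=
  (CSeries (fun k => f (Z.of_nat k)) + CSeries (fun k => f (- Z.of_nat (S k))%Z))%C.

Definition Lambda (u : R -> C) : R -> C := fun theta =>
  ZSeries (fun n => (RtoC (IZR (Z.abs n)) * fourier_coef u n * expi n theta)%C).

(* -i d/dtheta; the derivative of a complex-valued function of a real variable
   is taken componentwise. *)
Definition Dop (u : R -> C) : R -> C := fun theta =>
  (- Ci * (Derive (fun s => Re (u s)) theta, Derive (fun s => Im (u s)) theta))%C.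

Definition mult_op (a u : R -> C) : R -> C := fun theta => (a theta * u theta)%C.

(* (a Lambda)^p - (a D)^p *)
Definition steklov_diff (a : R -> C) (p : nat) (u : R -> C) : R -> C :=
  fun theta =>
    (Nat.iter p (fun v => mult_op a (Lambda v)) u theta -
     Nat.iter p (fun v => mult_op a (Dop v)) u theta)%C.

(* The functions e^{i n theta} form an orthonormal basis of L^2 for the
   normalised measure dtheta / (2 PI), and the n-th diagonal matrix entry of A
   in it is the n-th Fourier coefficient of A e^{i n theta}. *)
Definition op_trace (A : (R -> C) -> (R -> C)) : C :=
  ZSeries (fun n => fourier_coef (A (expi n)) n).

Definition steklov_zeta (m : nat) (a : R -> C) : C :=
  op_trace (steklov_diff a (2 * m)).

Lemma expi_mul n k t : (expi n t * expi k t)%C = expi (n + k) t.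
Proof.
unfold expi, Cmult; simpl. rewrite plus_IZR, Rmult_plus_distr_r, cos_plus, sin_plus.
f_equal; ring.
Qed.

Lemma sin_Z k : sin (IZR k * (2 * PI)) = 0.
Proof.
apply sin_eq_0_1. exists (2*k)%Z. rewrite mult_IZR. ring.
Qed.

Lemma cos_Z k : cos (IZR k * (2 * PI)) = 1.
Proof.
replace (IZR k * (2*PI)) with (2 * (IZR k * PI)) by ring.
rewrite cos_2a_sin. assert (sin (IZR k * PI) = 0) by (apply sin_eq_0_1; now exists k). rewrite H; ring.
Qed.

Lemma is_RInt_expi k : k <> 0%Z -> @is_RInt C_R_NormedModule (expi k) 0 (2*PI) (RtoC 0).
Proof.
intros Hk. assert (IZR k <> 0) by (now apply not_0_IZR).
apply (is_RInt_fct_extend_pair (expi k)); simpl.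
- replace 0 with (sin (IZR k * (2*PI)) / IZR k - sin (IZR k * 0)/IZR k) at 2
   by (rewrite sin_Z, Rmult_0_r, sin_0; field; auto).
  apply (is_RInt_derive (fun t => sin (IZR k * t) / IZR k)).
  + intros; auto_derive; auto; field; auto.
  + intros; apply (ex_derive_continuous (fun t => cos (IZR k * t))). auto_derive; auto.
- replace 0 with (- cos (IZR k * (2*PI)) / IZR k - - cos (IZR k * 0)/IZR k) at 2
   by (rewrite cos_Z, Rmult_0_r, cos_0; field; auto).
  apply (is_RInt_derive (fun t => - cos (IZR k * t) / IZR k)).
  + intros; auto_derive; auto; field; auto.
  + intros; apply (ex_derive_continuous (fun t => sin (IZR k * t))). auto_derive; auto.
Qed.

Lemma fourier_coef_expi n k : fourier_coef (expi n) k = if Z.eq_dec k n then RtoC 1 else RtoC 0.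
Proof.
pose proof PI_RGT_0. unfold fourier_coef.
replace (fun t => (expi n t * expi (- k) t)%C) with (expi (n - k)) by (apply functional_extensionality; intros; rewrite expi_mul; f_equal; lia).
destruct (Z.eq_dec k n) as [->|Hn].
- rewrite Z.sub_diag.
  rewrite (functional_extensionality (expi 0) (fun _ => RtoC 1)) by
   (intros; unfold expi, RtoC; rewrite Rmult_0_l, cos_0, sin_0; auto).
  rewrite RInt_const. unfold scal; simpl. unfold prod_scal, scal, RtoC, Cmult; simpl. unfold mult; simpl.
  f_equal; field; lra.
- erewrite is_RInt_unique by (apply is_RInt_expi; lia). apply Cmult_0_r.
Qed.

Lemma Series_single (f : nat -> R) k0 : (forall k, k <> k0 -> f k = 0) -> Series f = f k0.
Proof.
intros H. apply is_series_unique.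
change (is_lim_seq (sum_n f) (f k0)). apply (is_lim_seq_ext_loc (fun _ => f k0)); [| apply is_lim_seq_const].
exists k0. intros n Hn. induction Hn as [|n Hn IH].
- destruct k0 as [|k]; [now rewrite sum_O|]. rewrite sum_Sn.
  rewrite (sum_n_ext_loc _ (fun _ => 0)) by (intros; apply H; lia).
  rewrite sum_n_const. unfold plus; simpl; ring.
- rewrite sum_Sn, <- IH, (H (S n)) by lia. unfold plus; simpl; ring.
Qed.

Lemma Series_zero (f : nat -> R) : (forall k, f k = 0) -> Series f = 0.
Proof.
intros H. rewrite (Series_single f 0%nat); auto.
Qed.

Lemma ZSeries_single (f : Z -> C) n : (forall k, k <> n -> f k = RtoC 0) -> ZSeries f = f n.
Proof.
intros H. unfold ZSeries, CSeries.
destruct (Z_lt_le_dec n 0).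
- rewrite (Series_zero (fun k => Re (f (Z.of_nat k)))), (Series_zero (fun k => Im (f (Z.of_nat k))))
    by (intros; rewrite H by lia; auto).
  rewrite !(Series_single _ (Z.to_nat (-n-1))) by (intros; rewrite H by lia; auto).
  replace (- Z.of_nat (S (Z.to_nat (-n-1))))%Z with n by lia.
  destruct (f n); unfold Cplus; simpl; f_equal; ring.
- rewrite (Series_zero (fun k => Re (f (- Z.of_nat (S k))%Z))), (Series_zero (fun k => Im (f (- Z.of_nat (S k))%Z)))
    by (intros; rewrite H by lia; auto).
  rewrite !(Series_single _ (Z.to_nat n)) by (intros; rewrite H by lia; auto).
  rewrite Z2Nat.id by lia. destruct (f n); unfold Cplus; simpl; f_equal; ring.
Qed.

Lemma Lambda_expi n t : Lambda (expi n) t = (RtoC (IZR (Z.abs n)) * expi n t)%C.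
Proof.
unfold Lambda. rewrite (ZSeries_single _ n).
- rewrite fourier_coef_expi. destruct Z.eq_dec; [|lia]. now rewrite Cmult_1_r.
- intros k Hk. rewrite fourier_coef_expi. destruct Z.eq_dec; [lia|]. now rewrite Cmult_0_r, Cmult_0_l.
Qed.

Lemma Dop_expi n t : Dop (expi n) t = (RtoC (IZR n) * expi n t)%C.
Proof.
unfold Dop, expi; simpl.
replace (Derive (fun s : R => cos (IZR n * s)) t) with (- IZR n * sin (IZR n*t)) by (symmetry; apply is_derive_unique; auto_derive; auto; ring).
replace (Derive (fun s : R => sin (IZR n * s)) t) with (IZR n * cos (IZR n*t)) by (symmetry; apply is_derive_unique; auto_derive; auto; ring).
unfold Cmult, Copp, Ci, RtoC; simpl; f_equal; ring.
Qed.

(* Main.v *)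
Require Import Defs.
From Stdlib Require Import Reals ZArith Lia Lra List FunctionalExtensionality.
From Coquelicot Require Import Coquelicot.
Import ListNotations.
Open Scope R_scope.

(** In the basis e^{i n theta}, multiplication by [a] has the matrix A(i, j) = a_{i-j}, while Lambda
    and D are the diagonal matrices of |n| and n = sgn(n) |n|.  Multiply matrices with the weight
    |l|, that is (A B)(i, j) = sum_l A(i, l) |l| B(l, j), and put A'(i, j) = sgn(i) sgn(j) a_{i-j}.
    Then (a Lambda)^{2m} has the matrix A^{2m}(i, j) |j| and (a D)^{2m} has the matrix
    (A A')^m(i, j) |j|, so that Z_m(a) is formally tr A^{2m} - tr (A A')^m, where
    tr K = sum_i |i| K(i, i).  As a is real, A and A' are self-adjoint, and for this
    product and trace tr (K K^* ) >= 0, since all weights are non-negative.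

    The two traces need not converge, but A - A' lives on pairs of frequencies of opposite signs, where
    |i - j| = |i| + |j|, and is therefore rapidly decreasing in both indices.  Hence any two words of
    the same length in A, A' differ by a kernel which is rapidly decreasing in both indices, uniformly
    in a truncation of the frequencies to |l| <= N ([wprod_diff_smoothing]), and Z_m(a) is the limit of
    the differences of the traces of the truncated words ([trace_lim]).

    For a fixed truncation, Cauchy-Schwarz gives 2 Re tr(u v) <= Re tr(u u^* ) + Re tr(v^* v) for words
    u, v of length m ([word_tr_reflect]).  Reflecting a word of maximal trace until it is a power shows
    that A^{2m} has the largest trace ([word_tr_le_power]); and if the trace of u v is close to this
    maximum, so is that of u u^*.  Suppose that Z_m(a) = 0 and m >= 2.  The traces of the words (A A')^m
    are then close to the maximum, and reflections lead from (A A')^m to A' A^{2m-2} A', which means that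
    A^{m-2} (A^2 - A'^2) tends to 0 in the Hilbert-Schmidt norm ([defect_to_gap]).  The norms of the
    A^k (A^2 - A'^2) are log-convex in k and bounded in N, so the factor A^{m-2} can be removed
    ([defect_to_gap0]): every entry of A^2 - A'^2 tends to 0.  For n, k >= 1 the entry (n, -k) is
    2 sum_l |l| a_{n-l} a_{l+k}.  As the second difference of |l| is 2 at 0 and vanishes elsewhere, a second
    difference in (n, k) gives a_n a_k = 0 for n, k >= 2 ([corr_second_difference]), so a_n = 0 for
    |n| >= 2.  For m = 1 the defect is half the squared norm of A - A', which gives the same conclusion.
    Conversely, if a_n = 0 for |n| >= 2, then A and A' agree at all non-zero frequencies, and the
    truncated traces are equal.

    What remains is Fourier analysis: the matrices of the iterates are obtained from the convolution
    formula for a product with an absolutely convergent Fourier series ([fourier_coef_product]), and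
    smooth functions are sums of their Fourier series ([fourier_inversion]). *)

(** * Sums over symmetric ranges of integers and limits of complex sequences *)

Fixpoint csum (l : list Z) (f : Z -> C) : C :=
  match l with nil => RtoC 0 | x :: l' => (f x + csum l' f)%C end.

Fixpoint rsum (l : list Z) (f : Z -> R) : R :=
  match l with nil => 0 | x :: l' => f x + rsum l' f end.

Fixpoint zrange (N : nat) : list Z :=
  match N with
  | O => [0%Z]
  | S n => Z.of_nat (S n) :: (- Z.of_nat (S n))%Z :: zrange n
  end.

Lemma csum_ext l f g : (forall x, In x l -> f x = g x) -> csum l f = csum l g.
Proof.
induction l as [|x l IH]; intros H; simpl; auto.
rewrite H, IH; auto; [intros; apply H; now right | now left].
Qed.

Lemma csum_plus l f g : csum l (fun x => (f x + g x)%C) = (csum l f + csum l g)%C.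
Proof. induction l as [|x l IH]; simpl; [|rewrite IH]; ring. Qed.

Lemma csum_minus l f g : csum l (fun x => (f x - g x)%C) = (csum l f - csum l g)%C.
Proof. induction l as [|x l IH]; simpl; [|rewrite IH]; ring. Qed.

Lemma csum_mult_l l c f : csum l (fun x => (c * f x)%C) = (c * csum l f)%C.
Proof. induction l as [|x l IH]; simpl; [|rewrite IH]; ring. Qed.

Lemma csum_mult_r l c f : csum l (fun x => (f x * c)%C) = (csum l f * c)%C.
Proof. induction l as [|x l IH]; simpl; [|rewrite IH]; ring. Qed.

Lemma csum_zero l f : (forall x, In x l -> f x = RtoC 0) -> csum l f = RtoC 0.
Proof.
intros H. rewrite (csum_ext l f (fun _ => RtoC 0)) by auto.
clear H. induction l as [|x l IH]; simpl; [|rewrite IH]; ring.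
Qed.

Lemma csum_swap l l' (f : Z -> Z -> C) :
  csum l (fun x => csum l' (f x)) = csum l' (fun y => csum l (fun x => f x y)).
Proof.
induction l as [|x l IH]; simpl.
- symmetry; apply csum_zero; auto.
- now rewrite IH, <- csum_plus.
Qed.

Lemma csum_conj l f : Cconj (csum l f) = csum l (fun x => Cconj (f x)).
Proof.
induction l as [|x l IH]; simpl; [|rewrite <- IH]; unfold Cconj, RtoC, Cplus; simpl; f_equal; ring.
Qed.

Lemma Re_csum l f : Re (csum l f) = rsum l (fun x => Re (f x)).
Proof. induction l as [|x l IH]; simpl; auto. now rewrite <- IH. Qed.

Lemma csum_single l f k : NoDup l -> In k l -> (forall x, In x l -> x <> k -> f x = RtoC 0) ->
  csum l f = f k.
Proof.
induction 1 as [|x l Hx Hl IH]; intros Hk H; [easy|simpl].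
destruct (Z.eq_dec x k) as [->|Hn].
- rewrite csum_zero; [ring|]. intros y Hy; apply H; [now right|]. intros ->; auto.
- destruct Hk as [|Hk]; [easy|]. rewrite (H x), IH; auto; [ring| |now left].
  intros; apply H; auto; now right.
Qed.

Lemma rsum_ext l f g : (forall x, In x l -> f x = g x) -> rsum l f = rsum l g.
Proof.
induction l as [|x l IH]; intros H; simpl; auto.
rewrite H, IH; auto; [intros; apply H; now right | now left].
Qed.

Lemma rsum_le l f g : (forall x, In x l -> f x <= g x) -> rsum l f <= rsum l g.
Proof.
induction l as [|x l IH]; intros H; simpl; [lra|].
apply Rplus_le_compat; [apply H; now left | apply IH; intros; apply H; now right].
Qed.

Lemma rsum_scal l c f : rsum l (fun x => c * f x) = c * rsum l f.
Proof. induction l as [|x l IH]; simpl; [|rewrite IH]; ring. Qed.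

Lemma rsum_nonneg l f : (forall x, In x l -> 0 <= f x) -> 0 <= rsum l f.
Proof.
induction l as [|x l IH]; intros H; simpl; [lra|].
apply Rplus_le_le_0_compat; [apply H; now left | apply IH; intros; apply H; now right].
Qed.

Lemma rsum_term_le l f k : (forall x, In x l -> 0 <= f x) -> In k l -> f k <= rsum l f.
Proof.
induction l as [|x l IH]; intros H Hk; [easy|simpl].
destruct Hk as [->|Hk].
- assert (0 <= rsum l f) by (apply rsum_nonneg; intros; apply H; now right). lra.
- assert (0 <= f x) by (apply H; now left).
  assert (f k <= rsum l f) by (apply IH; auto; intros; apply H; now right). lra.
Qed.

Lemma Cmod_csum_le l f : Cmod (csum l f) <= rsum l (fun x => Cmod (f x)).
Proof.
induction l as [|x l IH]; simpl; [rewrite Cmod_0; lra|].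
eapply Rle_trans; [apply Cmod_triangle|lra].
Qed.

Lemma In_zrange N l : In l (zrange N) <-> (Z.abs l <= Z.of_nat N)%Z.
Proof.
induction N as [|N IH]; cbn [zrange In]; [lia|]. rewrite IH. lia.
Qed.

Lemma NoDup_zrange N : NoDup (zrange N).
Proof.
induction N as [|N IH]; cbn [zrange].
- repeat constructor; auto.
- constructor; [|constructor; auto].
  + simpl. rewrite In_zrange. lia.
  + rewrite In_zrange. lia.
Qed.

(** The weight in which all decay is measured; unlike |z| it never vanishes, and it is submultiplicative
    ([jb_peetre]). *)
Definition jb (z : Z) : R := 1 + IZR (Z.abs z).

Lemma jb_ge1 z : 1 <= jb z.
Proof. unfold jb. assert (0 <= IZR (Z.abs z)) by (apply IZR_le; lia). lra. Qed.

Lemma jb_pos z : 0 < jb z.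
Proof. pose proof (jb_ge1 z); lra. Qed.

Lemma jb_abs z : IZR (Z.abs z) <= jb z.
Proof. unfold jb; lra. Qed.

Lemma jb_peetre i l : jb i <= jb l * jb (i - l).
Proof.
unfold jb. assert (IZR (Z.abs i) <= IZR (Z.abs l) + IZR (Z.abs (i - l))) by (rewrite <- plus_IZR; apply IZR_le; lia).
assert (0 <= IZR (Z.abs l)) by (apply IZR_le; lia).
assert (0 <= IZR (Z.abs (i-l))) by (apply IZR_le; lia). nra.
Qed.

Lemma jb_sub_sym i j : jb (i - j) = jb (j - i).
Proof. unfold jb. do 2 f_equal. lia. Qed.

Lemma jb_pow_ge1 z k : 1 <= jb z ^ k.
Proof. apply pow_R1_Rle, jb_ge1. Qed.

Lemma jb_pow_pos z k : 0 < jb z ^ k.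
Proof. pose proof (jb_pow_ge1 z k); lra. Qed.

Lemma jb_pow_mono z k k' : (k <= k')%nat -> jb z ^ k <= jb z ^ k'.
Proof. intros; apply Rle_pow; auto; apply jb_ge1. Qed.

Lemma jb_peetre_pow i l k : jb i ^ k <= jb l ^ k * jb (i - l) ^ k.
Proof.
rewrite <- Rpow_mult_distr. apply pow_incr. split; [|apply jb_peetre].
pose proof (jb_pos i); lra.
Qed.

Lemma jb_opp z : jb (- z) = jb z.
Proof. unfold jb. now rewrite Z.abs_opp. Qed.

Lemma jb_nat n : jb (Z.of_nat n) = INR (S n).
Proof. unfold jb. rewrite Z.abs_eq by lia. rewrite S_INR, (INR_IZR_INZ n). apply Rplus_comm. Qed.

(** Makes the tails of the sums of [/ jb l ^ 2] telescope, which yields the explicit rate in [tail_csum]. *)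
Lemma inv_sq_telescope n : / INR (S (S n)) ^ 2 <= / INR (S n) - / INR (S (S n)).
Proof.
pose proof (pos_INR n). rewrite !S_INR.
replace (/ (INR n + 1) - / (INR n + 1 + 1)) with (/ ((INR n + 1) * (INR n + 1 + 1))) by (field; lra).
apply Rinv_le_contravar; nra.
Qed.

Lemma rsum_jb_bound N : rsum (zrange N) (fun l => / jb l ^ 2) <= 3.
Proof.
cut (rsum (zrange N) (fun l => / jb l ^ 2) <= 3 - 2 / INR (S N)).
{ intros H; assert (0 < / INR (S N)) by (apply Rinv_0_lt_compat, lt_0_INR; lia). unfold Rdiv in H; lra. }
induction N as [|N IH]; cbn [zrange rsum].
- unfold jb; simpl; lra.
- rewrite jb_opp, jb_nat. pose proof (inv_sq_telescope N). unfold Rdiv in *; lra.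
Qed.

Definition Clim (u : nat -> C) (x : C) : Prop :=
  is_lim_seq (fun n => Re (u n)) (Re x) /\ is_lim_seq (fun n => Im (u n)) (Im x).

Lemma Rabs_Re_le z : Rabs (Re z) <= Cmod z.
Proof. eapply Rle_trans; [|apply Rmax_Cmod]. apply Rmax_l. Qed.
Lemma Rabs_Im_le z : Rabs (Im z) <= Cmod z.
Proof. eapply Rle_trans; [|apply Rmax_Cmod]. apply Rmax_r. Qed.

Lemma Cmod_le_sum z : Cmod z <= Rabs (Re z) + Rabs (Im z).
Proof.
replace z with (RtoC (Re z) + Ci * RtoC (Im z))%C at 1
 by (destruct z; unfold RtoC, Ci, Cplus, Cmult; simpl; f_equal; ring).
eapply Rle_trans; [apply Cmod_triangle|]. rewrite Cmod_mult, !Cmod_R.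
replace (Cmod Ci) with 1; [lra|]. unfold Cmod, Ci; simpl. transitivity (sqrt 1); [now rewrite sqrt_1|f_equal; ring].
Qed.

Lemma Clim_eps u x : Clim u x <-> (forall eps, 0 < eps -> exists N, forall n, (N <= n)%nat -> Cmod (u n - x) < eps).
Proof.
split.
- intros [H1 H2] e He.
  destruct (proj2 (is_lim_seq_spec _ _) H1 (mkposreal (e/2) ltac:(lra))) as [N1 K1].
  destruct (proj2 (is_lim_seq_spec _ _) H2 (mkposreal (e/2) ltac:(lra))) as [N2 K2].
  exists (max N1 N2). intros n Hn. specialize (K1 n ltac:(lia)); specialize (K2 n ltac:(lia)). simpl in *.
  eapply Rle_lt_trans; [apply Cmod_le_sum|]. change (Re (u n - x)) with (Re (u n) - Re x). change (Im (u n - x)) with (Im (u n) - Im x).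
  lra.
- intros H; split; apply is_lim_seq_spec; intros e; destruct (H e (cond_pos e)) as [N K]; exists N; intros n Hn;
   specialize (K n Hn); eapply Rle_lt_trans; try apply K.
  + apply (Rabs_Re_le (u n - x)).
  + apply (Rabs_Im_le (u n - x)).
Qed.

Lemma Clim_const x : Clim (fun _ => x) x.
Proof. split; apply is_lim_seq_const. Qed.

Lemma Clim_plus u v x y : Clim u x -> Clim v y -> Clim (fun n => (u n + v n)%C) (x + y)%C.
Proof. intros [] []; split; simpl; now apply is_lim_seq_plus'. Qed.

Lemma Clim_minus u v x y : Clim u x -> Clim v y -> Clim (fun n => (u n - v n)%C) (x - y)%C.
Proof. intros [] []; split; simpl; now apply is_lim_seq_minus'. Qed.

Lemma is_lim_seq_scal_l' u (a l : R) : is_lim_seq u l -> is_lim_seq (fun n => a * u n) (a * l).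
Proof. intros H. apply (is_lim_seq_scal_l u a l H). Qed.

Lemma Clim_mult_l c u x : Clim u x -> Clim (fun n => (c * u n)%C) (c * x)%C.
Proof.
intros [H1 H2]; split; simpl.
- apply is_lim_seq_minus'; now apply is_lim_seq_scal_l'.
- apply is_lim_seq_plus'; now apply is_lim_seq_scal_l'.
Qed.

Lemma Clim_ext_loc u v x : (exists N, forall n, (N <= n)%nat -> u n = v n) -> Clim u x -> Clim v x.
Proof.
intros [N H] [H1 H2]; split; (eapply is_lim_seq_ext_loc; [|eassumption]); exists N; intros; now rewrite H.
Qed.

Lemma Clim_unique u x y : Clim u x -> Clim u y -> x = y.
Proof.
intros [H1 H2] [H3 H4]. apply is_lim_seq_unique in H1, H2, H3, H4.
rewrite H1 in H3; rewrite H2 in H4. destruct x, y; simpl in *. congruence.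
Qed.

Lemma Clim_csum l (f : nat -> Z -> C) g :
  (forall x, In x l -> Clim (fun n => f n x) (g x)) -> Clim (fun n => csum l (f n)) (csum l g).
Proof.
induction l as [|x l IH]; intros H; simpl; [apply Clim_const|].
apply Clim_plus; [apply H; now left|apply IH; intros; apply H; now right].
Qed.

Lemma Clim_Cmod_le u x B : Clim u x -> (forall n, Cmod (u n) <= B) -> Cmod x <= B.
Proof.
intros H HB. apply le_epsilon. intros e He.
destruct (proj1 (Clim_eps _ _) H e He) as [N K]. specialize (K N (le_n _)).
replace x with (u N - (u N - x))%C by ring. unfold Cminus at 1.
eapply Rle_trans; [apply Cmod_triangle|]. rewrite Cmod_opp. specialize (HB N). lra.
Qed.

Lemma bound_nonneg f B : (forall l, Cmod (f l) <= B / jb l ^ 2) -> 0 <= B.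
Proof.
intros H. specialize (H 0%Z). unfold jb in H. simpl in H. pose proof (Cmod_ge_0 (f 0%Z)).
    unfold Rdiv in H. replace (/ ((1+0) * ((1+0)*1))) with 1 in H by field. lra.
Qed.

Lemma tail_csum f B M N : (forall l, Cmod (f l) <= B / jb l ^ 2) -> (M <= N)%nat ->
  Cmod (csum (zrange N) f - csum (zrange M) f) <= 2 * B * (/ INR (S M) - / INR (S N)).
Proof.
intros H HMN. induction HMN as [|N HMN IH].
- unfold Cminus; rewrite Cplus_opp_r, Cmod_0. lra.
- cbn [zrange csum].
  set (p := Z.of_nat (S N)) in *.
  replace (f p + (f (- p)%Z + csum (zrange N) f) - csum (zrange M) f)%C
    with (f p + (f (-p)%Z + (csum (zrange N) f - csum (zrange M) f)))%C by ring.
  eapply Rle_trans; [apply Cmod_triangle|]. eapply Rle_trans; [apply Rplus_le_compat_l, Cmod_triangle|].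
  pose proof (H p) as H1. pose proof (H (-p)%Z) as H2. rewrite jb_opp in H2.
  assert (jb p = INR (S (S N))) as Ep by apply jb_nat. rewrite Ep in *.
  pose proof (inv_sq_telescope N) as HT.
  pose proof (bound_nonneg f B H).
  assert (B / INR (S (S N)) ^ 2 <= B * (/ INR (S N) - / INR (S (S N)))) by (unfold Rdiv; apply Rmult_le_compat_l; auto).
  lra.
Qed.

Lemma tail_csum' f B M N : (forall l, Cmod (f l) <= B / jb l ^ 2) -> (M <= N)%nat ->
  Cmod (csum (zrange N) f - csum (zrange M) f) <= 2 * B / INR (S M).
Proof.
intros H HMN. eapply Rle_trans; [now apply (tail_csum f B)|].
pose proof (bound_nonneg f B H). assert (0 < / INR (S N)) by (apply Rinv_0_lt_compat, lt_0_INR; lia).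
unfold Rdiv. apply Rmult_le_compat_l; lra.
Qed.

Lemma ex_series_inv_sq : ex_series (fun k => / INR (S k) ^ 2).
Proof.
apply ex_series_incr_1.
apply (@ex_series_le R_AbsRing R_CompleteNormedModule _ (fun n => / INR (S n) - / INR (S (S n)))).
- intros n. unfold norm; simpl. unfold abs; simpl. rewrite Rabs_right.
  + apply inv_sq_telescope.
  + apply Rle_ge, Rlt_le, Rinv_0_lt_compat. apply (pow_lt (INR (S (S n))) 2), lt_0_INR; lia.
- exists 1. change (is_lim_seq (sum_n (fun n => / INR (S n) - / INR (S (S n)))) 1).
  apply is_lim_seq_ext with (fun n => 1 - / INR (S (S n))).
  + intros n. induction n as [|n IH].
    * rewrite sum_O; simpl; lra.
    * rewrite sum_Sn, <- IH. unfold plus; simpl. lra.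
  + replace (Finite 1) with (Finite (1 - 0)) by (f_equal; ring).
    apply is_lim_seq_minus'; [apply is_lim_seq_const|].
    apply is_lim_seq_spec. intros e. destruct (archimed_cor1 e (cond_pos e)) as [N [H1 H2]].
    exists N. intros n Hn. rewrite Rminus_0_r, Rabs_right.
    * eapply Rle_lt_trans; [|apply H1]. apply Rinv_le_contravar; [apply lt_0_INR; lia|apply le_INR; lia].
    * apply Rle_ge, Rlt_le, Rinv_0_lt_compat, lt_0_INR; lia.
Qed.

Lemma ex_series_bound (g : nat -> R) B : (forall k, Rabs (g k) <= B / INR (S k) ^ 2) -> ex_series g.
Proof.
intros H. apply (@ex_series_le R_AbsRing R_CompleteNormedModule _ (fun k => B * / INR (S k) ^ 2)).
- intros n; apply H.
- apply (ex_series_scal_l (V := R_NormedModule) B (fun k => / INR (S k) ^ 2)), ex_series_inv_sq.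
Qed.

Lemma Clim_CSeries (g : nat -> C) B : (forall k, Cmod (g k) <= B / INR (S k) ^ 2) ->
  Clim (fun n => (sum_n (fun k => Re (g k)) n, sum_n (fun k => Im (g k)) n)) (CSeries g).
Proof.
intros H. split; simpl; apply Series_correct; apply ex_series_bound with B; intros k.
- eapply Rle_trans; [apply Rabs_Re_le|auto].
- eapply Rle_trans; [apply Rabs_Im_le|auto].
Qed.

Lemma bound_shift f B k : (forall l, Cmod (f l) <= B / jb l ^ 2) -> Cmod (f (- Z.of_nat (S k))%Z) <= B / INR (S k) ^ 2.
Proof.
intros H. pose proof (bound_nonneg f B H). eapply Rle_trans; [apply H|].
rewrite jb_opp, jb_nat. unfold Rdiv. apply Rmult_le_compat_l; auto.
apply Rinv_le_contravar; [apply pow_lt, lt_0_INR; lia|].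
apply pow_incr. split; [apply pos_INR|apply le_INR; lia].
Qed.

(** Under absolute convergence the one-sided sums in [ZSeries] can be recombined into symmetric ones. *)
Lemma Clim_ZSeries f B : (forall l, Cmod (f l) <= B / jb l ^ 2) ->
  Clim (fun N => csum (zrange N) f) (ZSeries f).
Proof.
intros H.
assert (H1 := Clim_CSeries (fun k => f (Z.of_nat k)) B (fun k => eq_ind _ (fun x => Cmod (f (Z.of_nat k)) <= B / x ^ 2) (H _) _ (jb_nat k))).
assert (H2 := Clim_CSeries (fun k => f (- Z.of_nat (S k))%Z) B (fun k => bound_shift f B k H)).
assert (Clim (fun N => csum (zrange (S N)) f) (ZSeries f)).
{ assert (Clim (fun N => f (Z.of_nat (S N))) (RtoC 0)) as H3.
  { apply Clim_eps. intros e He. pose proof (bound_nonneg f B H) as HB.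
    destruct (archimed_cor1 (e / (B + 1))) as [N [K1 K2]]; [apply Rdiv_lt_0_compat; lra|].
    exists N. intros n Hn. unfold Cminus. rewrite <- RtoC_opp, Ropp_0, Cplus_0_r.
    eapply Rle_lt_trans; [apply H|]. rewrite jb_nat.
    assert (1 <= INR (S (S n))) by (change 1 with (INR 1); apply le_INR; lia).
    assert (0 < INR N) by (apply lt_0_INR; lia).
    assert (INR N <= INR (S (S n))) by (apply le_INR; lia).
    assert (/ INR (S (S n)) ^ 2 <= / INR N) by (apply Rinv_le_contravar; auto; nra).
    apply Rle_lt_trans with ((B + 1) * / INR N).
    - unfold Rdiv. assert (0 < / INR N) by now apply Rinv_0_lt_compat.
      assert (0 < / INR (S (S n)) ^ 2) by (apply Rinv_0_lt_compat; nra). nra.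
    - apply Rmult_lt_reg_l with (/ (B+1)); [apply Rinv_0_lt_compat; lra|].
      rewrite <- Rmult_assoc, Rinv_l, Rmult_1_l by lra. rewrite Rmult_comm. apply K1. }
  pose proof (Clim_plus _ _ _ _ (Clim_plus _ _ _ _ H1 H2) H3) as H4.
  unfold ZSeries. rewrite Cplus_0_r in H4.
  eapply Clim_ext_loc; [|apply H4]. exists 0%nat. intros n _.
  cbn [zrange csum].
  replace (csum (zrange n) f) with
     ((sum_n (fun k => Re (f (Z.of_nat k))) n, sum_n (fun k => Im (f (Z.of_nat k))) n) +
      (sum_n (fun k => Re (f (- Z.of_nat (S k))%Z)) n, sum_n (fun k => Im (f (- Z.of_nat (S k))%Z)) n)
      - f (- Z.of_nat (S n))%Z)%C; [ring|].
  induction n as [|n IH].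
  - rewrite !sum_O. cbn [zrange csum]. change (Z.of_nat 0) with 0%Z.
    destruct (f 0%Z), (f (- Z.of_nat 1)%Z). unfold Cminus, Cplus, Copp, RtoC; simpl. f_equal; ring.
  - cbn [zrange csum]. rewrite <- IH. rewrite !sum_Sn.
    destruct (f (- Z.of_nat (S n))%Z), (f (- Z.of_nat (S (S n)))%Z), (f (Z.of_nat (S n))).
    unfold Cminus, Cplus, Copp, plus; simpl. f_equal; ring. }
destruct H0 as [K1 K2]. split; [apply (is_lim_seq_incr_1 (fun N => Re (csum (zrange N) f)))|apply (is_lim_seq_incr_1 (fun N => Im (csum (zrange N) f)))]; auto.
Qed.

Lemma inv_INR_small e : 0 < e -> exists M, forall n, (M <= n)%nat -> / INR (S n) < e.
Proof.
intros He. destruct (archimed_cor1 e He) as [N [K1 K2]]. exists N. intros n Hn.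
eapply Rle_lt_trans; [|apply K1]. apply Rinv_le_contravar; [apply lt_0_INR; lia|apply le_INR; lia].
Qed.

(** Dominated convergence for series (Tannery's theorem): both tails are small by [tail_csum'], and on a
    fixed range the convergence is that of a finite sum.  The length of the sum grows with [N] as well, so
    the bound is only asked for in the range of summation. *)
Lemma tannery (f : nat -> Z -> C) g B :
  (forall N l, (Z.abs l <= Z.of_nat N)%Z -> Cmod (f N l) <= B / jb l ^ 2) ->
  (forall l, Clim (fun N => f N l) (g l)) ->
  Clim (fun N => csum (zrange N) (f N)) (ZSeries g).
Proof.
intros H Hl.
set (f' := fun N l => if Z_le_dec (Z.abs l) (Z.of_nat N) then f N l else RtoC 0).
assert (HB0 : 0 <= B).
{ specialize (H 0%nat 0%Z ltac:(simpl; lia)). unfold jb in H. simpl in H. pose proof (Cmod_ge_0 (f 0%nat 0%Z)).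
    unfold Rdiv in H. replace (/ ((1+0) * ((1+0)*1))) with 1 in H by field. lra. }
assert (H' : forall N l, Cmod (f' N l) <= B / jb l ^ 2).
{ intros N l. unfold f'. destruct Z_le_dec; [now apply H|]. rewrite Cmod_0.
  apply Rmult_le_pos; auto. apply Rlt_le, Rinv_0_lt_compat, jb_pow_pos. }
assert (Hl' : forall l, Clim (fun N => f' N l) (g l)).
{ intros l. eapply Clim_ext_loc; [|apply Hl]. exists (Z.to_nat (Z.abs l)). intros n Hn.
  unfold f'. destruct Z_le_dec; [easy|lia]. }
assert (Hg : forall l, Cmod (g l) <= B / jb l ^ 2) by (intros l; eapply Clim_Cmod_le; [apply Hl'|intros; apply H']).
apply Clim_ext_loc with (fun N => csum (zrange N) (f' N)).
{ exists 0%nat. intros n _. apply csum_ext. intros x Hx. apply In_zrange in Hx. unfold f'. now destruct Z_le_dec. }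
apply Clim_eps. intros e He.
destruct (inv_INR_small (e / (8 * (B + 1)))) as [M HM]; [apply Rdiv_lt_0_compat; lra|].
specialize (HM M (le_n _)).
assert (HT : 2 * B / INR (S M) < e / 4).
{ assert (0 < / INR (S M)) by (apply Rinv_0_lt_compat, lt_0_INR; lia).
  assert ((8 * (B+1)) * / INR (S M) < e).
  { apply Rmult_lt_reg_l with (/ (8*(B+1))); [apply Rinv_0_lt_compat; lra|].
    rewrite <- Rmult_assoc, Rinv_l, Rmult_1_l by lra. rewrite Rmult_comm. apply HM. }
  unfold Rdiv. lra. }
destruct (proj1 (Clim_eps _ _) (Clim_csum (zrange M) f' g (fun x _ => Hl' x)) (e/4) ltac:(lra)) as [N1 K1].
destruct (proj1 (Clim_eps _ _) (Clim_ZSeries g B Hg) (e/4) ltac:(lra)) as [N2 K2].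
exists (max (max N1 N2) M). intros n Hn.
specialize (K1 n ltac:(lia)). specialize (K2 n ltac:(lia)).
pose proof (tail_csum' (f' n) B M n (H' n) ltac:(lia)) as T1.
pose proof (tail_csum' g B M n Hg ltac:(lia)) as T2.
replace (csum (zrange n) (f' n) - ZSeries g)%C with
 ((csum (zrange n) (f' n) - csum (zrange M) (f' n)) + ((csum (zrange M) (f' n) - csum (zrange M) g)
  + (- (csum (zrange n) g - csum (zrange M) g) + (csum (zrange n) g - ZSeries g))))%C by ring.
eapply Rle_lt_trans; [apply Cmod_triangle|].
eapply Rle_lt_trans; [apply Rplus_le_compat_l, Cmod_triangle|].
eapply Rle_lt_trans; [apply Rplus_le_compat_l, Rplus_le_compat_l, Cmod_triangle|].
rewrite Cmod_opp. lra.
Qed.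

Lemma jb_nonneg z : 0 <= jb z.
Proof. apply Rlt_le, jb_pos. Qed.
Lemma jb_pow_nonneg z k : 0 <= jb z ^ k.
Proof. apply Rlt_le, jb_pow_pos. Qed.
Lemma wt_ge0 l : 0 <= IZR (Z.abs l).
Proof. apply IZR_le; lia. Qed.

Ltac nonneg := repeat first [assumption | apply Cmod_ge_0 | apply jb_pow_nonneg | apply jb_nonneg | apply wt_ge0
  | apply pow2_ge_0 | apply Rmult_le_pos | lra].

(** * Traces of words in two kernels *)

Definition wt (l : Z) : C := RtoC (IZR (Z.abs l)).

(** The sign takes the value 1 at 0 so that it squares to 1 everywhere; the weight kills the frequency 0
    in all products and traces. *)
Definition sg (z : Z) : R := if Z_lt_dec z 0 then -1 else 1.

Lemma sg_sq z : sg z * sg z = 1.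
Proof. unfold sg; destruct Z_lt_dec; ring. Qed.


Lemma wt_ge1 l : l <> 0%Z -> 1 <= IZR (Z.abs l).
Proof. intros; apply IZR_le; lia. Qed.

Lemma Re_RtoC_mult r z : Re (RtoC r * z)%C = r * Re z.
Proof. destruct z; simpl; ring. Qed.

Lemma Cmult_conj_R z : (z * Cconj z)%C = RtoC (Cmod z ^ 2).
Proof.
destruct z as [x y]. unfold Cmod. rewrite pow2_sqrt by (apply Rplus_le_le_0_compat; apply pow2_ge_0).
unfold Cconj, Cmult, RtoC; simpl. f_equal; ring.
Qed.

Lemma Cconj_plus z w : Cconj (z + w)%C = (Cconj z + Cconj w)%C.
Proof. unfold Cconj, Cplus; simpl; f_equal; ring. Qed.
Lemma Cconj_mult z w : Cconj (z * w)%C = (Cconj z * Cconj w)%C.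
Proof. unfold Cconj, Cmult; simpl; f_equal; ring. Qed.
Lemma Cconj_RtoC r : Cconj (RtoC r) = RtoC r.
Proof. unfold Cconj, RtoC; simpl; f_equal; ring. Qed.
Lemma Cconj_wt l : Cconj (wt l) = wt l.
Proof. apply Cconj_RtoC. Qed.
Lemma Cconj_invol z : Cconj (Cconj z) = z.
Proof. destruct z; unfold Cconj; simpl; f_equal; ring. Qed.

Lemma RtoC_m1 : RtoC (-1) = (- RtoC 1)%C.
Proof. rewrite <- RtoC_opp; reflexivity. Qed.
Lemma RtoC_two : RtoC 2 = (RtoC 1 + RtoC 1)%C.
Proof. rewrite <- RtoC_plus; f_equal; ring. Qed.

Definition kernel := Z -> Z -> C.
Definition kminus (A B : kernel) : kernel := fun i j => (A i j - B i j)%C.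
Definition kplus (A B : kernel) : kernel := fun i j => (A i j + B i j)%C.
Definition kscal (c : R) (A : kernel) : kernel := fun i j => (RtoC c * A i j)%C.
Definition kadj (A : kernel) : kernel := fun i j => Cconj (A j i).
(** Conjugation by the sign operator D / Lambda; it exchanges A and A'. *)
Definition kflip (A : kernel) : kernel := fun i j => (RtoC (sg i * sg j) * A i j)%C.

Lemma kernel_ext (A B : kernel) : (forall i j, A i j = B i j) -> A = B.
Proof. intros H; apply functional_extensionality; intros i; apply functional_extensionality; auto. Qed.

Lemma kflip_invol A : kflip (kflip A) = A.
Proof.
apply kernel_ext; intros i j; unfold kflip. rewrite Cmult_assoc, <- RtoC_mult.
replace (sg i * sg j * (sg i * sg j)) with (sg i * sg i * (sg j * sg j)) by ring. rewrite !sg_sq, Rmult_1_l. ring.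
Qed.
Lemma kflip_minus A B : kflip (kminus A B) = kminus (kflip A) (kflip B).
Proof. apply kernel_ext; intros; unfold kflip, kminus; ring. Qed.
Lemma kflip_adj A : kflip (kadj A) = kadj (kflip A).
Proof. apply kernel_ext; intros; unfold kflip, kadj. rewrite Cconj_mult, Cconj_RtoC, (Rmult_comm (sg j)); ring. Qed.
Lemma kadj_invol A : kadj (kadj A) = A.
Proof. apply kernel_ext; intros; unfold kadj; apply Cconj_invol. Qed.
Lemma kadj_minus A B : kadj (kminus A B) = kminus (kadj A) (kadj B).
Proof.
apply kernel_ext; intros; unfold kadj, kminus, Cminus. rewrite Cconj_plus. unfold Cconj, Copp, Cplus; simpl; f_equal; ring.
Qed.

Section Trace.
Variable idx : list Z.

(** The weight |l| plays the role of conjugating by Lambda^{1/2}, without square roots: for this product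
    and the trace below, K |-> K K^* is positive and the truncated multiplication operator is self-adjoint. *)
Definition kmul (A B : kernel) : kernel := fun i j => csum idx (fun l => (A i l * wt l * B l j)%C).
Definition ktr (A : kernel) : C := csum idx (fun i => (wt i * A i i)%C).
Definition tau (A : kernel) : R := Re (ktr A).

Lemma kmul_assoc A B D : kmul A (kmul B D) = kmul (kmul A B) D.
Proof.
apply kernel_ext; intros i j; unfold kmul.
transitivity (csum idx (fun l => csum idx (fun k => (A i l * wt l * B l k * wt k * D k j)%C))).
- apply csum_ext; intros l _. rewrite <- csum_mult_l. apply csum_ext; intros; ring.
- rewrite csum_swap. apply csum_ext; intros k _.
  rewrite <- !csum_mult_r. apply csum_ext; intros; ring.
Qed.

Lemma kmul_minus_l A B D : kmul (kminus A B) D = kminus (kmul A D) (kmul B D).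
Proof.
apply kernel_ext; intros i j; unfold kmul, kminus. rewrite <- csum_minus. apply csum_ext; intros; ring.
Qed.
Lemma kmul_minus_r A B D : kmul D (kminus A B) = kminus (kmul D A) (kmul D B).
Proof.
apply kernel_ext; intros i j; unfold kmul, kminus. rewrite <- csum_minus. apply csum_ext; intros; ring.
Qed.
Lemma kmul_adj A B : kadj (kmul A B) = kmul (kadj B) (kadj A).
Proof.
apply kernel_ext; intros i j; unfold kmul, kadj. rewrite csum_conj.
apply csum_ext; intros. rewrite !Cconj_mult, Cconj_wt. ring.
Qed.
Lemma kmul_flip A B : kflip (kmul A B) = kmul (kflip A) (kflip B).
Proof.
apply kernel_ext; intros i j; unfold kmul, kflip. rewrite <- csum_mult_l.
apply csum_ext; intros l _.
replace (sg i * sg j) with ((sg i * sg l) * (sg l * sg j)) by (transitivity (sg i * (sg l * sg l) * sg j); [ring|rewrite sg_sq; ring]).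
rewrite RtoC_mult. ring.
Qed.

Lemma ktr_minus A B : ktr (kminus A B) = (ktr A - ktr B)%C.
Proof. unfold ktr, kminus. rewrite <- csum_minus. apply csum_ext; intros; ring. Qed.
Lemma tau_minus A B : tau (kminus A B) = tau A - tau B.
Proof. unfold tau. rewrite ktr_minus. reflexivity. Qed.
Lemma ktr_cyclic A B : ktr (kmul A B) = ktr (kmul B A).
Proof.
unfold ktr, kmul.
transitivity (csum idx (fun i => csum idx (fun l => (wt i * A i l * wt l * B l i)%C))).
- apply csum_ext; intros. rewrite <- csum_mult_l. apply csum_ext; intros; ring.
- rewrite csum_swap. apply csum_ext; intros. rewrite <- csum_mult_l. apply csum_ext; intros; ring.
Qed.
Lemma tau_cyclic A B : tau (kmul A B) = tau (kmul B A).
Proof. unfold tau. now rewrite ktr_cyclic. Qed.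
Lemma ktr_adj A : ktr (kadj A) = Cconj (ktr A).
Proof.
unfold ktr, kadj. rewrite csum_conj. apply csum_ext; intros. now rewrite Cconj_mult, Cconj_wt.
Qed.
Lemma tau_adj A : tau (kadj A) = tau A.
Proof. unfold tau. now rewrite ktr_adj. Qed.
Lemma ktr_flip A : ktr (kflip A) = ktr A.
Proof.
unfold ktr, kflip. apply csum_ext; intros. rewrite sg_sq. ring.
Qed.
Lemma tau_flip A : tau (kflip A) = tau A.
Proof. unfold tau. now rewrite ktr_flip. Qed.

Definition ip (A B : kernel) : R := tau (kmul A (kadj B)).
Definition nrm2 (A : kernel) : R := ip A A.

Lemma ip_sym A B : ip A B = ip B A.
Proof. unfold ip. rewrite <- tau_adj, kmul_adj, kadj_invol. reflexivity. Qed.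

(** The squared norm is a weighted Hilbert-Schmidt norm; this is where positivity comes from. *)
Lemma nrm2_sum A : nrm2 A = rsum idx (fun i => rsum idx (fun l => IZR (Z.abs i) * IZR (Z.abs l) * Cmod (A i l) ^ 2)).
Proof.
unfold nrm2, ip, tau, ktr. rewrite Re_csum. apply rsum_ext; intros i _.
unfold wt. rewrite Re_RtoC_mult. unfold kmul. rewrite Re_csum, <- rsum_scal.
apply rsum_ext; intros l _. unfold kadj, wt.
replace (A i l * RtoC (IZR (Z.abs l)) * Cconj (A i l))%C with (RtoC (IZR (Z.abs l)) * (A i l * Cconj (A i l)))%C by ring.
rewrite Re_RtoC_mult, Cmult_conj_R. simpl. ring.
Qed.

Lemma nrm2_nonneg A : 0 <= nrm2 A.
Proof.
rewrite nrm2_sum. apply rsum_nonneg; intros; apply rsum_nonneg; intros.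
apply Rmult_le_pos; [apply Rmult_le_pos; apply wt_ge0|apply pow2_ge_0].
Qed.

Lemma nrm2_entry A i j : In i idx -> In j idx -> i <> 0%Z -> j <> 0%Z -> Cmod (A i j) ^ 2 <= nrm2 A.
Proof.
intros Hi Hj Hi0 Hj0. rewrite nrm2_sum.
apply Rle_trans with (rsum idx (fun l => IZR (Z.abs i) * IZR (Z.abs l) * Cmod (A i l) ^ 2)).
- apply Rle_trans with (IZR (Z.abs i) * IZR (Z.abs j) * Cmod (A i j) ^ 2).
  + pose proof (wt_ge1 i Hi0); pose proof (wt_ge1 j Hj0). pose proof (pow2_ge_0 (Cmod (A i j))).
    rewrite <- (Rmult_1_l (Cmod (A i j) ^ 2)) at 1. apply Rmult_le_compat_r; auto. nra.
  + apply (rsum_term_le idx (fun l => IZR (Z.abs i) * IZR (Z.abs l) * Cmod (A i l) ^ 2)); auto.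
    intros; apply Rmult_le_pos; [apply Rmult_le_pos; apply wt_ge0|apply pow2_ge_0].
- apply (rsum_term_le idx (fun i => rsum idx (fun l => IZR (Z.abs i) * IZR (Z.abs l) * Cmod (A i l) ^ 2))); auto.
  intros; apply rsum_nonneg; intros. apply Rmult_le_pos; [apply Rmult_le_pos; apply wt_ge0|apply pow2_ge_0].
Qed.

Lemma ip_minus_l A B D : ip (kminus A B) D = ip A D - ip B D.
Proof. unfold ip. now rewrite kmul_minus_l, tau_minus. Qed.
Lemma ip_minus_r A B D : ip D (kminus A B) = ip D A - ip D B.
Proof. rewrite ip_sym, ip_minus_l, (ip_sym D A), (ip_sym D B). reflexivity. Qed.

Lemma nrm2_minus A B : nrm2 (kminus A B) = nrm2 A + nrm2 B - 2 * ip A B.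
Proof. unfold nrm2. rewrite ip_minus_l, !ip_minus_r, (ip_sym B A). ring. Qed.

Lemma ip_scal_l c A B : ip (kscal c A) B = c * ip A B.
Proof.
unfold ip, tau. rewrite <- Re_RtoC_mult. f_equal. unfold ktr, kmul, kscal.
rewrite <- csum_mult_l. apply csum_ext; intros. rewrite (Cmult_comm (RtoC c)), <- Cmult_assoc, <- csum_mult_r.
f_equal. apply csum_ext; intros; ring.
Qed.
Lemma kmul_scal_r c A B : kmul A (kscal c B) = kscal c (kmul A B).
Proof.
apply kernel_ext; intros i j; unfold kmul, kscal. rewrite <- csum_mult_l. apply csum_ext; intros; ring.
Qed.
Lemma ip_scal_r c A B : ip A (kscal c B) = c * ip A B.
Proof. now rewrite ip_sym, ip_scal_l, ip_sym. Qed.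

(** Expand the norm of [x A - y B] and choose [x = nrm2 B], [y = ip A B]. *)
Lemma ip_cauchy_schwarz A B : ip A B ^ 2 <= nrm2 A * nrm2 B.
Proof.
assert (H : forall x y, 0 <= x * x * nrm2 A + y * y * nrm2 B - 2 * (x * y) * ip A B).
{ intros x y. pose proof (nrm2_nonneg (kminus (kscal x A) (kscal y B))) as H.
  rewrite nrm2_minus in H. unfold nrm2 in *. rewrite !ip_scal_l, !ip_scal_r in H. lra. }
pose proof (nrm2_nonneg A) as HA. pose proof (nrm2_nonneg B) as HB.
revert HA HB H. generalize (nrm2 A) (nrm2 B) (ip A B). intros a b c HA HB H.
destruct (Req_dec b 0) as [Hb|Hb].
- destruct (Req_dec c 0) as [Hc|Hc]; [rewrite Hb, Hc; lra|].
  specialize (H 1 ((a + 1) / (2 * c))).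
  replace (2 * (1 * ((a + 1) / (2 * c))) * c) with (a + 1) in H by (field; auto). rewrite Hb in H. lra.
- specialize (H b c). assert (0 < b) by lra.
  assert (0 <= b * (a * b - c ^ 2)) by nra.
  assert (0 <= a * b - c ^ 2); [|lra].
  apply Rmult_le_reg_l with b; lra.
Qed.

Lemma nrm2_minus_le A B : nrm2 (kminus A B) <= 2 * nrm2 A + 2 * nrm2 B.
Proof.
pose proof (nrm2_nonneg (kminus A (kscal (-1) B))) as H. rewrite nrm2_minus in H. rewrite nrm2_minus.
unfold nrm2 in *. rewrite ip_scal_l, !ip_scal_r in H. lra.
Qed.

Lemma nrm2_flip A : nrm2 (kflip A) = nrm2 A.
Proof. unfold nrm2, ip. now rewrite <- kflip_adj, <- kmul_flip, tau_flip. Qed.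

Variable S0 : kernel.
Hypothesis S0_adj : kadj S0 = S0.

(** A word in A (here [S0]) and A' is a list of booleans, [true] standing for A'. *)
Definition letter (b : bool) : kernel := if b then kflip S0 else S0.

(** The weighted product has no unit on the kernels, so the product of a word is only meaningful for
    non-empty words; the value at the empty word is arbitrary. *)
Fixpoint wprod (w : list bool) : kernel :=
  match w with
  | nil => S0
  | b :: w' => match w' with nil => letter b | _ => kmul (letter b) (wprod w') end
  end.

Lemma wprod_cons b w : w <> nil -> wprod (b :: w) = kmul (letter b) (wprod w).
Proof. destruct w; [easy|auto]. Qed.

Lemma wprod_app u v : u <> nil -> v <> nil -> wprod (u ++ v) = kmul (wprod u) (wprod v).
Proof.
induction u as [|b u IH]; intros Hu Hv; [easy|].
destruct u as [|c u].
- simpl app. now apply wprod_cons.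
- change ((b :: c :: u) ++ v) with (b :: (c :: u) ++ v).
  rewrite wprod_cons, IH by (auto; easy). rewrite (wprod_cons b (c :: u)) by easy.
  apply kmul_assoc.
Qed.

Lemma letter_adj b : kadj (letter b) = letter b.
Proof. destruct b; simpl; auto. rewrite <- kflip_adj. now rewrite S0_adj. Qed.

Lemma app_not_nil {A} (u v : list A) : v <> nil -> u ++ v <> nil.
Proof. intros H E; apply app_eq_nil in E; tauto. Qed.

Lemma wprod_adj w : w <> nil -> kadj (wprod w) = wprod (rev w).
Proof.
induction w as [|b w IH]; intros Hw; [easy|].
destruct w as [|c w]; [apply letter_adj|].
rewrite wprod_cons by easy. change (rev (b :: c :: w)) with (rev (c :: w) ++ [b]).
rewrite wprod_app; [|apply app_not_nil; easy|easy].
rewrite kmul_adj, IH by easy. rewrite letter_adj. reflexivity.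
Qed.

Lemma wprod_flip w : w <> nil -> kflip (wprod w) = wprod (map negb w).
Proof.
assert (HL : forall b, kflip (letter b) = letter (negb b)).
{ destruct b; simpl; auto. apply kflip_invol. }
induction w as [|b w IH]; intros Hw; [easy|].
destruct w as [|c w]; [apply HL|].
rewrite wprod_cons by easy. rewrite kmul_flip, IH, HL by easy. reflexivity.
Qed.

Definition word_tr (w : list bool) : R := tau (wprod w).

Lemma word_tr_rot u v : word_tr (u ++ v) = word_tr (v ++ u).
Proof.
destruct u as [|b u]; [now rewrite app_nil_r|]. destruct v as [|c v]; [now rewrite app_nil_r|].
unfold word_tr. rewrite !wprod_app by easy. apply tau_cyclic.
Qed.

Lemma word_tr_flip w : word_tr (map negb w) = word_tr w.
Proof.
destruct w as [|b w]; auto. unfold word_tr. rewrite <- wprod_flip by easy. apply tau_flip.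
Qed.

Lemma word_tr_ip u v : u <> nil -> v <> nil -> ip (wprod u) (wprod v) = word_tr (u ++ rev v).
Proof.
intros Hu Hv. unfold ip, word_tr. rewrite wprod_adj, wprod_app; auto.
intros E. apply Hv. rewrite <- (rev_involutive v), E. reflexivity.
Qed.

Lemma nrm2_word_minus u v : u <> nil -> v <> nil ->
  nrm2 (kminus (wprod u) (wprod v)) = word_tr (u ++ rev u) + word_tr (v ++ rev v) - 2 * word_tr (u ++ rev v).
Proof. intros Hu Hv. rewrite nrm2_minus. unfold nrm2. rewrite !word_tr_ip by auto. reflexivity. Qed.

(** Reflection positivity: the difference of the two sides is the squared norm of [u - v^*]. *)
Lemma word_tr_reflect u v : u <> nil -> v <> nil -> 2 * word_tr (u ++ v) <= word_tr (u ++ rev u) + word_tr (rev v ++ v).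
Proof.
intros Hu Hv. assert (rev v <> nil) as Hv' by (intros E; apply Hv; rewrite <- (rev_involutive v), E; reflexivity).
pose proof (nrm2_nonneg (kminus (wprod u) (wprod (rev v)))) as H.
rewrite nrm2_word_minus, rev_involutive in H by auto. lra.
Qed.

Lemma exists_max_word n (F : list bool -> R) : exists w, length w = n /\ forall w', length w' = n -> F w' <= F w.
Proof.
revert F; induction n as [|n IH]; intros F.
- exists nil; split; auto. intros w' Hw'. destruct w'; [lra|easy].
- destruct (IH (fun w => F (true :: w))) as [w1 [L1 H1]].
  destruct (IH (fun w => F (false :: w))) as [w2 [L2 H2]].
  destruct (Rle_dec (F (true :: w1)) (F (false :: w2))) as [Hle|Hle].
  + exists (false :: w2); split; [simpl; auto|]. intros [|[] w'] Hw'; [easy| |]; simpl in Hw'; injection Hw' as Hw'.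
    * eapply Rle_trans; [apply (H1 w' Hw')|apply Hle].
    * apply (H2 w' Hw').
  + exists (true :: w1); split; [simpl; auto|]. intros [|[] w'] Hw'; [easy| |]; simpl in Hw'; injection Hw' as Hw'.
    * apply (H1 w' Hw').
    * eapply Rle_trans; [apply (H2 w' Hw')|]. lra.
Qed.
End Trace.

(** The combinatorics of reflections is shared by two arguments: that A^{2m} has the largest trace, and
    that words of nearly maximal trace propagate.  [P] is any property of words of length [2 m] which is
    stable under rotations and under reflecting a word about its middle. *)
Section Reflect.
Variable m : nat.
Variable P : list bool -> Prop.
Hypothesis P_len : forall w, P w -> length w = (2 * m)%nat.
Hypothesis P_rot : forall u v, P (u ++ v) -> P (v ++ u).
Hypothesis P_refl : forall u v, length u = m -> length v = m -> P (u ++ v) -> P (u ++ rev u).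

Lemma rev_repeat {A} (x : A) n : rev (repeat x n) = repeat x n.
Proof.
induction n as [|n IH]; auto. simpl. rewrite IH. symmetry. apply repeat_cons.
Qed.

(** Rotate the word so that its first half ends with [c x^r]; the reflection then doubles the run of [x],
    and puts a mirrored copy of [c] after it. *)
Lemma grow c x r z : (length c + r <= m)%nat -> P (c ++ repeat x r ++ z) ->
  exists y, length y = (m - (length c + r))%nat /\ P (c ++ repeat x (2 * r) ++ rev c ++ rev y ++ y).
Proof.
intros Hr HP. pose proof (P_len _ HP) as HL. rewrite !length_app, repeat_length in HL.
set (z1 := firstn m z). set (z2 := skipn m z).
assert (Hz : z = z1 ++ z2) by (symmetry; apply firstn_skipn).
assert (L1 : length z1 = m) by (unfold z1; rewrite length_firstn; lia).
assert (L2 : length z2 = (m - (length c + r))%nat) by (unfold z2; rewrite length_skipn; lia).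
exists z2; split; auto.
rewrite Hz in HP.
replace (c ++ repeat x r ++ z1 ++ z2) with ((c ++ repeat x r ++ z1) ++ z2) in HP by (rewrite <- !app_assoc; reflexivity).
apply P_rot in HP.
replace (z2 ++ c ++ repeat x r ++ z1) with ((z2 ++ c ++ repeat x r) ++ z1) in HP by (rewrite <- !app_assoc; reflexivity).
apply P_refl in HP; auto; [|rewrite !length_app, repeat_length; lia].
rewrite !rev_app_distr, rev_repeat in HP. rewrite <- !app_assoc in HP. apply P_rot in HP.
replace (2 * r)%nat with (r + r)%nat by lia. rewrite repeat_app, <- !app_assoc in *. exact HP.
Qed.

(** Repeating [grow] until [c] and the run fill the first half.  With [c] empty the result is a power of
    [x]; with a one-letter [c] the run ends up between two copies of [c]. *)
Lemma grow_all c x z : (length c < m)%nat -> P (c ++ x :: z) ->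
  P (c ++ repeat x (2 * (m - length c)) ++ rev c).
Proof.
intros Hc HP.
assert (H : forall r, (length c + S r <= m)%nat -> exists z, P (c ++ repeat x (S r) ++ z)).
{ induction r as [|r IH]; intros Hr; [exists z; exact HP|].
  destruct IH as [z' Hz']; [lia|]. apply grow in Hz'; [|lia]. destruct Hz' as [y [_ Hy]].
  replace (2 * S r)%nat with (S (S r) + r)%nat in Hy by lia.
  rewrite repeat_app, <- !app_assoc in Hy. eauto. }
destruct (H (m - length c - 1)%nat ltac:(lia)) as [z' Hz'].
apply grow in Hz'; [|lia]. destruct Hz' as [y [Ly Hy]].
destruct y; [|simpl in Ly; lia]. rewrite app_nil_r in Hy.
replace (m - length c)%nat with (S (m - length c - 1)) by lia. exact Hy.
Qed.
End Reflect.

Section Max.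
Variables (idx : list Z) (S0 : kernel).
Hypothesis S0_adj : kadj S0 = S0.
Notation word_tr := (word_tr idx S0).

Lemma length_pos_not_nil {A} (u : list A) n : length u = S n -> u <> nil.
Proof. intros H E; subst; easy. Qed.

(** The words of maximal trace are stable under reflection, so by [grow_all] one of them is a power; both
    powers have the same trace since A' is a conjugate of A. *)
Lemma word_tr_le_power m w : (1 <= m)%nat -> length w = (2 * m)%nat -> word_tr w <= word_tr (repeat false (2 * m)).
Proof.
intros Hm Hw.
destruct (exists_max_word (2 * m) word_tr) as [w0 [L0 H0]].
set (P := fun w => length w = (2 * m)%nat /\ word_tr w0 <= word_tr w).
assert (K : forall x z, w0 = x :: z -> P ([] ++ repeat x (2 * (m - 0)) ++ rev [])).
{ intros x z E. apply (grow_all m P) with z.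
  - intros ? []; auto.
  - intros u v [K1 K2]; split; [rewrite length_app in *; lia|now rewrite word_tr_rot].
  - intros u v Lu Lv [K1 K2]; split; [rewrite length_app, length_rev; lia|].
    destruct m as [|m']; [lia|].
    pose proof (word_tr_reflect idx S0 S0_adj u v (length_pos_not_nil _ _ Lu) (length_pos_not_nil _ _ Lv)) as K3.
    assert (word_tr (rev v ++ v) <= word_tr w0) by (apply H0; rewrite length_app, length_rev; lia). lra.
  - simpl; lia.
  - simpl. rewrite <- E. split; auto with real. }
specialize (H0 w Hw).
destruct w0 as [|x z]; [simpl in L0; lia|].
destruct (K x z eq_refl) as [_ K2]. cbn [app rev] in K2. rewrite app_nil_r, Nat.sub_0_r in K2.
destruct x; [|lra].
pose proof (word_tr_flip idx S0 (repeat true (2 * m))) as K3. rewrite map_repeat in K3. cbn [negb] in K3. lra.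
Qed.
End Max.

Section Family.
Variable S0 : kernel.
Hypothesis S0_adj : kadj S0 = S0.

Notation idx N := (zrange N).

Lemma lim0_squeeze (u v : nat -> R) : (forall N, 0 <= u N <= v N) -> is_lim_seq v 0 -> is_lim_seq u 0.
Proof.
intros H Hv. apply is_lim_seq_le_le with (fun _ => 0) v; auto. apply is_lim_seq_const.
Qed.

Lemma lim0_scal c (u : nat -> R) : is_lim_seq u 0 -> is_lim_seq (fun N => c * u N) 0.
Proof. intros H. replace 0 with (c * 0) by ring. now apply is_lim_seq_scal_l'. Qed.

Lemma lim0_sqrt (u v : nat -> R) : (forall N, 0 <= u N) -> (forall N, u N ^ 2 <= v N) -> is_lim_seq v 0 -> is_lim_seq u 0.
Proof.
intros Hu H Hv. apply is_lim_seq_spec. intros e.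
destruct (proj2 (is_lim_seq_spec _ _) Hv (mkposreal (e * e) ltac:(destruct e; simpl; nra))) as [N K].
exists N. intros n Hn. specialize (K n Hn). simpl in K. specialize (H n). specialize (Hu n).
rewrite Rminus_0_r in *. rewrite Rabs_right by lra. apply Rabs_def2 in K.
pose proof (cond_pos e). nra.
Qed.

(** By [word_tr_le_power] the defect is non-negative. *)
Definition defect m N w : R := word_tr (idx N) S0 (repeat false (2 * m)) - word_tr (idx N) S0 w.

(** A^k (A^2 - A'^2), truncated at [N]. *)
Definition gap k N : kernel :=
  kminus (wprod (idx N) S0 (repeat false (k + 2))) (wprod (idx N) S0 (repeat false k ++ [true; true])).

(** The words whose defect tends to 0 are stable under reflection, because the defect of [u u^*] is at
    most twice that of [u v].  Starting from A' A z, [grow_all] leads to A' A^{2m-2} A', whose defect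
    controls the norm of A^m - A^{m-2} A'^2. *)
Lemma defect_to_gap m z : (2 <= m)%nat -> length (true :: false :: z) = (2 * m)%nat ->
  is_lim_seq (fun N => defect m N (true :: false :: z)) 0 ->
  is_lim_seq (fun N => nrm2 (idx N) (gap (m - 2) N)) 0.
Proof.
intros Hm Hz Hlim.
set (P := fun w => length w = (2 * m)%nat /\ is_lim_seq (fun N => defect m N w) 0).
assert (HP : P ([true] ++ repeat false (2 * (m - length [true])) ++ rev [true])).
{ apply (grow_all m P) with z.
  - intros ? []; auto.
  - intros u v [K1 K2]; split; [rewrite length_app in *; lia|].
    eapply is_lim_seq_ext; [|apply K2]. intros N; unfold defect. simpl. now rewrite word_tr_rot.
  - intros u v Lu Lv [K1 K2]; split; [rewrite length_app, length_rev; lia|].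
    destruct m as [|m']; [lia|].
    apply lim0_squeeze with (fun N => 2 * defect (S m') N (u ++ v)); [|now apply lim0_scal].
    intros N. unfold defect.
    pose proof (word_tr_reflect (idx N) S0 S0_adj u v (length_pos_not_nil _ _ Lu) (length_pos_not_nil _ _ Lv)) as K3.
    pose proof (word_tr_le_power (idx N) S0 S0_adj (S m') (u ++ rev u) ltac:(lia) ltac:(rewrite length_app, length_rev; lia)).
    pose proof (word_tr_le_power (idx N) S0 S0_adj (S m') (rev v ++ v) ltac:(lia) ltac:(rewrite length_app, length_rev; lia)).
    lra.
  - simpl; lia.
  - simpl app. split; auto. }
destruct HP as [_ HP].
apply lim0_squeeze with (fun N => 2 * defect m N ([true] ++ repeat false (2 * (m - length [true])) ++ rev [true]));
  [|now apply lim0_scal].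
intros N. split; [apply nrm2_nonneg|].
unfold gap. replace (m - 2 + 2)%nat with m by lia.
assert (N1 : repeat false m <> []) by (destruct m; [lia|easy]).
rewrite nrm2_word_minus; auto; [|apply app_not_nil; easy].
rewrite rev_app_distr, !rev_repeat. cbn [rev app length].
assert (E1 : word_tr (idx N) S0 (repeat false m ++ repeat false m) = word_tr (idx N) S0 (repeat false (2 * m))).
{ rewrite <- repeat_app. do 2 f_equal; lia. }
assert (E2 : word_tr (idx N) S0 (repeat false m ++ true :: true :: repeat false (m - 2)) =
             word_tr (idx N) S0 (true :: repeat false (2 * (m - 1)) ++ [true])).
{ replace (repeat false m ++ true :: true :: repeat false (m - 2)) with
    ((repeat false m ++ [true]) ++ (true :: repeat false (m - 2))) by (rewrite <- app_assoc; reflexivity).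
  rewrite word_tr_rot. f_equal. simpl app. f_equal. rewrite app_assoc. f_equal. rewrite <- repeat_app. f_equal; lia. }
pose proof (word_tr_le_power (idx N) S0 S0_adj m ((repeat false (m - 2) ++ [true; true]) ++ true :: true :: repeat false (m - 2)) ltac:(lia)
   ltac:(rewrite !length_app; simpl; rewrite repeat_length; lia)).
rewrite E1, E2. unfold defect. simpl app in *. lra.
Qed.

Lemma gap_succ k N : gap (S k) N = kmul (idx N) S0 (gap k N).
Proof.
unfold gap. rewrite kmul_minus_r. f_equal.
- change (repeat false (S k + 2)) with (false :: repeat false (k + 2)). rewrite wprod_cons; auto.
  rewrite Nat.add_comm; easy.
- change (repeat false (S k) ++ [true; true]) with (false :: (repeat false k ++ [true; true])).
  rewrite wprod_cons; auto. apply app_not_nil; easy.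
Qed.

Definition gap_norm k N := nrm2 (idx N) (gap k N).

(** Cauchy-Schwarz after moving one factor A across the inner product. *)
Lemma gap_norm_log_convex k N : gap_norm (S k) N ^ 2 <= gap_norm k N * gap_norm (S (S k)) N.
Proof.
unfold gap_norm. replace (nrm2 (idx N) (gap (S k) N)) with (ip (idx N) (gap k N) (gap (S (S k)) N)).
- apply ip_cauchy_schwarz.
- unfold nrm2, ip. rewrite (gap_succ (S k)), (gap_succ k). rewrite !kmul_adj, S0_adj.
  rewrite kmul_assoc, <- (kmul_assoc _ S0), tau_cyclic. rewrite !kmul_assoc. reflexivity.
Qed.

(* A^2 - A'^2 is a smoothing kernel when A is Toeplitz with rapidly decreasing coefficients, whence this bound. *)
Hypothesis gap_norm_bounded : forall k, exists B, forall N, gap_norm k N <= B.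

Lemma gap_norm_nonneg k N : 0 <= gap_norm k N.
Proof. apply nrm2_nonneg. Qed.

Lemma lim0_bounded_prod (u v : nat -> R) B : (forall N, 0 <= u N) -> (forall N, 0 <= v N <= B) ->
  is_lim_seq u 0 -> is_lim_seq (fun N => u N * v N) 0.
Proof.
intros Hu Hv H. apply lim0_squeeze with (fun N => B * u N); [|now apply lim0_scal].
intros N. specialize (Hu N). specialize (Hv N). nra.
Qed.

Lemma gap_norm_up k : is_lim_seq (gap_norm k) 0 -> is_lim_seq (gap_norm (S k)) 0.
Proof.
intros H. destruct (gap_norm_bounded (S (S k))) as [B HB].
eapply lim0_sqrt; [apply gap_norm_nonneg|apply gap_norm_log_convex|].
apply lim0_bounded_prod with B; auto using gap_norm_nonneg.
Qed.

Lemma gap_norm_down k : is_lim_seq (gap_norm (S (S k))) 0 -> is_lim_seq (gap_norm (S k)) 0.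
Proof.
intros H. destruct (gap_norm_bounded k) as [B HB].
eapply lim0_sqrt; [apply gap_norm_nonneg|apply gap_norm_log_convex|].
eapply is_lim_seq_ext; [intros; apply Rmult_comm|].
apply lim0_bounded_prod with B; auto using gap_norm_nonneg.
Qed.

Lemma gap_norm_to_one k : is_lim_seq (gap_norm (S k)) 0 -> is_lim_seq (gap_norm 1) 0.
Proof. induction k as [|k IH]; auto. intros H; apply IH, gap_norm_down, H. Qed.

(** With Q = A^2 - A'^2 one has Q Q = A^2 Q - A'^2 Q, and the flip maps A^2 Q to - A'^2 Q because it
    changes the sign of Q. *)
Lemma gap0_square N : kmul (idx N) (gap 0 N) (gap 0 N) = kminus (gap 2 N) (kscal (-1) (kflip (gap 2 N))).
Proof.
rewrite (gap_succ 1), (gap_succ 0). unfold gap at 1. cbn [repeat Nat.add app].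
rewrite !kmul_flip. rewrite kmul_minus_l. rewrite !wprod_cons by easy. cbn [wprod letter].
rewrite <- !kmul_assoc.
assert (E : kflip (gap 0 N) = kscal (-1) (gap 0 N)).
{ unfold gap. cbn [repeat Nat.add app]. rewrite kflip_minus, !wprod_flip by easy. cbn [map negb].
  apply kernel_ext; intros. unfold kscal, kminus. rewrite RtoC_m1. ring. }
rewrite E, !kmul_scal_r. apply kernel_ext; intros i j. unfold kminus, kscal.
rewrite RtoC_m1. ring.
Qed.

(** Q is self-adjoint, so the entry (i, i) of Q Q bounds the square of the entry (i, j) of Q. *)
Lemma gap0_entry_le N i j : In i (idx N) -> In j (idx N) -> i <> 0%Z -> j <> 0%Z ->
  (Cmod (gap 0 N i j) ^ 2) ^ 2 <= 4 * gap_norm 2 N.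
Proof.
intros Hi Hj Hi0 Hj0.
assert (HQ : kadj (gap 0 N) = gap 0 N) by (unfold gap; rewrite kadj_minus, !wprod_adj by (auto; easy); reflexivity).
assert (H1 : nrm2 (idx N) (kmul (idx N) (gap 0 N) (gap 0 N)) <= 4 * gap_norm 2 N).
{ rewrite gap0_square. eapply Rle_trans; [apply nrm2_minus_le|]. 
  unfold nrm2 at 2. rewrite ip_scal_l, ip_scal_r. change (ip (idx N) (kflip (gap 2 N)) (kflip (gap 2 N))) with (nrm2 (idx N) (kflip (gap 2 N))).
  rewrite nrm2_flip. unfold gap_norm. lra. }
eapply Rle_trans; [|apply H1].
eapply Rle_trans; [|apply (nrm2_entry (idx N) _ i i); auto].
apply pow_incr. split; [apply pow2_ge_0|].
eapply Rle_trans; [|apply Rabs_Re_le]. eapply Rle_trans; [|apply Rle_abs].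
unfold kmul. rewrite Re_csum.
assert (HT : forall l, Re (gap 0 N i l * wt l * gap 0 N l i)%C = IZR (Z.abs l) * Cmod (gap 0 N i l) ^ 2).
{ intros l. replace (gap 0 N l i) with (Cconj (gap 0 N i l)) by (change (kadj (gap 0 N) l i = gap 0 N l i); now rewrite HQ).
  unfold wt.
  replace (gap 0 N i l * RtoC (IZR (Z.abs l)) * Cconj (gap 0 N i l))%C with (RtoC (IZR (Z.abs l)) * (gap 0 N i l * Cconj (gap 0 N i l)))%C by ring.
  rewrite Re_RtoC_mult, Cmult_conj_R. reflexivity. }
rewrite (rsum_ext _ _ _ (fun l _ => HT l)).
eapply Rle_trans; [|apply (rsum_term_le _ _ j); auto].
- cbv beta. pose proof (wt_ge1 j Hj0). pose proof (pow2_ge_0 (Cmod (gap 0 N i j))). nra.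
- intros; apply Rmult_le_pos; [apply wt_ge0|apply pow2_ge_0].
Qed.

(** Removes the power of A from [defect_to_gap].  For m = 2 there is none.  For m >= 3 log-convexity brings
    the exponent m - 2 down to 1 and then up to 2, where [gap0_entry_le] applies. *)
Lemma defect_to_gap0 m z i j : (2 <= m)%nat -> length (true :: false :: z) = (2 * m)%nat ->
  is_lim_seq (fun N => defect m N (true :: false :: z)) 0 -> i <> 0%Z -> j <> 0%Z ->
  Clim (fun N => gap 0 N i j) (RtoC 0).
Proof.
intros Hm Hz Hlim Hi Hj. apply defect_to_gap in Hlim; auto.
assert (H : exists v, is_lim_seq v 0 /\ forall N, In i (idx N) -> In j (idx N) -> (Cmod (gap 0 N i j) ^ 2) ^ 2 <= v N).
{ destruct (Nat.eq_dec m 2) as [->|Hm2].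
  - exists (fun N => gap_norm 0 N * gap_norm 0 N). split.
    + replace 0 with (0 * 0) by ring. apply is_lim_seq_mult'; apply Hlim.
    + intros N Hi' Hj'. pose proof (nrm2_entry (idx N) (gap 0 N) i j Hi' Hj' Hi Hj).
      pose proof (pow2_ge_0 (Cmod (gap 0 N i j))).
      replace ((Cmod (gap 0 N i j) ^ 2) ^ 2) with (Cmod (gap 0 N i j) ^ 2 * Cmod (gap 0 N i j) ^ 2) by ring.
      apply Rmult_le_compat; auto.
  - exists (fun N => 4 * gap_norm 2 N). split.
    + apply lim0_scal, gap_norm_up, (gap_norm_to_one (m - 3)). replace (S (m - 3)) with (m - 2)%nat by lia. exact Hlim.
    + intros N Hi' Hj'. now apply gap0_entry_le. }
destruct H as [v [Hv H]].
apply Clim_eps. intros e He.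
destruct (proj2 (is_lim_seq_spec _ _) Hv (mkposreal (e * e * (e * e)) ltac:(apply Rmult_lt_0_compat; nra))) as [M K].
exists (max M (max (Z.to_nat (Z.abs i)) (Z.to_nat (Z.abs j)))). intros n Hn.
specialize (K n ltac:(lia)). simpl in K. rewrite Rminus_0_r in K. apply Rabs_def2 in K.
specialize (H n ltac:(apply In_zrange; lia) ltac:(apply In_zrange; lia)).
unfold Cminus. rewrite <- RtoC_opp, Ropp_0, Cplus_0_r.
destruct (Rlt_le_dec (Cmod (gap 0 n i j)) e) as [|Hle]; auto. exfalso.
assert (e ^ 2 <= Cmod (gap 0 n i j) ^ 2) by (apply pow_incr; lra).
assert ((e ^ 2) ^ 2 <= (Cmod (gap 0 n i j) ^ 2) ^ 2) by (apply pow_incr; split; auto; apply pow2_ge_0).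
simpl in *. lra.
Qed.
End Family.

(** * Uniform bounds on truncated kernels *)

(** Rapidly decreasing sequences, the Fourier coefficients of smooth functions. *)
Definition rapid (c : Z -> C) : Prop := forall k, exists B, forall n, Cmod (c n) * jb n ^ k <= B.

Lemma csum_bound N f y B : 0 <= y -> (forall l, Cmod (f l) * jb l ^ 2 * y <= B) -> Cmod (csum (zrange N) f) * y <= 3 * B.
Proof.
intros Hy H.
assert (0 <= B) by (eapply Rle_trans; [|apply (H 0%Z)]; nonneg).
apply Rle_trans with (B * rsum (zrange N) (fun l => / jb l ^ 2)); [|pose proof (rsum_jb_bound N); nra].
rewrite <- rsum_scal. rewrite Rmult_comm.
eapply Rle_trans; [apply Rmult_le_compat_l; [auto|apply Cmod_csum_le]|].
rewrite <- rsum_scal. apply rsum_le. intros l _. specialize (H l).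
pose proof (jb_pow_pos l 2). apply Rmult_le_reg_r with (jb l ^ 2); auto.
rewrite Rmult_assoc, Rmult_assoc, Rinv_l by lra. lra.
Qed.

(** Three powers of the bracket pay for the weight |l| and for the summation over [l]. *)
Lemma kmul_bound N (A B : kernel) i j y M : 0 <= y ->
  (forall l, Cmod (A i l) * Cmod (B l j) * jb l ^ 3 * y <= M) ->
  Cmod (kmul (zrange N) A B i j) * y <= 3 * M.
Proof.
intros Hy H. apply csum_bound; auto. intros l. rewrite !Cmod_mult. unfold wt.
rewrite Cmod_R, Rabs_right by (apply Rle_ge, wt_ge0).
eapply Rle_trans; [|apply (H l)].
replace (Cmod (A i l) * IZR (Z.abs l) * Cmod (B l j) * jb l ^ 2 * y) with
  ((Cmod (A i l) * Cmod (B l j) * jb l ^ 2 * y) * IZR (Z.abs l)) by ring.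
replace (Cmod (A i l) * Cmod (B l j) * jb l ^ 3 * y) with
  ((Cmod (A i l) * Cmod (B l j) * jb l ^ 2 * y) * jb l) by ring.
apply Rmult_le_compat_l; [|apply jb_abs].
nonneg.
Qed.

(** Kernels, depending on the truncation, that act on rapidly decreasing sequences from either side with
    bounds uniform in the truncation. *)
Definition tempered (K : nat -> kernel) : Prop :=
  (forall k, exists r B, forall N i j, Cmod (K N i j) * jb j ^ k <= B * jb i ^ r) /\
  (forall k, exists r B, forall N i j, Cmod (K N i j) * jb i ^ k <= B * jb j ^ r).

(** The two-sided ideal of the tempered kernels formed by the kernels of smoothing operators. *)
Definition smoothing (K : nat -> kernel) : Prop :=
  forall k, exists B, forall N i j, Cmod (K N i j) * jb i ^ k * jb j ^ k <= B.

Lemma Cmod_conj z : Cmod (Cconj z) = Cmod z.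
Proof. unfold Cmod, Cconj; simpl. f_equal; ring. Qed.

Lemma tempered_adj K : tempered K -> tempered (fun N => kadj (K N)).
Proof.
intros [H1 H2]; split; intros k.
- destruct (H2 k) as [r [B H]]; exists r, B; intros; unfold kadj; rewrite Cmod_conj; auto.
- destruct (H1 k) as [r [B H]]; exists r, B; intros; unfold kadj; rewrite Cmod_conj; auto.
Qed.

Lemma smoothing_adj K : smoothing K -> smoothing (fun N => kadj (K N)).
Proof.
intros H k. destruct (H k) as [B HB]; exists B; intros. unfold kadj; rewrite Cmod_conj.
rewrite Rmult_assoc, (Rmult_comm (jb i ^ k)), <- Rmult_assoc. auto.
Qed.

Lemma tempered_mul_aux K L : tempered K -> tempered L ->
  forall k, exists r B, forall N i j, Cmod (kmul (zrange N) (K N) (L N) i j) * jb j ^ k <= B * jb i ^ r.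
Proof.
intros [HK _] [HL _] k.
destruct (HL k) as [r [B HB]]. destruct (HK (r + 3)%nat) as [r' [B' HB']].
exists r', (3 * (B * B')). intros N i j.
rewrite Rmult_assoc. apply kmul_bound; [nonneg|].
intros l. specialize (HB N l j). specialize (HB' N i l).
assert (0 <= B).
{ pose proof (jb_pow_pos l r). pose proof (Cmod_ge_0 (L N l j)). pose proof (jb_pow_pos j k).
  assert (0 <= B * jb l ^ r) by nra. nra. }
apply Rle_trans with (Cmod (K N i l) * jb l ^ 3 * (B * jb l ^ r)).
- replace (Cmod (K N i l) * Cmod (L N l j) * jb l ^ 3 * jb j ^ k) with (Cmod (K N i l) * jb l ^ 3 * (Cmod (L N l j) * jb j ^ k)) by ring.
  apply Rmult_le_compat_l; auto. nonneg.
- rewrite pow_add in HB'.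
  replace (Cmod (K N i l) * jb l ^ 3 * (B * jb l ^ r)) with (B * (Cmod (K N i l) * (jb l ^ r * jb l ^ 3))) by ring.
  rewrite Rmult_assoc. now apply Rmult_le_compat_l.
Qed.

Lemma tempered_mul K L : tempered K -> tempered L -> tempered (fun N => kmul (zrange N) (K N) (L N)).
Proof.
intros HK HL. split; [now apply tempered_mul_aux|].
intros k. destruct (tempered_mul_aux _ _ (tempered_adj _ HL) (tempered_adj _ HK) k) as [r [B H]].
exists r, B. intros N i j. specialize (H N j i). rewrite <- kmul_adj in H. unfold kadj in H at 1.
now rewrite Cmod_conj in H.
Qed.

Lemma smoothing_mul_l K L : tempered K -> smoothing L -> smoothing (fun N => kmul (zrange N) (K N) (L N)).
Proof.
intros [_ HK] HL k. destruct (HK k) as [r [B HB]]. destruct (HL (k + (r + 3))%nat) as [B' HB'].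
exists (3 * (B * B')). intros N i j. rewrite Rmult_assoc.
apply kmul_bound; [nonneg|].
intros l. specialize (HB N i l). specialize (HB' N l j).
assert (0 <= B).
{ pose proof (jb_pow_pos l r). pose proof (Cmod_ge_0 (K N i l)). pose proof (jb_pow_pos i k).
  assert (0 <= B * jb l ^ r) by nra. nra. }
assert (H1 : Cmod (L N l j) * jb l ^ (r + 3) * jb j ^ k <= B').
{ eapply Rle_trans; [|apply HB'].
  apply Rmult_le_compat; [nonneg|nonneg| |apply jb_pow_mono; lia].
  apply Rmult_le_compat_l; [apply Cmod_ge_0|apply jb_pow_mono; lia]. }
apply Rle_trans with (B * jb l ^ r * (Cmod (L N l j) * jb l ^ 3 * jb j ^ k)).
- replace (Cmod (K N i l) * Cmod (L N l j) * jb l ^ 3 * (jb i ^ k * jb j ^ k)) with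
   (Cmod (K N i l) * jb i ^ k * (Cmod (L N l j) * jb l ^ 3 * jb j ^ k)) by ring.
  apply Rmult_le_compat_r; auto. nonneg.
- rewrite pow_add in H1.
  replace (B * jb l ^ r * (Cmod (L N l j) * jb l ^ 3 * jb j ^ k)) with (B * (Cmod (L N l j) * (jb l ^ r * jb l ^ 3) * jb j ^ k)) by ring.
  now apply Rmult_le_compat_l.
Qed.

Lemma smoothing_ext K L : (forall N, K N = L N) -> smoothing K -> smoothing L.
Proof. intros E H k. destruct (H k) as [B HB]; exists B; intros; rewrite <- E; auto. Qed.

Lemma smoothing_mul_r K L : smoothing K -> tempered L -> smoothing (fun N => kmul (zrange N) (K N) (L N)).
Proof.
intros HK HL. pose proof (smoothing_adj _ (smoothing_mul_l _ _ (tempered_adj _ HL) (smoothing_adj _ HK))) as H.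
eapply smoothing_ext; [|apply H]. intros N; simpl. now rewrite kmul_adj, !kadj_invol.
Qed.

Lemma smoothing_plus K L M : (forall N, M N = kplus (K N) (L N)) -> smoothing K -> smoothing L -> smoothing M.
Proof.
intros E HK HL k. destruct (HK k) as [B HB]. destruct (HL k) as [B' HB']. exists (B + B').
intros N i j. rewrite E. unfold kplus. specialize (HB N i j). specialize (HB' N i j).
pose proof (Cmod_triangle (K N i j) (L N i j)). pose proof (jb_pow_pos i k). pose proof (jb_pow_pos j k).
assert (0 < jb i ^ k * jb j ^ k) by nra. nra.
Qed.

Lemma smoothing_tempered K : smoothing K -> tempered K.
Proof.
intros H; split; intros k; destruct (H k) as [B HB]; exists 0%nat, B; intros N i j; rewrite Rmult_1_r;
 (eapply Rle_trans; [|apply (HB N i j)]); pose proof (jb_pow_ge1 i k); pose proof (jb_pow_ge1 j k);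
 pose proof (Cmod_ge_0 (K N i j)); [rewrite Rmult_assoc, (Rmult_comm (jb i ^ k)), <- Rmult_assoc|]; 
 match goal with |- ?x <= ?x * ?y => assert (0 <= x) by nra; nra end.
Qed.

Lemma smoothing_diag K : smoothing K -> exists B, forall N n, Cmod (wt n * K N n n)%C <= B / jb n ^ 2.
Proof.
intros H. destruct (H 3%nat) as [B HB]. exists B. intros N n. specialize (HB N n n).
pose proof (jb_pow_pos n 2) as Hp. apply Rmult_le_reg_r with (jb n ^ 2); auto.
unfold Rdiv. rewrite Rmult_assoc, Rinv_l, Rmult_1_r by lra.
eapply Rle_trans; [|apply HB]. rewrite Cmod_mult. unfold wt. rewrite Cmod_R, Rabs_right by (apply Rle_ge, wt_ge0).
pose proof (jb_abs n). pose proof (jb_pow_ge1 n 3). pose proof (Cmod_ge_0 (K N n n)). pose proof (wt_ge0 n).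
replace (IZR (Z.abs n) * Cmod (K N n n) * jb n ^ 2) with (Cmod (K N n n) * jb n ^ 2 * IZR (Z.abs n)) by ring.
apply Rle_trans with (Cmod (K N n n) * jb n ^ 2 * jb n).
- apply Rmult_le_compat_l; auto. nonneg.
- replace (Cmod (K N n n) * jb n ^ 2 * jb n) with (Cmod (K N n n) * jb n ^ 3) by ring.
  assert (0 <= Cmod (K N n n) * jb n ^ 3) by (nonneg). nra.
Qed.

Lemma smoothing_tau K : smoothing K -> exists B, forall N, tau (zrange N) (K N) <= B.
Proof.
intros H. destruct (smoothing_diag K H) as [B HB]. exists (3 * B). intros N. unfold tau.
eapply Rle_trans; [apply Rle_abs|]. eapply Rle_trans; [apply Rabs_Re_le|].
rewrite <- (Rmult_1_r (Cmod _)). apply csum_bound; [lra|]. intros l. rewrite Rmult_1_r.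
specialize (HB N l). pose proof (jb_pow_pos l 2) as Hp. apply Rmult_le_compat_r with (r := jb l ^ 2) in HB; [|lra].
unfold Rdiv in HB. rewrite Rmult_assoc, Rinv_l, Rmult_1_r in HB by lra. exact HB.
Qed.

Section Toeplitz.
Variable c : Z -> C.
Hypothesis c_rapid : rapid c.
Hypothesis c_real : forall n, c (- n)%Z = Cconj (c n).

Definition toep : kernel := fun i j => c (i - j).

Lemma toep_adj : kadj toep = toep.
Proof.
apply kernel_ext; intros i j; unfold kadj, toep. rewrite <- c_real. f_equal; lia.
Qed.

Lemma toep_tempered : tempered (fun _ => toep).
Proof.
assert (H : forall k, exists r B, forall (N : nat) i j, Cmod (toep i j) * jb j ^ k <= B * jb i ^ r).
{ intros k. destruct (c_rapid k) as [B HB]. exists k, B. intros _ i j. unfold toep. specialize (HB (i - j)%Z).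
  pose proof (jb_peetre_pow j i k) as HP. rewrite jb_sub_sym in HP.
  pose proof (jb_pow_pos i k). pose proof (Cmod_ge_0 (c (i - j))).
  apply Rle_trans with (Cmod (c (i - j)) * (jb i ^ k * jb (i - j) ^ k)); [now apply Rmult_le_compat_l|].
  nra. }
split; auto.
intros k. destruct (H k) as [r [B HB]]. exists r, B. intros N i j. rewrite <- toep_adj. unfold kadj.
rewrite Cmod_conj. apply (HB N).
Qed.

Lemma sg_abs i : Rabs (sg i) = 1.
Proof. unfold sg. destruct Z_lt_dec; [rewrite Rabs_left; lra|apply Rabs_R1]. Qed.

Lemma Cmod_flip A i j : Cmod (kflip A i j) = Cmod (A i j).
Proof. unfold kflip. rewrite Cmod_mult, Cmod_R, Rabs_mult, !sg_abs. ring. Qed.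

Lemma letter_tempered b : tempered (fun _ => letter toep b).
Proof.
destruct toep_tempered as [H1 H2]. destruct b; simpl; [|split; auto].
split; intros k; [destruct (H1 k) as [r [B H]]|destruct (H2 k) as [r [B H]]]; exists r, B; intros; rewrite Cmod_flip; auto.
Qed.

(** Entries of A - A' vanish unless the frequencies have opposite signs, and then |i - j| = |i| + |j|, so that
    the decay of the coefficients controls both indices. *)
Lemma toep_flip_diff_smoothing : smoothing (fun _ => kminus toep (kflip toep)).
Proof.
intros k. destruct (c_rapid (k + k)%nat) as [B HB]. exists (2 * B). intros _ i j.
unfold kminus, kflip, toep.
assert (HB0 : 0 <= B).
{ specialize (HB 0%Z). pose proof (Cmod_ge_0 (c 0%Z)). pose proof (jb_pow_pos 0 (k + k)%nat). nra. }
assert (E : (sg i * sg j = 1) \/ (sg i * sg j = -1 /\ Z.abs (i - j) = (Z.abs i + Z.abs j)%Z)).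
{ unfold sg; do 2 destruct Z_lt_dec; (left; lra) || (right; split; [lra|lia]). }
destruct E as [E|[E1 E2]].
- rewrite E. replace (c (i - j) - RtoC 1 * c (i - j))%C with (RtoC 0) by ring. rewrite Cmod_0. lra.
- rewrite E1. replace (c (i - j) - RtoC (-1) * c (i - j))%C with (RtoC 2 * c (i - j))%C.
  + rewrite Cmod_mult, Cmod_R, Rabs_right by lra. specialize (HB (i - j)%Z). rewrite pow_add in HB.
    assert (H1 : jb i ^ k <= jb (i - j) ^ k).
    { apply pow_incr. split; [nonneg|]. unfold jb. rewrite E2, plus_IZR. pose proof (wt_ge0 j); lra. }
    assert (H2 : jb j ^ k <= jb (i - j) ^ k).
    { apply pow_incr. split; [nonneg|]. unfold jb. rewrite E2, plus_IZR. pose proof (wt_ge0 i); lra. }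
    rewrite !Rmult_assoc. apply Rmult_le_compat_l; [lra|].
    eapply Rle_trans; [|apply HB]. apply Rmult_le_compat_l; [apply Cmod_ge_0|].
    apply Rmult_le_compat; auto; nonneg.
  + rewrite RtoC_m1.
    rewrite RtoC_two. ring.
Qed.

Lemma letter_diff_smoothing b b' : smoothing (fun _ => kminus (letter toep b) (letter toep b')).
Proof.
assert (H0 : forall A, smoothing (fun _ => kminus A A)).
{ intros A k. exists 0. intros. unfold kminus. replace (A i j - A i j)%C with (RtoC 0) by ring. rewrite Cmod_0; lra. }
pose proof toep_flip_diff_smoothing as H.
destruct b, b'; simpl; auto.
intros k. destruct (H k) as [B HB]. exists B. intros N i j. specialize (HB N i j).
unfold kminus in *. replace (kflip toep i j - toep i j)%C with (- (toep i j - kflip toep i j))%C by ring.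
now rewrite Cmod_opp.
Qed.

Lemma wprod_tempered w : tempered (fun N => wprod (zrange N) toep w).
Proof.
induction w as [|b w IH]; [apply toep_tempered|].
destruct w as [|b' w]; [apply letter_tempered|].
apply (tempered_mul _ _ (letter_tempered b) IH).
Qed.

(** Replace one letter at a time: each replacement produces a factor A - A', and smoothing kernels form
    an ideal. *)
Lemma wprod_diff_smoothing w w' : length w = length w' ->
  smoothing (fun N => kminus (wprod (zrange N) toep w) (wprod (zrange N) toep w')).
Proof.
revert w'; induction w as [|b w IH]; intros [|b' w'] HL; try easy; [apply (letter_diff_smoothing false false)|].
injection HL as HL.
destruct w as [|d w], w' as [|d' w']; try easy; [apply letter_diff_smoothing|].
apply smoothing_plus with
  (fun N => kmul (zrange N) (letter toep b) (kminus (wprod (zrange N) toep (d :: w)) (wprod (zrange N) toep (d' :: w'))))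
  (fun N => kmul (zrange N) (kminus (letter toep b) (letter toep b')) (wprod (zrange N) toep (d' :: w'))).
- intros N. rewrite !(wprod_cons _ _ b), !(wprod_cons _ _ b') by easy. rewrite kmul_minus_l, kmul_minus_r.
  apply kernel_ext; intros; unfold kplus, kminus; ring.
- apply smoothing_mul_l; [apply letter_tempered|now apply IH].
- apply smoothing_mul_r; [apply letter_diff_smoothing|apply wprod_tempered].
Qed.

Lemma gap_norm_bounded k : exists B, forall N, gap_norm toep k N <= B.
Proof.
apply (smoothing_tau (fun N => kmul (zrange N) (gap toep k N) (kadj (gap toep k N)))).
assert (H : smoothing (gap toep k)).
{ apply wprod_diff_smoothing. rewrite length_app, !repeat_length. reflexivity. }
apply smoothing_mul_r; auto. apply smoothing_tempered, smoothing_adj, H.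
Qed.

(** The cases [om l = |l|] and [om l = l] are the truncations of a Lambda and of a D. *)
Section Power.
Variable om : Z -> R.
Hypothesis om_abs : forall l, Rabs (om l) = IZR (Z.abs l).

Fixpoint mat_pow (N : nat) (p : nat) (j i : Z) : C :=
  match p with
  | O => if Z.eq_dec i j then RtoC 1 else RtoC 0
  | S p' => csum (zrange N) (fun l => (c (i - l) * (RtoC (om l) * mat_pow N p' j l))%C)
  end.

(** By [jb_peetre_pow] the weight in [i] is shared between the two factors. *)
Lemma conv_term_bound i l (v : Z -> C) k B B' :
  Cmod (c (i - l)) * jb (i - l) ^ k <= B -> Cmod (v l) * jb l ^ (k + 3) <= B' ->
  Cmod (c (i - l) * (RtoC (om l) * v l))%C * jb l ^ 2 * jb i ^ k <= B * B'.
Proof.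
intros H1 H2. rewrite !Cmod_mult, Cmod_R, om_abs.
pose proof (jb_peetre_pow i l k) as HP. pose proof (jb_abs l) as Ha. pose proof (wt_ge0 l) as Hw.
pose proof (Cmod_ge_0 (c (i - l))). pose proof (Cmod_ge_0 (v l)).
pose proof (jb_pow_pos l 2). pose proof (jb_pow_pos l k). pose proof (jb_pow_pos i k). pose proof (jb_pow_pos (i - l) k).
apply Rle_trans with ((Cmod (c (i - l)) * jb (i - l) ^ k) * (Cmod (v l) * jb l ^ (k + 3))).
- rewrite pow_add.
  replace (Cmod (c (i - l)) * (IZR (Z.abs l) * Cmod (v l)) * jb l ^ 2 * jb i ^ k) with
   ((Cmod (c (i - l)) * Cmod (v l) * jb l ^ 2) * (IZR (Z.abs l) * jb i ^ k)) by ring.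
  replace (Cmod (c (i - l)) * jb (i - l) ^ k * (Cmod (v l) * (jb l ^ k * jb l ^ 3))) with
   ((Cmod (c (i - l)) * Cmod (v l) * jb l ^ 2) * (jb l * (jb l ^ k * jb (i - l) ^ k))) by ring.
  apply Rmult_le_compat_l; [nonneg|].
  apply Rmult_le_compat; auto; lra.
- apply Rmult_le_compat; auto; nonneg.
Qed.

Lemma mat_pow_bound p j k : exists B, forall N i, Cmod (mat_pow N p j i) * jb i ^ k <= B.
Proof.
revert k; induction p as [|p IH]; intros k.
- exists (jb j ^ k). intros N i. simpl. destruct Z.eq_dec as [->|].
  + rewrite Cmod_1. lra.
  + rewrite Cmod_0. pose proof (jb_pow_pos j k). lra.
- destruct (IH (k + 3)%nat) as [B' HB']. destruct (c_rapid k) as [B HB].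
  exists (3 * (B * B')). intros N i. simpl. apply csum_bound; [nonneg|].
  intros l. apply conv_term_bound; auto.
Qed.

(** The truncated powers converge to those of the untruncated operator, entry by entry, since their columns
    decrease rapidly, uniformly in the truncation. *)
Lemma mat_pow_lim (E : nat -> Z -> C) j :
  (forall i, E 0%nat i = if Z.eq_dec i j then RtoC 1 else RtoC 0) ->
  (forall p i, E (S p) i = ZSeries (fun l => (c (i - l) * (RtoC (om l) * E p l))%C)) ->
  forall p i, Clim (fun N => mat_pow N p j i) (E p i).
Proof.
intros E0 ES. induction p as [|p IH]; intros i.
- rewrite E0. apply Clim_const.
- rewrite ES. simpl. destruct (mat_pow_bound p j 3) as [B' HB']. destruct (c_rapid 0%nat) as [B HB].
  apply tannery with (B * B').
  + intros N l _. pose proof (conv_term_bound i l (mat_pow N p j) 0%nat B B' (HB _) (HB' N l)) as H.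
    pose proof (jb_pow_pos l 2) as Hp.
    apply Rmult_le_reg_r with (jb l ^ 2); auto. unfold Rdiv. rewrite Rmult_assoc, Rinv_l by lra. simpl in *; lra.
  + intros l. apply Clim_mult_l, Clim_mult_l, IH.
Qed.
End Power.

(** The word of (A A')^m is [alt false (2 * m)]. *)
Fixpoint alt (b : bool) (p : nat) : list bool :=
  match p with O => nil | S p' => b :: alt (negb b) p' end.

Lemma alt_length b p : length (alt b p) = p.
Proof. revert b; induction p; intros; simpl; auto. Qed.

Lemma alt_negb b p : map negb (alt b p) = alt (negb b) p.
Proof. revert b; induction p; intros; simpl; f_equal; auto. Qed.

Lemma csum_delta N om i j : (Z.abs j <= Z.of_nat N)%Z ->
  csum (zrange N) (fun l => (c (i - l) * (RtoC (om l) * (if Z.eq_dec l j then RtoC 1 else RtoC 0)))%C) =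
  (c (i - j) * RtoC (om j))%C.
Proof.
intros Hj. rewrite (csum_single _ _ j).
- destruct Z.eq_dec; [ring|easy].
- apply NoDup_zrange.
- now apply In_zrange.
- intros l _ Hl. destruct Z.eq_dec; [easy|ring].
Qed.

Lemma mat_pow_Lambda N p j i : (Z.abs j <= Z.of_nat N)%Z ->
  mat_pow (fun l => IZR (Z.abs l)) N (S p) j i = (wprod (zrange N) toep (repeat false (S p)) i j * wt j)%C.
Proof.
intros Hj. revert i; induction p as [|p IH]; intros i.
- simpl. now rewrite csum_delta.
- change (mat_pow (fun l => IZR (Z.abs l)) N (S (S p)) j i) with
   (csum (zrange N) (fun l => (c (i - l) * (wt l * mat_pow (fun l => IZR (Z.abs l)) N (S p) j l))%C)).
  change (repeat false (S (S p))) with (false :: repeat false (S p)). rewrite wprod_cons by easy.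
  unfold kmul. rewrite <- csum_mult_r. apply csum_ext; intros l _. rewrite IH. unfold toep. simpl. ring.
Qed.

Lemma sg_abs_IZR l : IZR l = sg l * IZR (Z.abs l).
Proof.
unfold sg. destruct Z_lt_dec.
- rewrite Z.abs_neq, opp_IZR by lia. ring.
- rewrite Z.abs_eq by lia. ring.
Qed.

(** Each factor l = sgn(l) |l| leaves a sign between two letters; pairing it with the sign of the column
    flips the rest of the word, which makes the letters alternate.  One sign of the column remains per
    factor, so an even power has none. *)
Lemma mat_pow_D N p j i : (Z.abs j <= Z.of_nat N)%Z ->
  mat_pow IZR N (S p) j i = (wprod (zrange N) toep (alt false (S p)) i j * wt j * RtoC (sg j ^ S p))%C.
Proof.
intros Hj. revert i; induction p as [|p IH]; intros i.
- simpl. rewrite csum_delta, sg_abs_IZR, Rmult_1_r by auto. unfold toep, wt. rewrite RtoC_mult. ring.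
- change (mat_pow IZR N (S (S p)) j i) with
   (csum (zrange N) (fun l => (c (i - l) * (RtoC (IZR l) * mat_pow IZR N (S p) j l))%C)).
  change (alt false (S (S p))) with (false :: alt true (S p)). rewrite wprod_cons by easy.
  unfold kmul. rewrite <- Cmult_assoc, <- csum_mult_r. apply csum_ext; intros l _. rewrite IH.
  change (alt true (S p)) with (alt (negb false) (S p)). rewrite <- alt_negb, <- wprod_flip by easy.
  unfold kflip. rewrite sg_abs_IZR. change (sg j ^ S (S p)) with (sg j * sg j ^ S p).
  unfold wt. change (letter toep false i l) with (c (i - l)). rewrite !RtoC_mult.
  transitivity (c (i - l) * RtoC (sg l) * RtoC (IZR (Z.abs l)) * wprod (zrange N) toep (alt false (S p)) l j * RtoC (IZR (Z.abs j)) * (RtoC (sg j * sg j) * RtoC (sg j ^ S p)))%C.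
  + rewrite sg_sq. ring.
  + rewrite RtoC_mult. ring.
Qed.

Lemma sg_even_pow j m : sg j ^ (2 * m) = 1.
Proof. rewrite pow_mult. replace (sg j ^ 2) with (sg j * sg j) by ring. rewrite sg_sq. apply pow1. Qed.

(** [EL j p] and [ED j p] stand for the Fourier coefficients of (a Lambda)^p and (a D)^p applied to
    e^{i j theta}.  The entries converge by [mat_pow_lim], and the diagonal of the smoothing difference
    of the two words dominates the sum. *)
Lemma trace_lim m (EL ED : Z -> nat -> Z -> C) : (1 <= m)%nat ->
  (forall j i, EL j 0%nat i = if Z.eq_dec i j then RtoC 1 else RtoC 0) ->
  (forall j p i, EL j (S p) i = ZSeries (fun l => (c (i - l) * (RtoC (IZR (Z.abs l)) * EL j p l))%C)) ->
  (forall j i, ED j 0%nat i = if Z.eq_dec i j then RtoC 1 else RtoC 0) ->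
  (forall j p i, ED j (S p) i = ZSeries (fun l => (c (i - l) * (RtoC (IZR l) * ED j p l))%C)) ->
  Clim (fun N => ktr (zrange N) (kminus (wprod (zrange N) toep (repeat false (2 * m))) (wprod (zrange N) toep (alt false (2 * m)))))
       (ZSeries (fun n => (EL n (2 * m)%nat n - ED n (2 * m)%nat n)%C)).
Proof.
intros Hm EL0 ELS ED0 EDS.
assert (HS : smoothing (fun N => kminus (wprod (zrange N) toep (repeat false (2 * m))) (wprod (zrange N) toep (alt false (2 * m)))))
 by (apply wprod_diff_smoothing; now rewrite repeat_length, alt_length).
destruct (smoothing_diag _ HS) as [B HB].
apply tannery with B; [intros; apply HB|].
intros n.
assert (HL := mat_pow_lim (fun l => IZR (Z.abs l)) ltac:(intros; apply Rabs_right, Rle_ge, wt_ge0) (EL n) n (EL0 n) (ELS n) (2 * m) n).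
assert (HD := mat_pow_lim IZR ltac:(intros; now rewrite abs_IZR) (ED n) n (ED0 n) (EDS n) (2 * m) n).
eapply Clim_ext_loc; [|apply (Clim_minus _ _ _ _ HL HD)].
exists (Z.to_nat (Z.abs n)). intros N HN.
pose proof (sg_even_pow n m) as Hsg.
destruct (2 * m)%nat as [|p] eqn:E; [lia|].
rewrite mat_pow_Lambda, mat_pow_D by lia. rewrite Hsg. unfold kminus. ring.
Qed.

End Toeplitz.

(** * From vanishing traces to vanishing coefficients *)

Section Coefficients.
Variable c : Z -> C.
Hypothesis c_rapid : rapid c.
Hypothesis c_real : forall n, c (- n)%Z = Cconj (c n).

Lemma Clim0_bound (u : nat -> C) B : (forall N, Cmod (u N) <= B / INR (S N)) -> Clim u (RtoC 0).
Proof.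
intros H. apply Clim_eps. intros e He.
assert (HB : 0 <= B).
{ specialize (H 0%nat). pose proof (Cmod_ge_0 (u 0%nat)). simpl in H. unfold Rdiv in H. rewrite Rinv_1 in H. lra. }
destruct (inv_INR_small (e / (B + 1))) as [M HM]; [apply Rdiv_lt_0_compat; lra|].
exists M. intros n Hn. specialize (HM n Hn). unfold Cminus. rewrite <- RtoC_opp, Ropp_0, Cplus_0_r.
eapply Rle_lt_trans; [apply H|].
assert (0 < / INR (S n)) by (apply Rinv_0_lt_compat, lt_0_INR; lia).
apply Rle_lt_trans with ((B + 1) * / INR (S n)); [unfold Rdiv; nra|].
apply Rmult_lt_reg_l with (/ (B + 1)); [apply Rinv_0_lt_compat; lra|].
rewrite <- Rmult_assoc, Rinv_l, Rmult_1_l by lra. rewrite Rmult_comm. exact HM.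
Qed.

(** Summation by parts: the second difference of |l| is concentrated at 0, the other terms being the
    boundary terms at the ends of the range. *)
Lemma second_difference (d : Z -> C) N :
  (csum (zrange N) (fun l => wt l * d (l - 1)%Z) + csum (zrange N) (fun l => wt l * d (l + 1)%Z)
   - RtoC 2 * csum (zrange N) (fun l => wt l * d l))%C =
  (RtoC 2 * d 0%Z + (RtoC (INR N) * (d (Z.of_nat (S N)) + d (- Z.of_nat (S N))%Z)
   - RtoC (INR (S N)) * (d (Z.of_nat N) + d (- Z.of_nat N)%Z)))%C.
Proof.
assert (E2 : RtoC 2 = (RtoC 1 + RtoC 1)%C) by (rewrite <- RtoC_plus; f_equal; ring).
induction N as [|N IH].
- simpl. unfold wt. simpl. rewrite E2. ring.
- cbn [zrange csum].
  assert (W : forall z, Z.abs z = Z.of_nat (S N) -> wt z = RtoC (INR (S N))).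
  { intros z Hz. unfold wt. now rewrite Hz, <- INR_IZR_INZ. }
  rewrite (W (Z.of_nat (S N))), (W (- Z.of_nat (S N))%Z) by lia.
  replace (Z.of_nat (S N) - 1)%Z with (Z.of_nat N) by lia.
  replace (- Z.of_nat (S N) + 1)%Z with (- Z.of_nat N)%Z by lia.
  replace (Z.of_nat (S N) + 1)%Z with (Z.of_nat (S (S N))) by lia.
  replace (- Z.of_nat (S N) - 1)%Z with (- Z.of_nat (S (S N)))%Z by lia.
  set (X := csum (zrange N) (fun l => (wt l * d (l - 1)%Z)%C)) in *.
  set (Y := csum (zrange N) (fun l => (wt l * d (l + 1)%Z)%C)) in *.
  set (V := csum (zrange N) (fun l => (wt l * d l)%C)) in *.
  transitivity ((X + Y - RtoC 2 * V) + RtoC (INR (S N)) * (d (Z.of_nat N) + d (- Z.of_nat (S (S N)))%Z + d (Z.of_nat (S (S N))) + d (- Z.of_nat N)%Z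
     - RtoC 2 * (d (Z.of_nat (S N)) + d (- Z.of_nat (S N))%Z)))%C; [ring|].
  rewrite IH. rewrite (S_INR (S N)), (S_INR N), !RtoC_plus, E2. ring.
Qed.

(** Half the entry (n, -k) of A^2 - A'^2. *)
Definition corr n k N : C := csum (zrange N) (fun l => (c (n - l) * wt l * c (l + k))%C).

(** The three correlations are the sums of |l| against d(l - 1), d(l + 1) and d(l), where
    d(l) = c(n - l) c(l + k). *)
Lemma corr_second_difference n k :
  Clim (corr (n + 1) (k - 1)) (RtoC 0) -> Clim (corr (n - 1) (k + 1)) (RtoC 0) -> Clim (corr n k) (RtoC 0) ->
  (c n * c k)%C = RtoC 0.
Proof.
intros H1 H2 H3.
set (d := fun l => (c (n - l) * c (l + k))%C).
set (b := fun N => (RtoC (INR N) * (d (Z.of_nat (S N)) + d (- Z.of_nat (S N))%Z)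
   - RtoC (INR (S N)) * (d (Z.of_nat N) + d (- Z.of_nat N)%Z))%C).
assert (Hb : Clim b (RtoC 0)).
{ destruct (c_rapid 2%nat) as [B HB]. destruct (c_rapid 0%nat) as [B' HB'].
  assert (Hd : exists D, forall l, Cmod (d l) * jb l ^ 2 <= D).
  { exists (jb n ^ 2 * (B * B')). intros l. unfold d. rewrite Cmod_mult.
    pose proof (jb_peetre_pow l n 2%nat) as HP. specialize (HB (n - l)%Z). specialize (HB' (l + k)%Z).
    rewrite jb_sub_sym in HP.
    apply Rle_trans with (Cmod (c (n - l)) * Cmod (c (l + k)) * (jb n ^ 2 * jb (n - l) ^ 2)).
    - apply Rmult_le_compat_l; nonneg.
    - replace (Cmod (c (n - l)) * Cmod (c (l + k)) * (jb n ^ 2 * jb (n - l) ^ 2)) with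
        (jb n ^ 2 * ((Cmod (c (n - l)) * jb (n - l) ^ 2) * Cmod (c (l + k)))) by ring.
      apply Rmult_le_compat_l; [nonneg|]. apply Rmult_le_compat; [nonneg|nonneg|auto|]. rewrite Rmult_1_r in HB'. exact HB'. }
  destruct Hd as [D HD].
  assert (K : forall x N l, 0 <= x <= INR (S N) -> (INR (S N) <= jb l) -> Cmod (RtoC x * d l)%C <= D / INR (S N)).
  { intros x N l [Hx0 Hx] Hl. specialize (HD l). rewrite Cmod_mult, Cmod_R, Rabs_right by lra.
    assert (Hp : 0 < INR (S N)) by (apply lt_0_INR; lia).
    apply Rmult_le_reg_r with (INR (S N)); auto. unfold Rdiv. rewrite (Rmult_assoc D), Rinv_l, Rmult_1_r by lra.
    eapply Rle_trans; [|apply HD].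
    replace (x * Cmod (d l) * INR (S N)) with (Cmod (d l) * (x * INR (S N))) by ring.
    apply Rmult_le_compat_l; nonneg. nra. }
  apply Clim0_bound with (4 * D). intros N.
  assert (HJ : forall z, (Z.of_nat N <= Z.abs z)%Z -> INR (S N) <= jb z).
  { intros z Hz. rewrite <- jb_nat. unfold jb. apply Rplus_le_compat_l, IZR_le. lia. }
  unfold b.
  replace (RtoC (INR N) * (d (Z.of_nat (S N)) + d (- Z.of_nat (S N))%Z) - RtoC (INR (S N)) * (d (Z.of_nat N) + d (- Z.of_nat N)%Z))%C
   with (RtoC (INR N) * d (Z.of_nat (S N)) + (RtoC (INR N) * d (- Z.of_nat (S N))%Z +
    - (RtoC (INR (S N)) * d (Z.of_nat N) + RtoC (INR (S N)) * d (- Z.of_nat N)%Z)))%C by ring.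
  eapply Rle_trans; [apply Cmod_triangle|]. eapply Rle_trans; [apply Rplus_le_compat_l, Cmod_triangle|].
  rewrite Cmod_opp. eapply Rle_trans; [do 2 apply Rplus_le_compat_l; apply Cmod_triangle|].
  assert (0 <= INR N <= INR (S N)) by (split; [apply pos_INR|apply le_INR; lia]).
  assert (0 <= INR (S N) <= INR (S N)) by (split; [apply pos_INR|lra]).
  pose proof (K (INR N) N (Z.of_nat (S N)) ltac:(auto) (HJ (Z.of_nat (S N)) ltac:(lia))).
  pose proof (K (INR N) N (- Z.of_nat (S N))%Z ltac:(auto) (HJ (- Z.of_nat (S N))%Z ltac:(lia))).
  pose proof (K (INR (S N)) N (Z.of_nat N) ltac:(auto) (HJ (Z.of_nat N) ltac:(lia))).
  pose proof (K (INR (S N)) N (- Z.of_nat N)%Z ltac:(auto) (HJ (- Z.of_nat N)%Z ltac:(lia))).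
  unfold Rdiv in *. lra. }
assert (Hs : Clim (fun N => RtoC 2 * d 0%Z + b N)%C (RtoC 0)).
{ pose proof (Clim_minus _ _ _ _ (Clim_plus _ _ _ _ H1 H2) (Clim_mult_l (RtoC 2) _ _ H3)) as H4.
  replace (RtoC 0) with (RtoC 0 + RtoC 0 - RtoC 2 * RtoC 0)%C by ring.
  eapply Clim_ext_loc; [|apply H4]. exists 0%nat. intros N _. unfold b. rewrite <- second_difference.
  unfold corr, d. f_equal; [f_equal|f_equal]; apply csum_ext; intros l _.
  - replace (n - (l - 1))%Z with (n + 1 - l)%Z by lia. replace (l - 1 + k)%Z with (l + (k - 1))%Z by lia. ring.
  - replace (n - (l + 1))%Z with (n - 1 - l)%Z by lia. replace (l + 1 + k)%Z with (l + (k + 1))%Z by lia. ring.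
  - ring. }
pose proof (Clim_unique _ _ _ Hs (Clim_plus _ _ _ _ (Clim_const (RtoC 2 * d 0%Z)%C) Hb)) as E.
rewrite Cplus_0_r in E. unfold d in E. rewrite Z.sub_0_r in E. simpl in E.
symmetry in E. apply (f_equal (fun z => (RtoC (/ 2) * z)%C)) in E. rewrite Cmult_assoc, <- RtoC_mult, Rinv_l, Cmult_0_r, Cmult_1_l in E by lra.
exact E.
Qed.

Notation SS := (toep c).

Lemma gap0_corr N n k : (1 <= n)%Z -> (1 <= k)%Z -> gap SS 0 N n (- k)%Z = (RtoC 2 * corr n k N)%C.
Proof.
intros Hn Hk. unfold gap, kminus. cbn [repeat Nat.add app].
change [true; true] with (map negb [false; false]). rewrite <- wprod_flip by easy.
unfold kflip. replace (sg n * sg (- k)) with (-1) by (unfold sg; do 2 destruct Z_lt_dec; (lia || ring)).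
replace (wprod (zrange N) SS [false; false] n (- k)%Z) with (corr n k N).
- rewrite RtoC_m1.
  rewrite RtoC_two. ring.
- simpl. unfold kmul, corr, toep. apply csum_ext; intros l _. do 2 f_equal. lia.
Qed.

(** For m = 1 the squared norm of A - A' is twice the defect, and its entry (n - 1, -1) is 2 c(n). *)
Lemma limit_zero_coef m :
  (1 <= m)%nat -> is_lim_seq (fun N => defect SS m N (alt false (2 * m))) 0 -> forall n, (2 <= n)%Z -> c n = RtoC 0.
Proof.
intros Hm Hlim n Hn.
destruct (Nat.eq_dec m 1) as [->|Hm1].
(* A constant sequence bounded by a null sequence is zero. *)
- assert (H : Clim (fun _ : nat => (RtoC 2 * c n)%C) (RtoC 0)).
  { apply Clim_eps. intros e He.
    destruct (proj2 (is_lim_seq_spec _ _) Hlim (mkposreal (e * e / 2) ltac:(nra))) as [M K].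
    exists 0%nat. intros k _. set (N := max M (Z.to_nat n)). specialize (K N ltac:(lia)). simpl in K.
    rewrite Rminus_0_r in K. apply Rabs_def2 in K.
    pose proof (nrm2_word_minus (zrange N) SS (toep_adj c c_real) [false] [true] ltac:(easy) ltac:(easy)) as E.
    pose proof (word_tr_flip (zrange N) SS [false; false]) as EF.
    pose proof (nrm2_entry (zrange N) (kminus (wprod (zrange N) SS [false]) (wprod (zrange N) SS [true])) (n - 1) (-1)
       ltac:(apply In_zrange; lia) ltac:(apply In_zrange; lia) ltac:(lia) ltac:(lia)) as HE.
    rewrite E in HE. simpl in EF. cbn [app rev] in HE. rewrite EF in HE. unfold defect in K. simpl in K.
    unfold Cminus. rewrite <- RtoC_opp, Ropp_0, Cplus_0_r.
    replace (kminus (wprod (zrange N) SS [false]) (wprod (zrange N) SS [true]) (n - 1)%Z (-1)%Z) with (RtoC 2 * c n)%C in HE.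
    - destruct (Rlt_le_dec (Cmod (RtoC 2 * c n)) e) as [|Hle]; auto. exfalso.
      assert (e ^ 2 <= Cmod (RtoC 2 * c n) ^ 2) by (apply pow_incr; lra). simpl in *. lra.
    - simpl. unfold kminus, kflip, toep. replace (sg (n - 1) * sg (-1)) with (-1) by (unfold sg; do 2 destruct Z_lt_dec; (lia || ring)).
      replace (n - 1 - -1)%Z with n by lia.
      rewrite RtoC_m1.
      rewrite RtoC_two. ring. }
  pose proof (Clim_unique _ _ _ H (Clim_const _)) as E. symmetry in E.
  apply (f_equal (fun z => (RtoC (/ 2) * z)%C)) in E. rewrite Cmult_assoc, <- RtoC_mult, Rinv_l, Cmult_0_r, Cmult_1_l in E by lra.
  exact E.
(* A rotation of (A A')^m starts with A' A, as [defect_to_gap0] requires. *)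
- assert (HQ : forall n k, (1 <= n)%Z -> (1 <= k)%Z -> Clim (corr n k) (RtoC 0)).
  { intros n' k' Hn' Hk'.
    assert (Ea : exists z, alt true (2 * m - 1) ++ [false] = true :: false :: z /\ length (true :: false :: z) = (2 * m)%nat).
    { replace (2 * m - 1)%nat with (S (S (2 * m - 3))) by lia. eexists. split; [reflexivity|].
      simpl length. rewrite length_app, alt_length. simpl. lia. }
    destruct Ea as [z [Ez Lz]].
    assert (Clim (fun N => gap SS 0 N n' (- k')%Z) (RtoC 0)) as HV.
    { apply (defect_to_gap0 SS (toep_adj c c_real) (gap_norm_bounded c c_rapid c_real) m z); auto; try lia.
      eapply is_lim_seq_ext; [|apply Hlim]. intros N. unfold defect. rewrite <- Ez, word_tr_rot. do 2 f_equal.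
      replace (2 * m)%nat with (S (2 * m - 1)) at 1 by lia. reflexivity. }
    apply (Clim_mult_l (RtoC (/ 2))) in HV. rewrite Cmult_0_r in HV.
    eapply Clim_ext_loc; [|apply HV]. exists 0%nat. intros N _. rewrite gap0_corr by auto.
    rewrite Cmult_assoc, <- RtoC_mult, Rinv_l, Cmult_1_l by lra. reflexivity. }
  assert (E : (c n * c n)%C = RtoC 0) by (apply corr_second_difference; apply HQ; lia).
  destruct (Ceq_dec (c n) (RtoC 0)) as [|Hc]; auto. exfalso. now apply (Cmult_neq_0 _ _ Hc Hc).
Qed.

(** For non-zero i, j of opposite signs |i - j| >= 2, so A and A' agree away from the frequency 0, which
    carries no weight. *)
Lemma band_words_equal N w w' : (forall n, (2 <= Z.abs n)%Z -> c n = RtoC 0) -> length w = length w' ->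
  forall i j, i <> 0%Z -> j <> 0%Z -> wprod (zrange N) SS w i j = wprod (zrange N) SS w' i j.
Proof.
intros Hc.
assert (HL : forall b i j, i <> 0%Z -> j <> 0%Z -> letter SS b i j = SS i j).
{ intros [] i j Hi Hj; simpl; auto. unfold kflip, toep.
  destruct (Z_lt_le_dec (Z.abs (i - j)) 2).
  - replace (sg i * sg j) with 1 by (unfold sg; do 2 destruct Z_lt_dec; (lia || ring)). ring.
  - rewrite Hc by auto. ring. }
revert w'; induction w as [|b w IH]; intros [|b' w'] L i j Hi Hj; try easy.
injection L as L. destruct w as [|d w], w' as [|d' w']; try easy.
- simpl. now rewrite !HL.
- rewrite !wprod_cons by easy. unfold kmul. apply csum_ext; intros l _.
  destruct (Z.eq_dec l 0) as [->|Hl]; [unfold wt; simpl; ring|].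
  rewrite !HL by auto. rewrite (IH (d' :: w')); auto.
Qed.

Lemma trace_zero_iff m z : (1 <= m)%nat ->
  Clim (fun N => ktr (zrange N) (kminus (wprod (zrange N) SS (repeat false (2 * m))) (wprod (zrange N) SS (alt false (2 * m))))) z ->
  (z = RtoC 0 <-> forall n, (2 <= Z.abs n)%Z -> c n = RtoC 0).
Proof.
intros Hm Hlim. split.
- intros ->.
  assert (H : forall n, (2 <= n)%Z -> c n = RtoC 0).
  { apply (limit_zero_coef m Hm). destruct Hlim as [Hr _]. eapply is_lim_seq_ext; [|apply Hr].
    intros N. unfold defect, word_tr. rewrite <- tau_minus. reflexivity. }
  intros n Hn. destruct (Z_lt_le_dec n 0).
  + replace n with (- - n)%Z by lia. rewrite c_real, H by lia. apply Cconj_RtoC.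
  + apply H; lia.
- intros Hc. eapply Clim_unique; [apply Hlim|].
  eapply Clim_ext_loc; [|apply Clim_const]. exists 0%nat. intros N _. symmetry.
  apply csum_zero. intros i _. destruct (Z.eq_dec i 0) as [->|Hi]; [unfold wt; simpl; ring|].
  unfold kminus. rewrite (band_words_equal N (repeat false (2 * m)) (alt false (2 * m))); auto; [ring|].
  now rewrite repeat_length, alt_length.
Qed.
End Coefficients.

(** * Fourier coefficients of continuous functions *)

Definition cont (u : R -> C) : Prop :=
  forall t, continuous (fun s => Re (u s)) t /\ continuous (fun s => Im (u s)) t.

Definition CInt (u : R -> C) (x y : R) : C := (RInt (fun t => Re (u t)) x y, RInt (fun t => Im (u t)) x y).

Lemma cont_Re u x y : cont u -> ex_RInt (fun t => Re (u t)) x y.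
Proof. intros H. apply (@ex_RInt_continuous R_CompleteNormedModule). intros; exact (proj1 (H _)). Qed.
Lemma cont_Im u x y : cont u -> ex_RInt (fun t => Im (u t)) x y.
Proof. intros H. apply (@ex_RInt_continuous R_CompleteNormedModule). intros; exact (proj2 (H _)). Qed.

Lemma RInt_CInt u x y : cont u -> @RInt C_R_CompleteNormedModule u x y = CInt u x y.
Proof.
intros H. apply is_RInt_unique. apply (is_RInt_fct_extend_pair u).
- apply (@RInt_correct R_CompleteNormedModule), (cont_Re u x y H).
- apply (@RInt_correct R_CompleteNormedModule), (cont_Im u x y H).
Qed.

Lemma cont_const z : cont (fun _ => z).
Proof. intros t; split; apply continuous_const. Qed.

Lemma cont_plus u v : cont u -> cont v -> cont (fun t => (u t + v t)%C).
Proof.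
intros Hu Hv t. destruct (Hu t), (Hv t). split; simpl.
- now apply (continuous_plus (fun s => Re (u s)) (fun s => Re (v s))).
- now apply (continuous_plus (fun s => Im (u s)) (fun s => Im (v s))).
Qed.

Lemma cont_mult u v : cont u -> cont v -> cont (fun t => (u t * v t)%C).
Proof.
intros Hu Hv t. destruct (Hu t) as [U1 U2], (Hv t) as [V1 V2]. split; simpl.
- apply (continuous_minus (fun s => Re (u s) * Re (v s)) (fun s => Im (u s) * Im (v s)));
   [apply (continuous_mult (fun s => Re (u s)) (fun s => Re (v s)))|apply (continuous_mult (fun s => Im (u s)) (fun s => Im (v s)))]; auto.
- apply (continuous_plus (fun s => Re (u s) * Im (v s)) (fun s => Im (u s) * Re (v s)));
   [apply (continuous_mult (fun s => Re (u s)) (fun s => Im (v s)))|apply (continuous_mult (fun s => Im (u s)) (fun s => Re (v s)))]; auto.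
Qed.

Lemma cont_opp u : cont u -> cont (fun t => (- u t)%C).
Proof.
intros Hu t. destruct (Hu t). split; simpl.
- now apply (continuous_opp (fun s => Re (u s))).
- now apply (continuous_opp (fun s => Im (u s))).
Qed.

Lemma cont_minus u v : cont u -> cont v -> cont (fun t => (u t - v t)%C).
Proof. intros Hu Hv. apply cont_plus; auto. now apply cont_opp. Qed.

Lemma cont_expi n : cont (expi n).
Proof.
intros t. split; simpl; apply (ex_derive_continuous (K := R_AbsRing) (V := R_NormedModule)); auto_derive; auto.
Qed.

Lemma cont_csum l (f : Z -> R -> C) : (forall x, cont (f x)) -> cont (fun t => csum l (fun x => f x t)).
Proof.
intros H. induction l as [|x l IH]; simpl; [apply cont_const|]. now apply cont_plus.
Qed.

Lemma CInt_plus u v x y : cont u -> cont v -> CInt (fun t => (u t + v t)%C) x y = (CInt u x y + CInt v x y)%C.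
Proof.
intros Hu Hv. unfold CInt, Cplus; simpl. f_equal.
- apply (RInt_plus (V := R_CompleteNormedModule) (fun t => Re (u t)) (fun t => Re (v t))); now apply cont_Re.
- apply (RInt_plus (V := R_CompleteNormedModule) (fun t => Im (u t)) (fun t => Im (v t))); now apply cont_Im.
Qed.

Lemma ex_RInt_scal' (f : R -> R) k x y : ex_RInt f x y -> ex_RInt (fun t => k * f t) x y.
Proof. apply (ex_RInt_scal (V := R_NormedModule)). Qed.
Lemma RInt_scal' (f : R -> R) k x y : ex_RInt f x y -> RInt (fun t => k * f t) x y = k * RInt f x y.
Proof. apply (RInt_scal (V := R_CompleteNormedModule)). Qed.

Lemma CInt_scal z u x y : cont u -> CInt (fun t => (z * u t)%C) x y = (z * CInt u x y)%C.
Proof.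
intros Hu. pose proof (cont_Re u x y Hu) as H1. pose proof (cont_Im u x y Hu) as H2.
unfold CInt, Cmult; simpl. f_equal.
- rewrite <- !RInt_scal' by auto. apply (RInt_minus (V := R_CompleteNormedModule)); now apply ex_RInt_scal'.
- rewrite <- !RInt_scal' by auto. apply (RInt_plus (V := R_CompleteNormedModule)); now apply ex_RInt_scal'.
Qed.

Lemma CInt_bound u x y M : x <= y -> cont u -> (forall t, x <= t <= y -> Cmod (u t) <= M) -> Cmod (CInt u x y) <= 2 * (y - x) * M.
Proof.
intros Hxy Hu HM. eapply Rle_trans; [apply Cmod_le_sum|]. simpl.
assert (Rabs (RInt (fun t => Re (u t)) x y) <= (y - x) * M).
{ apply abs_RInt_le_const; auto; [now apply cont_Re|]. intros t Ht. eapply Rle_trans; [apply Rabs_Re_le|auto]. }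
assert (Rabs (RInt (fun t => Im (u t)) x y) <= (y - x) * M).
{ apply abs_RInt_le_const; auto; [now apply cont_Im|]. intros t Ht. eapply Rle_trans; [apply Rabs_Im_le|auto]. }
lra.
Qed.

Lemma cont_bounded u x y : x <= y -> cont u -> exists M, forall t, x <= t <= y -> Cmod (u t) <= M.
Proof.
intros Hxy Hu.
destruct (continuity_ab_maj (fun t => Rabs (Re (u t)) + Rabs (Im (u t))) x y Hxy) as [Mx [H _]].
- intros t _. apply continuity_pt_filterlim.
  apply (continuous_plus (fun t => Rabs (Re (u t))) (fun t => Rabs (Im (u t)))).
  + apply (continuous_comp (fun t => Re (u t)) Rabs); [exact (proj1 (Hu t))|apply continuous_Rabs].
  + apply (continuous_comp (fun t => Im (u t)) Rabs); [exact (proj2 (Hu t))|apply continuous_Rabs].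
- eexists. intros t Ht. eapply Rle_trans; [apply Cmod_le_sum|apply (H t Ht)].
Qed.

Lemma Cmod_expi n t : Cmod (expi n t) = 1.
Proof.
unfold Cmod, expi; simpl. rewrite !Rmult_1_r, Rplus_comm. pose proof (sin2_cos2 (IZR n * t)) as H. unfold Rsqr in H.
rewrite H. apply sqrt_1.
Qed.

Lemma expi_0 t : expi 0 t = RtoC 1.
Proof. unfold expi. rewrite Rmult_0_l, cos_0, sin_0. reflexivity. Qed.

Lemma fourier_coef_CInt u n : cont u -> fourier_coef u n = (RtoC (/ (2 * PI)) * CInt (fun t => (u t * expi (- n) t)%C) 0 (2 * PI))%C.
Proof.
intros H. unfold fourier_coef. rewrite RInt_CInt; auto. apply cont_mult; auto. apply cont_expi.
Qed.

Lemma fourier_coef_plus u v n : cont u -> cont v ->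
  fourier_coef (fun t => (u t + v t)%C) n = (fourier_coef u n + fourier_coef v n)%C.
Proof.
intros Hu Hv. rewrite !fourier_coef_CInt; auto; [|now apply cont_plus].
rewrite <- Cmult_plus_distr_l, <- CInt_plus by (apply cont_mult; auto using cont_expi).
do 2 f_equal. apply functional_extensionality; intros; ring.
Qed.

Lemma fourier_coef_scal z u n : cont u -> fourier_coef (fun t => (z * u t)%C) n = (z * fourier_coef u n)%C.
Proof.
intros Hu. rewrite !fourier_coef_CInt; auto; [|apply cont_mult; auto; apply cont_const].
replace (fun t => (z * u t * expi (- n) t)%C) with (fun t => (z * (u t * expi (- n) t))%C)
 by (apply functional_extensionality; intros; ring).
rewrite CInt_scal by (apply cont_mult; auto using cont_expi). ring.
Qed.

Lemma fourier_coef_minus u v n : cont u -> cont v ->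
  fourier_coef (fun t => (u t - v t)%C) n = (fourier_coef u n - fourier_coef v n)%C.
Proof.
intros Hu Hv.
replace (fun t => (u t - v t)%C) with (fun t => (u t + (- RtoC 1) * v t)%C) by (apply functional_extensionality; intros; ring).
rewrite fourier_coef_plus, fourier_coef_scal; auto; [ring|]. apply cont_mult; auto using cont_const.
Qed.

Lemma fourier_coef_csum l (f : Z -> R -> C) n : (forall x, cont (f x)) ->
  fourier_coef (fun t => csum l (fun x => f x t)) n = csum l (fun x => fourier_coef (f x) n).
Proof.
intros H. induction l as [|x l IH]; simpl.
- transitivity (fourier_coef (fun _ : R => (RtoC 0 * RtoC 0)%C) n).
  + f_equal. apply functional_extensionality; intros; ring.
  + rewrite (fourier_coef_scal (RtoC 0) (fun _ => RtoC 0)) by apply cont_const. ring.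
- rewrite fourier_coef_plus, IH; auto. now apply cont_csum.
Qed.

Lemma fourier_coef_mult_expi u k n : fourier_coef (fun t => (u t * expi k t)%C) n = fourier_coef u (n - k).
Proof.
unfold fourier_coef. do 2 f_equal. apply functional_extensionality; intros t.
rewrite <- Cmult_assoc, expi_mul. do 2 f_equal. lia.
Qed.

Lemma fourier_coef_bound u n M : cont u -> (forall t, 0 <= t <= 2 * PI -> Cmod (u t) <= M) -> Cmod (fourier_coef u n) <= 2 * M.
Proof.
intros Hu HM. pose proof PI_RGT_0. rewrite fourier_coef_CInt, Cmod_mult, Cmod_R by auto.
assert (Hp : 0 < / (2 * PI)) by (apply Rinv_0_lt_compat; lra).
rewrite Rabs_right by lra.
apply Rle_trans with (/ (2 * PI) * (2 * (2 * PI - 0) * M)); [|right; field; lra].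
apply Rmult_le_compat_l; [lra|].
apply CInt_bound; [lra|apply cont_mult; auto using cont_expi|].
intros t Ht. rewrite Cmod_mult, Cmod_expi, Rmult_1_r. auto.
Qed.

Lemma series_tail (d : Z -> C) B w t N :
  (forall l, Cmod (d l) <= B / jb l ^ 2) ->
  Clim (fun N => csum (zrange N) (fun l => (d l * expi l t)%C)) w ->
  Cmod (w - csum (zrange N) (fun l => (d l * expi l t)%C)) <= 2 * B / INR (S N).
Proof.
intros Hd Hw.
assert (Hw' : Clim (fun n => csum (zrange (n + N)) (fun l => (d l * expi l t)%C)) w).
{ destruct Hw as [H1 H2]. split; [apply (is_lim_seq_incr_n _ N) in H1|apply (is_lim_seq_incr_n _ N) in H2]; auto. }
eapply Clim_Cmod_le; [apply Clim_minus; [apply Hw'|apply Clim_const]|].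
intros n. simpl. apply tail_csum'; [|lia]. intros l. rewrite Cmod_mult, Cmod_expi, Rmult_1_r. auto.
Qed.

Lemma cont_series (d : Z -> C) B (w : R -> C) :
  (forall l, Cmod (d l) <= B / jb l ^ 2) ->
  (forall t, Clim (fun N => csum (zrange N) (fun l => (d l * expi l t)%C)) (w t)) ->
  cont w.
Proof.
intros Hd Hw.
set (s := fun N t => csum (zrange N) (fun l => (d l * expi l t)%C)).
assert (Hs : forall N, cont (s N)) by (intros; apply cont_csum; intros; apply cont_mult; auto using cont_const, cont_expi).
assert (HB : 0 <= B) by (apply (bound_nonneg d B Hd)).
assert (HT : forall N t, Cmod (w t - s N t) <= 2 * B / INR (S N)) by (intros; now apply series_tail).
assert (K : forall (pr : C -> R), (forall z z', pr (z - z')%C = pr z - pr z') -> (forall z, Rabs (pr z) <= Cmod z) ->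
  (forall N t, continuous (fun x => pr (s N x)) t) -> forall t, continuous (fun x => pr (w x)) t).
{ intros pr Hlin Hle Hc t. apply filterlim_locally. intros eps.
  destruct (inv_INR_small (eps / (6 * (B + 1)))) as [N HN]; [apply Rdiv_lt_0_compat; [apply cond_pos|lra]|].
  specialize (HN N (le_n _)).
  assert (HTN : 2 * B / INR (S N) < eps / 3).
  { assert (0 < / INR (S N)) by (apply Rinv_0_lt_compat, lt_0_INR; lia).
    assert (6 * (B + 1) * / INR (S N) < eps).
    { apply Rmult_lt_reg_l with (/ (6 * (B + 1))); [apply Rinv_0_lt_compat; lra|].
      rewrite <- Rmult_assoc, Rinv_l, Rmult_1_l by lra. rewrite Rmult_comm. exact HN. }
    unfold Rdiv. lra. }
  assert (He : 0 < eps / 3) by (pose proof (cond_pos eps); lra).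
  specialize (Hc N t). apply filterlim_locally with (eps := mkposreal _ He) in Hc.
  eapply filter_imp; [|apply Hc]. intros x Hx.
  change (Rabs (pr (s N x) - pr (s N t)) < eps / 3) in Hx. change (Rabs (pr (w x) - pr (w t)) < eps).
  pose proof (Hle (w x - s N x)%C) as H1. pose proof (Hle (w t - s N t)%C) as H2. rewrite Hlin in H1, H2.
  pose proof (HT N x). pose proof (HT N t).
  apply Rabs_def2 in Hx. assert (H1' : Rabs (pr (w x) - pr (s N x)) < eps / 3) by lra.
  assert (H2' : Rabs (pr (w t) - pr (s N t)) < eps / 3) by lra.
  apply Rabs_def2 in H1', H2'. apply Rabs_def1; lra. }
intros t. split; apply K; auto using Rabs_Re_le, Rabs_Im_le.
- intros N x; exact (proj1 (Hs N x)).
- intros N x; exact (proj2 (Hs N x)).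
Qed.

(** Multiplication by [a] turns into convolution of the coefficients: the partial sums of the series
    converge uniformly, and each of them is a combination of shifts of the coefficients of [a]. *)
Lemma fourier_coef_product a (d : Z -> C) B (w : R -> C) i : cont a ->
  (forall l, Cmod (d l) <= B / jb l ^ 2) ->
  (forall t, Clim (fun N => csum (zrange N) (fun l => (d l * expi l t)%C)) (w t)) ->
  fourier_coef (fun t => (a t * w t)%C) i = ZSeries (fun l => (fourier_coef a (i - l) * d l)%C).
Proof.
intros Ha Hd Hw. pose proof PI_RGT_0.
destruct (cont_bounded a 0 (2 * PI) ltac:(lra) Ha) as [M HM].
assert (HM0 : 0 <= M) by (eapply Rle_trans; [apply Cmod_ge_0|apply (HM 0); lra]).
assert (Hcw : cont w) by (eapply cont_series; eauto).
assert (HB : 0 <= B) by (apply (bound_nonneg d B Hd)).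
assert (Hs : forall N, cont (fun t => csum (zrange N) (fun l => (d l * expi l t)%C)))
 by (intros; apply cont_csum; intros; apply cont_mult; auto using cont_const, cont_expi).
assert (E : forall N, csum (zrange N) (fun l => (fourier_coef a (i - l) * d l)%C) =
   fourier_coef (fun t => (a t * csum (zrange N) (fun l => (d l * expi l t)%C))%C) i).
{ intros N. symmetry.
  replace (fun t => (a t * csum (zrange N) (fun l => (d l * expi l t)%C))%C) with
    (fun t => csum (zrange N) (fun l => (d l * (a t * expi l t))%C)).
  - rewrite (fourier_coef_csum _ (fun l t => (d l * (a t * expi l t))%C)).
    + apply csum_ext; intros l _. rewrite fourier_coef_scal, fourier_coef_mult_expi; [ring|].
      apply cont_mult; auto using cont_expi.
    + intros l. apply cont_mult; [apply cont_const|apply cont_mult; auto using cont_expi].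
  - apply functional_extensionality; intros t. rewrite <- csum_mult_l. apply csum_ext; intros; ring. }
eapply Clim_unique; [|apply (Clim_ZSeries _ (2 * M * B))].
- apply Clim_eps. intros e He.
  destruct (inv_INR_small (e / (4 * M * B + 1))) as [N HN]; [apply Rdiv_lt_0_compat; nra|].
  exists N. intros n Hn. specialize (HN n Hn). rewrite E, <- fourier_coef_minus by (apply cont_mult; auto).
  eapply Rle_lt_trans; [apply (fourier_coef_bound _ _ (M * (2 * B / INR (S n))))|].
  + apply cont_minus; apply cont_mult; auto.
  + intros t Ht.
    replace (a t * csum (zrange n) (fun l => (d l * expi l t)%C) - a t * w t)%C with
      (- (a t * (w t - csum (zrange n) (fun l => (d l * expi l t)%C))))%C by ring.
    rewrite Cmod_opp, Cmod_mult. apply Rmult_le_compat; auto using Cmod_ge_0. now apply series_tail.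
  + assert (0 < / INR (S n)) by (apply Rinv_0_lt_compat, lt_0_INR; lia).
    replace (2 * (M * (2 * B / INR (S n)))) with (4 * M * B * / INR (S n)) by (unfold Rdiv; ring).
    assert (0 <= 4 * M * B) by nra.
    apply Rle_lt_trans with ((4 * M * B + 1) * / INR (S n)); [nra|].
    apply Rmult_lt_reg_l with (/ (4 * M * B + 1)); [apply Rinv_0_lt_compat; lra|].
    rewrite <- Rmult_assoc, Rinv_l, Rmult_1_l by lra. rewrite Rmult_comm. exact HN.
- intros l. rewrite Cmod_mult. unfold Rdiv in *. rewrite Rmult_assoc.
  apply Rmult_le_compat; auto using Cmod_ge_0. now apply fourier_coef_bound.
Qed.

(** * Pointwise Fourier inversion *)

Definition energy (u : R -> C) : R := RInt (fun t => Cmod (u t) ^ 2) 0 (2 * PI).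

Lemma Cmod_sq_Re u : (fun t => Cmod (u t) ^ 2) = (fun t : R => Re (u t * Cconj (u t))%C).
Proof. apply functional_extensionality; intros t. now rewrite Cmult_conj_R. Qed.

Lemma cont_conj u : cont u -> cont (fun t => Cconj (u t)).
Proof.
intros Hu t. destruct (Hu t). split; simpl; auto. now apply (continuous_opp (fun s => Im (u s))).
Qed.

Lemma energy_nonneg u : cont u -> 0 <= energy u.
Proof.
intros Hu. pose proof PI_RGT_0. unfold energy. apply RInt_ge_0; [lra| |intros; apply pow2_ge_0].
rewrite Cmod_sq_Re. apply cont_Re, cont_mult; auto using cont_conj.
Qed.

Lemma expi_conj n t : Cconj (expi n t) = expi (- n) t.
Proof.
unfold expi, Cconj; simpl. rewrite opp_IZR, Ropp_mult_distr_l_reverse, cos_neg, sin_neg. reflexivity.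
Qed.

(** Pythagoras: removing one Fourier mode lowers the energy by its share; Bessel's inequality is the
    iteration of this step. *)
Lemma energy_remove u n : cont u ->
  energy (fun t => (u t - fourier_coef u n * expi n t)%C) = energy u - 2 * PI * Cmod (fourier_coef u n) ^ 2.
Proof.
intros Hu. pose proof PI_RGT_0. set (z := fourier_coef u n).
assert (Hz : CInt (fun t => (u t * expi (- n) t)%C) 0 (2 * PI) = (RtoC (2 * PI) * z)%C).
{ unfold z. rewrite fourier_coef_CInt by auto. rewrite Cmult_assoc, <- RtoC_mult, Rinv_r, Cmult_1_l by lra. reflexivity. }
assert (Hpt : forall t, Cmod (u t - z * expi n t) ^ 2 = Cmod (u t) ^ 2 + ((-2) * Re (Cconj z * (u t * expi (- n) t))%C + Cmod z ^ 2)).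
{ intros t. assert (E : forall v, Cmod v ^ 2 = Re (v * Cconj v)%C) by (intros; now rewrite Cmult_conj_R).
  pose proof (Cmod_expi n t) as He. rewrite <- (expi_conj n t).
  replace (Cmod z ^ 2) with (Cmod (z * expi n t) ^ 2) by (rewrite Cmod_mult, He, Rmult_1_r; reflexivity).
  rewrite !E. destruct (u t), z, (expi n t). unfold Cconj, Cminus, Copp, Cmult, Cplus; simpl. ring. }
unfold energy. rewrite (RInt_ext _ (fun t => Cmod (u t) ^ 2 + ((-2) * Re (Cconj z * (u t * expi (- n) t))%C + Cmod z ^ 2))) by (intros; apply Hpt).
assert (H1 : cont (fun t => (Cconj z * (u t * expi (- n) t))%C)) by (apply cont_mult; [apply cont_const|apply cont_mult; auto using cont_expi]).
assert (E1 : ex_RInt (fun t => Cmod (u t) ^ 2) 0 (2 * PI)) by (rewrite Cmod_sq_Re; apply cont_Re, cont_mult; auto using cont_conj).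
assert (E2 : ex_RInt (fun t => (-2) * Re (Cconj z * (u t * expi (- n) t))%C) 0 (2 * PI)) by (apply ex_RInt_scal', cont_Re, H1).
assert (E3 : ex_RInt (fun _ : R => Cmod z ^ 2) 0 (2 * PI)) by apply ex_RInt_const.
rewrite (RInt_plus (V := R_CompleteNormedModule) (fun t => Cmod (u t) ^ 2)); [|exact E1|apply (ex_RInt_plus (V := R_NormedModule)); auto].
rewrite (RInt_plus (V := R_CompleteNormedModule) (fun t => (-2) * Re (Cconj z * (u t * expi (- n) t))%C)) by auto.
rewrite RInt_scal' by (apply cont_Re, H1). rewrite RInt_const.
change (RInt (fun t => Re (Cconj z * (u t * expi (- n) t))%C) 0 (2 * PI)) with
  (Re (CInt (fun t => (Cconj z * (u t * expi (- n) t))%C) 0 (2 * PI))).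
rewrite CInt_scal, Hz by (apply cont_mult; auto using cont_expi).
replace (Cconj z * (RtoC (2 * PI) * z))%C with (RtoC (2 * PI) * (z * Cconj z))%C by ring.
rewrite Re_RtoC_mult, Cmult_conj_R. unfold plus, scal; simpl. unfold mult; simpl. ring.
Qed.

Lemma bessel l u : NoDup l -> cont u -> 2 * PI * rsum l (fun n => Cmod (fourier_coef u n) ^ 2) <= energy u.
Proof.
intros Hl. revert u. induction Hl as [|n l Hn Hl IH]; intros u Hu; cbn [rsum].
- pose proof (energy_nonneg u Hu). lra.
- assert (Hc : cont (fun t => (u t - fourier_coef u n * expi n t)%C)) by (apply cont_minus; auto; apply cont_mult; auto using cont_const, cont_expi).
  specialize (IH _ Hc). rewrite energy_remove in IH by auto.
  rewrite (rsum_ext l _ (fun n => Cmod (fourier_coef u n) ^ 2)) in IH; [lra|].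
  intros k Hk. rewrite fourier_coef_minus, fourier_coef_scal, fourier_coef_expi; auto using cont_expi.
  + destruct Z.eq_dec as [->|]; [easy|]. do 2 f_equal. ring.
  + apply cont_mult; auto using cont_const, cont_expi.
Qed.

(** By Bessel's inequality the sums of the squared moduli of the coefficients are bounded, so their terms
    tend to 0. *)
Lemma riemann_lebesgue u : cont u ->
  Clim (fun N => fourier_coef u (Z.of_nat N)) (RtoC 0) /\ Clim (fun N => fourier_coef u (- Z.of_nat (S N))%Z) (RtoC 0).
Proof.
intros Hu. pose proof PI_RGT_0.
set (s := fun N => rsum (zrange N) (fun n => Cmod (fourier_coef u n) ^ 2)).
assert (Hs : ex_finite_lim_seq s).
{ apply ex_finite_lim_seq_incr with (energy u / (2 * PI)).
  - intros N. unfold s. cbn [zrange rsum]. pose proof (pow2_ge_0 (Cmod (fourier_coef u (Z.of_nat (S N))))).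
    pose proof (pow2_ge_0 (Cmod (fourier_coef u (- Z.of_nat (S N))%Z))). lra.
  - intros N. apply Rmult_le_reg_l with (2 * PI); [lra|].
    replace (2 * PI * (energy u / (2 * PI))) with (energy u) by (field; lra).
    apply bessel; auto using NoDup_zrange. }
destruct Hs as [L HL].
assert (Hd : is_lim_seq (fun N => s (S N) - s N) 0).
{ replace 0 with (L - L) by ring. apply is_lim_seq_minus'; auto. apply (is_lim_seq_incr_1 s) in HL. exact HL. }
assert (K : forall v : nat -> C, (forall N, Cmod (v N) ^ 2 <= s (S N) - s N) -> Clim v (RtoC 0)).
{ intros v Hv. apply Clim_eps. intros e He.
  destruct (proj2 (is_lim_seq_spec _ _) Hd (mkposreal (e * e) ltac:(nra))) as [N HN].
  exists N. intros n Hn. specialize (HN n Hn). simpl in HN. rewrite Rminus_0_r in HN. apply Rabs_def2 in HN.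
  specialize (Hv n). unfold Cminus. rewrite <- RtoC_opp, Ropp_0, Cplus_0_r.
  destruct (Rlt_le_dec (Cmod (v n)) e) as [|Hle]; auto. exfalso.
  assert (e ^ 2 <= Cmod (v n) ^ 2) by (apply pow_incr; lra). simpl in *. lra. }
split.
- assert (H1 : Clim (fun N => fourier_coef u (Z.of_nat (S N))) (RtoC 0)).
  { apply K. intros N. unfold s. cbn [zrange rsum]. pose proof (pow2_ge_0 (Cmod (fourier_coef u (- Z.of_nat (S N))%Z))). lra. }
  destruct H1 as [H1 H2]. split; [apply (is_lim_seq_incr_1 (fun N => Re (fourier_coef u (Z.of_nat N))))|apply (is_lim_seq_incr_1 (fun N => Im (fourier_coef u (Z.of_nat N))))]; auto.
- apply K. intros N. unfold s. cbn [zrange rsum]. pose proof (pow2_ge_0 (Cmod (fourier_coef u (Z.of_nat (S N))))). lra.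
Qed.

Lemma diffquot_continuous (phi : R -> R) l : phi 0 = 0 -> is_derive phi 0 l ->
  continuous (fun t => if Req_EM_T t 0 then l else phi t / t) 0.
Proof.
intros H0 Hd. apply is_derive_Reals in Hd. apply filterlim_locally. intros eps.
destruct (Hd eps (cond_pos eps)) as [dl Hdl]. exists dl. intros y Hy.
destruct (Req_EM_T 0 0) as [_|]; [|easy].
destruct (Req_EM_T y 0) as [->|Hy0].
- apply ball_center.
- change (Rabs (y - 0) < dl) in Hy. rewrite Rminus_0_r in Hy. specialize (Hdl y Hy0 Hy).
  rewrite Rplus_0_l, H0, Rminus_0_r in Hdl. exact Hdl.
Qed.

(** [phi t * cot (t / 2)], extended continuously to the multiples of [2 * PI] when phi is [2 * PI]-periodic,
    vanishes at 0 and has the derivative [l] there. *)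
Definition cotq (phi : R -> R) (l t : R) : R :=
  if Req_EM_T (sin (t / 2)) 0 then 2 * l else phi t * cos (t / 2) / sin (t / 2).

Lemma periodic_Z (phi : R -> R) : (forall t, phi (t + 2 * PI) = phi t) -> forall k t, phi (t + IZR k * (2 * PI)) = phi t.
Proof.
intros H.
assert (Hn : forall n t, phi (t + INR n * (2 * PI)) = phi t).
{ induction n as [|n IH]; intros t; [simpl; f_equal; ring|].
  rewrite S_INR. replace (t + (INR n + 1) * (2 * PI)) with ((t + INR n * (2 * PI)) + 2 * PI) by ring. now rewrite H. }
intros k t. destruct (Z_lt_le_dec k 0) as [Hk|Hk].
- rewrite <- (Hn (Z.to_nat (- k))). f_equal. rewrite INR_IZR_INZ, Z2Nat.id, opp_IZR by lia. ring.
- rewrite <- (Hn (Z.to_nat k) t). do 2 f_equal. rewrite INR_IZR_INZ, Z2Nat.id by lia. ring.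
Qed.

Lemma sin_half_zero t : sin (t / 2) = 0 -> exists k, t = IZR k * (2 * PI).
Proof.
intros H. apply sin_eq_0_0 in H. destruct H as [k Hk]. exists k. lra.
Qed.

Lemma cotq_periodic phi l : (forall t, phi (t + 2 * PI) = phi t) -> forall t, cotq phi l (t + 2 * PI) = cotq phi l t.
Proof.
intros H t. unfold cotq. rewrite H. replace ((t + 2 * PI) / 2) with (t / 2 + PI) by field.
rewrite neg_sin, neg_cos. destruct (Req_EM_T (- sin (t / 2)) 0), (Req_EM_T (sin (t / 2)) 0); try lra.
field. auto.
Qed.

Lemma cotq_continuous_0 phi l : phi 0 = 0 -> is_derive phi 0 l -> continuous (cotq phi l) 0.
Proof.
intros H0 Hd. pose proof PI_RGT_0.
pose proof (diffquot_continuous phi l H0 Hd) as H1.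
assert (Hsd : is_derive (fun t => sin (t / 2)) 0 (/ 2)) by (auto_derive; auto; rewrite Rmult_0_l, cos_0; ring).
pose proof (diffquot_continuous (fun t => sin (t / 2)) (/ 2) ltac:(unfold Rdiv; rewrite Rmult_0_l; apply sin_0) Hsd) as H2.
assert (H3 : continuous (fun t => cos (t / 2)) 0) by (apply (ex_derive_continuous (K := R_AbsRing) (V := R_NormedModule)); auto_derive; auto).
apply continuous_ext_loc with (fun t => (if Req_EM_T t 0 then l else phi t / t) *
   (/ (if Req_EM_T t 0 then / 2 else sin (t / 2) / t) * cos (t / 2))).
- exists (mkposreal _ H). intros t Ht. change (Rabs (t - 0) < PI) in Ht. rewrite Rminus_0_r in Ht. apply Rabs_def2 in Ht.
  unfold cotq. destruct (Req_EM_T t 0) as [->|Ht0].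
  + unfold Rdiv. rewrite Rmult_0_l, sin_0, cos_0. destruct Req_EM_T; [|easy]. change (l * (/ / 2 * 1) = 2 * l). field.
  + destruct Req_EM_T as [E|E].
    * exfalso. destruct (Rlt_le_dec t 0).
      -- assert (sin (- (t / 2)) > 0) by (apply sin_gt_0; lra). rewrite sin_neg in *. lra.
      -- assert (sin (t / 2) > 0) by (apply sin_gt_0; lra). lra.
    * change (phi t / t * (/ (sin (t / 2) / t) * cos (t / 2)) = phi t * cos (t / 2) / sin (t / 2)). field. auto.
- apply (continuous_mult (K := R_AbsRing)); [exact H1|]. apply (continuous_mult (K := R_AbsRing)); [|exact H3].
  apply continuous_Rinv_comp; [exact H2|]. destruct Req_EM_T; [lra|easy].
Qed.

Lemma cotq_continuous phi l : (forall t, phi (t + 2 * PI) = phi t) -> phi 0 = 0 -> is_derive phi 0 l ->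
  (forall t, continuous phi t) -> forall t, continuous (cotq phi l) t.
Proof.
intros Hp H0 Hd Hc t.
destruct (Req_EM_T (sin (t / 2)) 0) as [E|E].
- destruct (sin_half_zero t E) as [k ->].
  apply continuous_ext with (fun t => cotq phi l (t - IZR k * (2 * PI))).
  + intros x. rewrite <- (periodic_Z (cotq phi l) (cotq_periodic phi l Hp) k). f_equal. ring.
  + apply (continuous_comp (fun t => t - IZR k * (2 * PI)) (cotq phi l)).
    * apply (ex_derive_continuous (K := R_AbsRing) (V := R_NormedModule)); auto_derive; auto.
    * unfold Rminus. rewrite Rplus_opp_r. now apply cotq_continuous_0.
- assert (Hs : forall x, continuous (fun t => sin (t / 2)) x) by (intros; apply (ex_derive_continuous (K := R_AbsRing) (V := R_NormedModule)); auto_derive; auto).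
  assert (Hcs : forall x, continuous (fun t => cos (t / 2)) x) by (intros; apply (ex_derive_continuous (K := R_AbsRing) (V := R_NormedModule)); auto_derive; auto).
  apply continuous_ext_loc with (fun t => phi t * cos (t / 2) * / sin (t / 2)).
  + assert (Hne : locally t (fun x => sin (x / 2) <> 0)) by (apply (Hs t (fun y => y <> 0)); now apply open_neq).
    eapply filter_imp; [|apply Hne]. intros x Hx. unfold cotq. destruct Req_EM_T; [easy|reflexivity].
  + apply (continuous_mult (K := R_AbsRing)); [apply (continuous_mult (K := R_AbsRing)); auto|].
    now apply continuous_Rinv_comp.
Qed.

Definition cdiff (u : R -> C) : Prop := forall t, ex_derive (fun s => Re (u s)) t /\ ex_derive (fun s => Im (u s)) t.

Lemma cdiff_cont u : cdiff u -> cont u.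
Proof. intros H t; split; apply (ex_derive_continuous (K := R_AbsRing) (V := R_NormedModule)); apply H. Qed.

(** The quotient is written with 1 / (e^{it} - 1) = - 1/2 - (i/2) cot (t/2), which reduces the removable
    singularities to the real function [cotq]. *)
Lemma divide_by_e1 u : (forall t, u (t + 2 * PI) = u t) -> cdiff u -> u 0 = RtoC 0 ->
  exists g, cont g /\ forall t, u t = ((expi 1 t - RtoC 1) * g t)%C.
Proof.
intros Hp Hd H0.
set (lr := Derive (fun s => Re (u s)) 0). set (li := Derive (fun s => Im (u s)) 0).
assert (Hr : forall t, continuous (cotq (fun s => Re (u s)) lr) t).
{ apply cotq_continuous; [intros; now rewrite Hp|now rewrite H0|apply Derive_correct, (proj1 (Hd 0))|intros; exact (proj1 (cdiff_cont u Hd _))]. }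
assert (Hi : forall t, continuous (cotq (fun s => Im (u s)) li) t).
{ apply cotq_continuous; [intros; now rewrite Hp|now rewrite H0|apply Derive_correct, (proj2 (Hd 0))|intros; exact (proj2 (cdiff_cont u Hd _))]. }
exists (fun t => (- / 2 * Re (u t) + / 2 * cotq (fun s => Im (u s)) li t, - / 2 * Im (u t) - / 2 * cotq (fun s => Re (u s)) lr t)).
split.
- intros t. destruct (cdiff_cont u Hd t). split; simpl.
  + apply (continuous_plus (fun t => - / 2 * Re (u t)) (fun t => / 2 * cotq (fun s => Im (u s)) li t));
     apply (continuous_scal_r (V := R_NormedModule)); auto.
  + apply (continuous_minus (fun t => - / 2 * Im (u t)) (fun t => / 2 * cotq (fun s => Re (u s)) lr t));
     apply (continuous_scal_r (V := R_NormedModule)); auto.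
- intros t. unfold cotq. destruct (Req_EM_T (sin (t / 2)) 0) as [E|E].
  + destruct (sin_half_zero t E) as [k ->].
    assert (Eu : u (IZR k * (2 * PI)) = RtoC 0).
    { rewrite <- (Rplus_0_l (IZR k * (2 * PI))), <- H0. apply injective_projections.
      - apply (periodic_Z (fun s => Re (u s))). intros; now rewrite Hp.
      - apply (periodic_Z (fun s => Im (u s))). intros; now rewrite Hp. }
    rewrite Eu. unfold expi. rewrite Rmult_1_l, cos_Z, sin_Z. unfold RtoC, Cminus, Cplus, Copp, Cmult; simpl. f_equal; ring.
  + unfold expi. rewrite Rmult_1_l. replace t with (2 * (t / 2)) at 2 3 by field.
    rewrite cos_2a_sin, sin_2a. destruct (u t) as [a b]. unfold RtoC, Cminus, Cplus, Copp, Cmult; simpl.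
    pose proof (sin2_cos2 (t / 2)) as HT. unfold Rsqr in HT.
    set (s := sin (t / 2)) in *. set (c := cos (t / 2)) in *.
    f_equal.
    * transitivity (a * (s * s + c * c)); [rewrite HT; ring|field; auto].
    * transitivity (b * (s * s + c * c)); [rewrite HT; ring|field; auto].
Qed.

(** Chernoff's argument: if u - u(0) = (e^{it} - 1) g, then the coefficients of u - u(0) are differences
    of consecutive coefficients of g, so their symmetric sums telescope and tend to 0 by the
    Riemann-Lebesgue lemma. *)
Lemma fourier_at_zero u : (forall t, u (t + 2 * PI) = u t) -> cdiff u ->
  Clim (fun N => csum (zrange N) (fourier_coef u)) (u 0).
Proof.
intros Hp Hd. pose proof (cdiff_cont u Hd) as Hc.
set (v := fun t => (u t - u 0 * expi 0 t)%C).
assert (Hv : exists g, cont g /\ forall t, v t = ((expi 1 t - RtoC 1) * g t)%C).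
{ apply divide_by_e1.
  - intros t. unfold v. now rewrite Hp, !expi_0.
  - assert (Ev : forall s, v s = (u s - u 0)%C) by (intros s; unfold v; rewrite expi_0; ring).
    intros t. destruct (Hd t). split.
    + apply ex_derive_ext with (fun s => Re (u s) - Re (u 0)); [intros s; rewrite Ev; reflexivity|].
      apply (ex_derive_minus (V := R_NormedModule) (fun s => Re (u s)) (fun _ => Re (u 0))); auto; apply ex_derive_const.
    + apply ex_derive_ext with (fun s => Im (u s) - Im (u 0)); [intros s; rewrite Ev; reflexivity|].
      apply (ex_derive_minus (V := R_NormedModule) (fun s => Im (u s)) (fun _ => Im (u 0))); auto; apply ex_derive_const.
  - unfold v. rewrite expi_0. ring. }
destruct Hv as [g [Hg Eg]].
assert (Ev : forall n, fourier_coef v n = (fourier_coef g (n - 1) - fourier_coef g n)%C).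
{ intros n. replace v with (fun t => (g t * expi 1 t - g t)%C) by (apply functional_extensionality; intros; rewrite Eg; ring).
  rewrite fourier_coef_minus, fourier_coef_mult_expi; auto. apply cont_mult; auto using cont_expi. }
assert (Es : forall N, csum (zrange N) (fourier_coef v) = (fourier_coef g (- Z.of_nat (S N))%Z - fourier_coef g (Z.of_nat N))%C).
{ induction N as [|N IH]; cbn [zrange csum].
  - rewrite Ev. simpl. ring.
  - rewrite IH, !Ev. replace (Z.of_nat (S N) - 1)%Z with (Z.of_nat N) by lia.
    replace (- Z.of_nat (S N) - 1)%Z with (- Z.of_nat (S (S N)))%Z by lia. ring. }
assert (Eu : forall N, csum (zrange N) (fourier_coef u) = (u 0 + csum (zrange N) (fourier_coef v))%C).
{ intros N. unfold v.
  rewrite (csum_ext _ (fourier_coef (fun t => (u t - u 0 * expi 0 t)%C)) (fun n => (fourier_coef u n - u 0 * (if Z.eq_dec n 0 then RtoC 1 else RtoC 0))%C)).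
  - rewrite csum_minus, csum_mult_l, (csum_single (zrange N) (fun n => if Z.eq_dec n 0 then RtoC 1 else RtoC 0) 0%Z (NoDup_zrange N)); [simpl; ring|apply In_zrange; lia|].
    intros x _ Hx. destruct Z.eq_dec; easy.
  - intros n _. rewrite fourier_coef_minus, fourier_coef_scal, fourier_coef_expi; auto using cont_expi.
    apply cont_mult; auto using cont_const, cont_expi. }
destruct (riemann_lebesgue g Hg) as [R1 R2].
pose proof (Clim_plus _ _ _ _ (Clim_const (u 0)) (Clim_minus _ _ _ _ R2 R1)) as H.
replace (u 0 + (RtoC 0 - RtoC 0))%C with (u 0) in H by ring.
eapply Clim_ext_loc; [|apply H]. exists 0%nat. intros N _. now rewrite Eu, Es.
Qed.

Lemma RInt_periodic (p : R -> R) s : (forall t, p (t + 2 * PI) = p t) -> (forall t, continuous p t) ->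
  RInt (fun t => p (t + s)) 0 (2 * PI) = RInt p 0 (2 * PI).
Proof.
intros Hp Hc.
assert (He : forall x y, ex_RInt p x y) by (intros; apply (@ex_RInt_continuous R_CompleteNormedModule); auto).
assert (Hsh : forall v x y, RInt (fun t => p (t + v)) x y = RInt p (x + v) (y + v)).
{ intros v x y. apply is_RInt_unique.
  apply (is_RInt_ext (fun y => scal 1 (p (1 * y + v)))).
  - intros; now rewrite !Rmult_1_l.
  - apply (is_RInt_comp_lin (V := R_NormedModule) p 1 v). rewrite !Rmult_1_l. apply (RInt_correct (V := R_CompleteNormedModule)), He. }
rewrite Hsh, Rplus_0_l.
assert (E : RInt p (2 * PI) (2 * PI + s) = RInt p 0 s).
{ replace (2 * PI) with (0 + 2 * PI) at 1 by ring. rewrite (Rplus_comm (2 * PI) s). rewrite <- Hsh.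
  apply RInt_ext; intros; apply Hp. }
pose proof (RInt_Chasles (V := R_CompleteNormedModule) p s 0 (2 * PI) (He _ _) (He _ _)) as H1.
pose proof (RInt_Chasles (V := R_CompleteNormedModule) p s (2 * PI) (2 * PI + s) (He _ _) (He _ _)) as H2.
pose proof (opp_RInt_swap (V := R_CompleteNormedModule) p s 0 (He _ _)) as H3.
unfold plus, opp in *; simpl in *. lra.
Qed.

Lemma expi_periodic n t : expi n (t + 2 * PI) = expi n t.
Proof.
unfold expi. rewrite Rmult_plus_distr_l, cos_plus, sin_plus, cos_Z, sin_Z. f_equal; ring.
Qed.

Lemma expi_shift n t s : expi n (t + s) = (expi n t * expi n s)%C.
Proof.
unfold expi, Cmult; simpl. rewrite Rmult_plus_distr_l, cos_plus, sin_plus. f_equal; ring.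
Qed.

Lemma fourier_coef_shift u s n : (forall t, u (t + 2 * PI) = u t) -> cont u -> 
  fourier_coef (fun t => u (t + s)) n = (fourier_coef u n * expi n s)%C.
Proof.
intros Hp Hc.
assert (Hsh : forall w, cont w -> cont (fun t => w (t + s))).
{ intros w Hw t.
  assert (Hts : continuous (fun t => t + s) t) by (apply (ex_derive_continuous (K := R_AbsRing) (V := R_NormedModule)); auto_derive; auto).
  split.
  - apply (continuous_comp (fun t => t + s) (fun t => Re (w t))); [exact Hts|exact (proj1 (Hw _))].
  - apply (continuous_comp (fun t => t + s) (fun t => Im (w t))); [exact Hts|exact (proj2 (Hw _))]. }
assert (Hm : cont (fun t => (u t * expi (- n) t)%C)) by (apply cont_mult; auto using cont_expi).
rewrite !fourier_coef_CInt; auto.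
replace (fun t : R => (u (t + s)%R * expi (- n) t)%C) with (fun t : R => (expi n s * (u (t + s)%R * expi (- n) (t + s)%R))%C).
- rewrite CInt_scal by (apply (Hsh _ Hm)).
  replace (CInt (fun t : R => (u (t + s)%R * expi (- n) (t + s)%R)%C) 0 (2 * PI)) with (CInt (fun t => (u t * expi (- n) t)%C) 0 (2 * PI)); [ring|].
  unfold CInt. f_equal; symmetry.
  + apply (RInt_periodic (fun t => Re (u t * expi (- n) t)%C)); [intros; now rewrite Hp, expi_periodic|intros; exact (proj1 (Hm _))].
  + apply (RInt_periodic (fun t => Im (u t * expi (- n) t)%C)); [intros; now rewrite Hp, expi_periodic|intros; exact (proj2 (Hm _))].
- apply functional_extensionality; intros t. cbv beta. rewrite (expi_shift (- n)).
  transitivity (u (t + s)%R * expi (- n) t * (expi n s * expi (- n) s))%C; [ring|].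
  rewrite expi_mul, Z.add_opp_diag_r, expi_0. ring.
Qed.

(** Translation reduces this to [fourier_at_zero]. *)
Lemma fourier_inversion u t : (forall t, u (t + 2 * PI) = u t) -> cdiff u ->
  Clim (fun N => csum (zrange N) (fun n => (fourier_coef u n * expi n t)%C)) (u t).
Proof.
intros Hp Hd.
assert (H : Clim (fun N => csum (zrange N) (fourier_coef (fun s => u (s + t)))) (u (0 + t))).
{ apply (fourier_at_zero (fun s => u (s + t))).
  - intros s. replace (s + 2 * PI + t) with (s + t + 2 * PI) by ring. apply Hp.
  - intros s. destruct (Hd (s + t)). split.
    + apply (ex_derive_comp (fun s => Re (u s)) (fun s => s + t)); auto. auto_derive; auto.
    + apply (ex_derive_comp (fun s => Im (u s)) (fun s => s + t)); auto. auto_derive; auto. }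
rewrite Rplus_0_l in H. eapply Clim_ext_loc; [|apply H]. exists 0%nat. intros N _. apply csum_ext; intros n _.
apply fourier_coef_shift; auto using cdiff_cont.
Qed.

(** * Smooth functions and the iterates of the two operators *)

Definition rsmooth (f : R -> R) : Prop := forall k t, ex_derive_n f k t.

Lemma Derive_n_Derive f k : Derive_n (Derive f) k = Derive_n f (S k).
Proof.
induction k as [|k IH]; [reflexivity|]. simpl. rewrite IH. reflexivity.
Qed.

Lemma rsmooth_derive f : rsmooth f -> rsmooth (Derive f).
Proof.
intros H [|k] t; [exact I|]. simpl. rewrite Derive_n_Derive. apply (H (S (S k)) t).
Qed.

Lemma rsmooth_ex_derive f : rsmooth f -> forall t, ex_derive f t.
Proof. intros H t. apply (H 1%nat t). Qed.

Lemma ex_derive_n_step f k : (forall t, ex_derive f t) -> (forall t, ex_derive_n (Derive f) k t) -> forall t, ex_derive_n f (S k) t.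
Proof.
intros H1 H2 t. destruct k as [|k]; [apply H1|].
specialize (H2 t). simpl in *. rewrite Derive_n_Derive in H2. exact H2.
Qed.

Lemma rsmooth_plus f g : rsmooth f -> rsmooth g -> rsmooth (fun t => f t + g t).
Proof. intros Hf Hg k t. apply ex_derive_n_plus; apply filter_forall; intros; [apply Hf|apply Hg]. Qed.

Lemma rsmooth_scal c f : rsmooth f -> rsmooth (fun t => c * f t).
Proof. intros Hf k t. apply ex_derive_n_scal_l, Hf. Qed.

(** Leibniz' rule, by an induction on the order that treats all pairs of smooth functions at once. *)
Lemma rsmooth_mult f g : rsmooth f -> rsmooth g -> rsmooth (fun t => f t * g t).
Proof.
assert (H : forall k f g, rsmooth f -> rsmooth g -> forall j t, (j <= k)%nat -> ex_derive_n (fun t => f t * g t) j t).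
{ induction k as [|k IH]; intros f0 g0 Hf Hg [|j] t Hj; try exact I; [lia|].
  apply ex_derive_n_step.
  - intros x. apply (ex_derive_mult f0 g0); now apply rsmooth_ex_derive.
  - intros x.
    replace (Derive (fun t => f0 t * g0 t)) with (fun t => Derive f0 t * g0 t + f0 t * Derive g0 t)
      by (apply functional_extensionality; intros y; symmetry; apply Derive_mult; now apply rsmooth_ex_derive).
    apply ex_derive_n_plus; apply filter_forall; intros y i Hi; apply IH; auto using rsmooth_derive; lia. }
intros Hf Hg k t. now apply (H k).
Qed.

Lemma smooth_comp u : smooth_on_circle u ->
  (forall t, u (t + 2 * PI) = u t) /\ rsmooth (fun s => Re (u s)) /\ rsmooth (fun s => Im (u s)).
Proof. intros [H1 H2]. repeat split; auto; intros k t; apply H2. Qed.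

Lemma smooth_intro u : (forall t, u (t + 2 * PI) = u t) -> rsmooth (fun s => Re (u s)) -> rsmooth (fun s => Im (u s)) ->
  smooth_on_circle u.
Proof. intros H1 H2 H3; split; auto. Qed.

Lemma smooth_cdiff u : smooth_on_circle u -> cdiff u.
Proof. intros H t. apply smooth_comp in H. destruct H as [_ [H1 H2]]. split; now apply rsmooth_ex_derive. Qed.

Lemma smooth_cont u : smooth_on_circle u -> cont u.
Proof. intros H; now apply cdiff_cont, smooth_cdiff. Qed.

Lemma smooth_mult u v : smooth_on_circle u -> smooth_on_circle v -> smooth_on_circle (fun t => (u t * v t)%C).
Proof.
intros Hu Hv. apply smooth_comp in Hu, Hv. destruct Hu as [U0 [U1 U2]], Hv as [V0 [V1 V2]].
apply smooth_intro.
- intros t. now rewrite U0, V0.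
- replace (fun s => Re (u s * v s)%C) with (fun s => Re (u s) * Re (v s) + (-1) * (Im (u s) * Im (v s)))
    by (apply functional_extensionality; intros x; destruct (u x), (v x); simpl; ring).
  apply rsmooth_plus; [|apply rsmooth_scal]; now apply rsmooth_mult.
- apply (rsmooth_plus (fun s => Re (u s) * Im (v s)) (fun s => Im (u s) * Re (v s))); now apply rsmooth_mult.
Qed.

Lemma periodic_Derive (f : R -> R) : (forall t, f (t + 2 * PI) = f t) -> (forall t, ex_derive f t) ->
  forall t, Derive f (t + 2 * PI) = Derive f t.
Proof.
intros H Hd t. rewrite <- (Derive_ext (fun t => f (t + 2 * PI)) f t) by auto.
symmetry. apply is_derive_unique. rewrite <- (Rmult_1_l (Derive f (t + 2 * PI))).
apply (is_derive_comp f (fun t => t + 2 * PI)); [apply Derive_correct, Hd|]. auto_derive; auto.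
Qed.

Lemma Re_Dop u t : Re (Dop u t) = Derive (fun s => Im (u s)) t.
Proof. unfold Dop; simpl; ring. Qed.

Lemma Im_Dop u t : Im (Dop u t) = (-1) * Derive (fun s => Re (u s)) t.
Proof. unfold Dop; simpl; ring. Qed.

Lemma smooth_Dop u : smooth_on_circle u -> smooth_on_circle (Dop u).
Proof.
intros Hu. apply smooth_comp in Hu. destruct Hu as [U0 [U1 U2]].
apply smooth_intro.
- intros t. unfold Dop. f_equal. f_equal; apply (periodic_Derive (fun s => _ (u s))); try (intros; now rewrite U0); now apply rsmooth_ex_derive.
- replace (fun s => Re (Dop u s)) with (Derive (fun s => Im (u s))); [now apply rsmooth_derive|].
  apply functional_extensionality; intros s. now rewrite Re_Dop.
- replace (fun s => Im (Dop u s)) with (fun s => (-1) * Derive (fun s => Re (u s)) s); [now apply rsmooth_scal, rsmooth_derive|].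
  apply functional_extensionality; intros s. now rewrite Im_Dop.
Qed.

Lemma smooth_expi n : smooth_on_circle (expi n).
Proof.
assert (H : forall k x y t, ex_derive_n (fun t => x * cos (IZR n * t) + y * sin (IZR n * t)) k t).
{ induction k as [|k IH]; intros x y t; [exact I|]. revert t. apply ex_derive_n_step.
  - intros t. auto_derive; auto.
  - intros t.
    replace (Derive (fun t => x * cos (IZR n * t) + y * sin (IZR n * t))) with
      (fun t => (y * IZR n) * cos (IZR n * t) + (- x * IZR n) * sin (IZR n * t)); [apply IH|].
    apply functional_extensionality; intros s. symmetry. apply is_derive_unique. auto_derive; auto. ring. }
apply smooth_intro.
- intros; apply expi_periodic.
- intros k t. eapply ex_derive_n_ext; [|apply (H k 1 0)]. intros s; simpl; ring.
- intros k t. eapply ex_derive_n_ext; [|apply (H k 0 1)]. intros s; simpl; ring.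
Qed.

Lemma Dop_mult u v t : cdiff u -> cdiff v -> Dop (fun s => (u s * v s)%C) t = (Dop u t * v t + u t * Dop v t)%C.
Proof.
intros Hu Hv. destruct (Hu t) as [U1 U2], (Hv t) as [V1 V2]. unfold Dop.
assert (E1 : Derive (fun s => Re (u s * v s)%C) t = Derive (fun s => Re (u s)) t * Re (v t) + Re (u t) * Derive (fun s => Re (v s)) t
  - (Derive (fun s => Im (u s)) t * Im (v t) + Im (u t) * Derive (fun s => Im (v s)) t)).
{ transitivity (Derive (fun s => Re (u s) * Re (v s) - Im (u s) * Im (v s)) t); [reflexivity|].
  rewrite (Derive_minus (fun s => Re (u s) * Re (v s)) (fun s => Im (u s) * Im (v s))) by (now apply (ex_derive_mult (fun s => _ (u s)))).
  rewrite (Derive_mult (fun s => Re (u s))), (Derive_mult (fun s => Im (u s))) by auto. reflexivity. }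
assert (E2 : Derive (fun s => Im (u s * v s)%C) t = Derive (fun s => Re (u s)) t * Im (v t) + Re (u t) * Derive (fun s => Im (v s)) t
  + (Derive (fun s => Im (u s)) t * Re (v t) + Im (u t) * Derive (fun s => Re (v s)) t)).
{ transitivity (Derive (fun s => Re (u s) * Im (v s) + Im (u s) * Re (v s)) t); [reflexivity|].
  rewrite (Derive_plus (fun s => Re (u s) * Im (v s)) (fun s => Im (u s) * Re (v s))) by (now apply (ex_derive_mult (fun s => _ (u s)))).
  rewrite (Derive_mult (fun s => Re (u s))), (Derive_mult (fun s => Im (u s))) by auto. reflexivity. }
rewrite E1, E2. destruct (u t), (v t). unfold Cmult, Cplus, Copp, Ci; simpl. f_equal; ring.
Qed.

Lemma CInt_Dop u : smooth_on_circle u -> CInt (Dop u) 0 (2 * PI) = RtoC 0.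
Proof.
intros Hu. pose proof (smooth_comp u Hu) as [U0 [U1 U2]].
assert (H : forall f, (forall t, f (t + 2 * PI) = f t) -> rsmooth f -> RInt (Derive f) 0 (2 * PI) = 0).
{ intros f Hp Hf. rewrite RInt_Derive.
  - rewrite <- (Rplus_0_l (2 * PI)), Hp. now apply Rminus_diag_eq.
  - intros; now apply rsmooth_ex_derive.
  - intros x _. apply (ex_derive_continuous (K := R_AbsRing) (V := R_NormedModule)). now apply rsmooth_ex_derive, rsmooth_derive. }
unfold CInt, RtoC. f_equal.
- rewrite (RInt_ext _ (Derive (fun s => Im (u s)))); [apply H; auto; intros; now rewrite U0|].
  intros; apply Re_Dop.
- rewrite (RInt_ext _ (fun t => (-1) * Derive (fun s => Re (u s)) t)) by (intros; apply Im_Dop).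
  rewrite RInt_scal'.
  + rewrite H; auto; [apply Rmult_0_r|intros; now rewrite U0].
  + apply (@ex_RInt_continuous R_CompleteNormedModule). intros; apply (ex_derive_continuous (K := R_AbsRing) (V := R_NormedModule)).
    now apply rsmooth_ex_derive, rsmooth_derive.
Qed.

(** Integration by parts: the integral of D (u e^{-i n t}) over a period vanishes. *)
Lemma fourier_coef_Dop u n : smooth_on_circle u -> fourier_coef (Dop u) n = (RtoC (IZR n) * fourier_coef u n)%C.
Proof.
intros Hu.
assert (H := CInt_Dop _ (smooth_mult _ _ Hu (smooth_expi (- n)))).
rewrite !fourier_coef_CInt by auto using smooth_cont, smooth_Dop.
assert (E : Dop (fun t => (u t * expi (- n) t)%C) = (fun t => (Dop u t * expi (- n) t + RtoC (IZR (- n)) * (u t * expi (- n) t))%C)).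
{ apply functional_extensionality; intros t.
  rewrite Dop_mult, Dop_expi by auto using smooth_cdiff, smooth_expi. ring. }
rewrite E in H.
assert (C1 : cont (fun t => (Dop u t * expi (- n) t)%C)) by (apply cont_mult; auto using smooth_cont, smooth_Dop, cont_expi).
assert (C2 : cont (fun t => (u t * expi (- n) t)%C)) by (apply cont_mult; auto using smooth_cont, cont_expi).
rewrite CInt_plus, CInt_scal in H by (auto; apply cont_mult; auto using cont_const).
rewrite opp_IZR, RtoC_opp in H.
set (X := CInt (fun t => (Dop u t * expi (- n) t)%C) 0 (2 * PI)) in *.
set (Y := CInt (fun t => (u t * expi (- n) t)%C) 0 (2 * PI)) in *.
replace X with (RtoC (IZR n) * Y + (X + - RtoC (IZR n) * Y))%C by ring. rewrite H. ring.
Qed.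

(** The function D^k u is continuous, so its coefficients n^k u_n are bounded. *)
Lemma smooth_rapid u : smooth_on_circle u -> rapid (fourier_coef u).
Proof.
intros Hu.
assert (H : forall k u, smooth_on_circle u -> exists B, forall n, Cmod (fourier_coef u n) * IZR (Z.abs n) ^ k <= B).
{ clear. induction k as [|k IH]; intros u Hu.
  - pose proof PI_RGT_0. destruct (cont_bounded u 0 (2 * PI) ltac:(lra) (smooth_cont u Hu)) as [M HM].
    exists (2 * M). intros n. rewrite Rmult_1_r. apply fourier_coef_bound; auto using smooth_cont.
  - destruct (IH (Dop u) (smooth_Dop u Hu)) as [B HB]. exists B. intros n. specialize (HB n).
    rewrite fourier_coef_Dop, Cmod_mult, Cmod_R, <- abs_IZR in HB by auto. simpl. lra. }
intros k. destruct (H k u Hu) as [B HB]. destruct (H 0%nat u Hu) as [B0 HB0].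
exists (2 ^ k * B + 2 ^ k * B0). intros n. specialize (HB n). specialize (HB0 n). simpl in HB0. rewrite Rmult_1_r in HB0.
assert (HK : jb n ^ k <= 2 ^ k * IZR (Z.abs n) ^ k + 2 ^ k).
{ assert (H2 : 0 < 2 ^ k) by (apply pow_lt; lra). destruct (Z.eq_dec n 0) as [->|Hn].
  - unfold jb. simpl. rewrite Rplus_0_r, pow1. assert (1 <= 2 ^ k) by (apply pow_R1_Rle; lra).
    assert (0 <= 0 ^ k) by (apply pow_le; lra). nra.
  - rewrite <- Rpow_mult_distr. assert (jb n ^ k <= (2 * IZR (Z.abs n)) ^ k); [|lra].
    apply pow_incr. split; [apply jb_nonneg|]. unfold jb. pose proof (wt_ge1 n Hn). lra. }
pose proof (Cmod_ge_0 (fourier_coef u n)). assert (H2 : 0 < 2 ^ k) by (apply pow_lt; lra).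
apply Rle_trans with (Cmod (fourier_coef u n) * (2 ^ k * IZR (Z.abs n) ^ k + 2 ^ k)); [now apply Rmult_le_compat_l|]. nra.
Qed.

Lemma rapid_sq c : rapid c -> exists B, forall l, Cmod (c l) <= B / jb l ^ 2.
Proof.
intros H. destruct (H 2%nat) as [B HB]. exists B. intros l. specialize (HB l). pose proof (jb_pow_pos l 2).
apply Rmult_le_reg_r with (jb l ^ 2); auto. unfold Rdiv. rewrite Rmult_assoc, Rinv_l by lra. lra.
Qed.

Lemma rapid_abs_sq c (om : Z -> R) : (forall l, Rabs (om l) = IZR (Z.abs l)) -> rapid c ->
  exists B, forall l, Cmod (RtoC (om l) * c l)%C <= B / jb l ^ 2.
Proof.
intros Hom H. apply rapid_sq. intros k. destruct (H (S k)) as [B HB]. exists B. intros n. specialize (HB n).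
rewrite Cmod_mult, Cmod_R, Hom. eapply Rle_trans; [|apply HB]. simpl.
pose proof (jb_abs n). pose proof (jb_pow_pos n k). pose proof (Cmod_ge_0 (c n)).
replace (Cmod (c n) * (jb n * jb n ^ k)) with (jb n * (Cmod (c n) * jb n ^ k)) by ring.
rewrite Rmult_assoc. apply Rmult_le_compat_r; auto. nonneg.
Qed.

Section Iterates.
Variable a : R -> C.
Hypothesis a_smooth : smooth_on_circle a.

Lemma Lambda_series u t : rapid (fourier_coef u) ->
  Clim (fun N => csum (zrange N) (fun l => (RtoC (IZR (Z.abs l)) * fourier_coef u l * expi l t)%C)) (Lambda u t).
Proof.
intros Hu. destruct (rapid_abs_sq _ (fun l => IZR (Z.abs l)) ltac:(intros; apply Rabs_right, Rle_ge, wt_ge0) Hu) as [B HB].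
apply (Clim_ZSeries _ B). intros l. rewrite Cmod_mult, Cmod_expi, Rmult_1_r. auto.
Qed.

(** [Lambda u] is an absolutely convergent Fourier series by definition; the decay of its coefficients is
    what the iteration carries along, by the estimate [conv_term_bound] for the convolution. *)
Lemma step_Lambda u : rapid (fourier_coef u) ->
  cont (mult_op a (Lambda u)) /\
  (forall i, fourier_coef (mult_op a (Lambda u)) i = ZSeries (fun l => (fourier_coef a (i - l) * (RtoC (IZR (Z.abs l)) * fourier_coef u l))%C)) /\
  rapid (fourier_coef (mult_op a (Lambda u))).
Proof.
intros Hu. assert (Hom : forall l, Rabs (IZR (Z.abs l)) = IZR (Z.abs l)) by (intros; apply Rabs_right, Rle_ge, wt_ge0).
destruct (rapid_abs_sq _ _ Hom Hu) as [B HB].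
pose proof (smooth_rapid a a_smooth) as Ha.
assert (E : forall i, fourier_coef (mult_op a (Lambda u)) i = ZSeries (fun l => (fourier_coef a (i - l) * (RtoC (IZR (Z.abs l)) * fourier_coef u l))%C)).
{ intros i. apply (fourier_coef_product a _ B (Lambda u)); auto using smooth_cont. intros; now apply Lambda_series. }
split; [|split; [exact E|]].
- apply cont_mult; [now apply smooth_cont|]. apply (cont_series (fun l => (RtoC (IZR (Z.abs l)) * fourier_coef u l)%C) B); [apply HB|]. intros; now apply Lambda_series.
- intros k. destruct (Ha k) as [B1 HB1]. destruct (Hu (k + 3)%nat) as [B2 HB2].
  exists (3 * (B1 * B2)). intros i. rewrite E.
  assert (HT := fun l => conv_term_bound (fourier_coef a) _ Hom i l (fourier_coef u) k B1 B2 (HB1 _) (HB2 l)).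
  assert (HC : forall l, Cmod (fourier_coef a (i - l) * (RtoC (IZR (Z.abs l)) * fourier_coef u l)) <= (B1 * B2 / jb i ^ k) / jb l ^ 2).
  { intros l. specialize (HT l). pose proof (jb_pow_pos l 2). pose proof (jb_pow_pos i k).
    apply Rmult_le_reg_r with (jb l ^ 2 * jb i ^ k); [nra|].
    replace (B1 * B2 / jb i ^ k / jb l ^ 2 * (jb l ^ 2 * jb i ^ k)) with (B1 * B2) by (field; pose proof (jb_pos l); split; lra). lra. }
  pose proof (jb_pow_pos i k).
  apply Rmult_le_reg_r with (/ jb i ^ k); [now apply Rinv_0_lt_compat|]. rewrite Rmult_assoc, Rinv_r, Rmult_1_r by lra.
  eapply Clim_Cmod_le; [apply (Clim_ZSeries _ _ HC)|].
  intros N. simpl. apply Rmult_le_reg_r with (jb i ^ k); auto. rewrite (Rmult_assoc _ (/ _)), Rinv_l, Rmult_1_r by lra.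
  apply csum_bound; [nonneg|]. apply HT.
Qed.

Lemma iter_Lambda j p : let v := Nat.iter p (fun v => mult_op a (Lambda v)) (expi j) in cont v /\ rapid (fourier_coef v).
Proof.
induction p as [|p [IH1 IH2]]; simpl.
- split; [apply cont_expi|apply smooth_rapid, smooth_expi].
- now destruct (step_Lambda _ IH2) as [H1 [_ H3]].
Qed.

(** Here [Dop u] is a derivative, and Fourier inversion is what makes it a convergent series. *)
Lemma step_D u i : smooth_on_circle u ->
  fourier_coef (mult_op a (Dop u)) i = ZSeries (fun l => (fourier_coef a (i - l) * (RtoC (IZR l) * fourier_coef u l))%C).
Proof.
intros Hu. destruct (rapid_abs_sq _ IZR ltac:(intros; now rewrite abs_IZR) (smooth_rapid u Hu)) as [B HB].
apply (fourier_coef_product a _ B (Dop u)); auto using smooth_cont.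
intros t. pose proof (smooth_Dop u Hu) as Hd.
eapply Clim_ext_loc; [|apply (fourier_inversion (Dop u) t); [apply Hd|now apply smooth_cdiff]].
exists 0%nat. intros N _. apply csum_ext; intros l _. now rewrite fourier_coef_Dop.
Qed.

Lemma iter_D j p : smooth_on_circle (Nat.iter p (fun v => mult_op a (Dop v)) (expi j)).
Proof.
induction p as [|p IH]; simpl; [apply smooth_expi|]. apply smooth_mult; auto. now apply smooth_Dop.
Qed.

End Iterates.

Lemma real_coef a n : cont a -> real_valued a -> fourier_coef a (- n) = Cconj (fourier_coef a n).
Proof.
intros Hc Hr. rewrite !fourier_coef_CInt, Cconj_mult, Cconj_RtoC by auto. f_equal.
assert (Ha : forall t, a t = RtoC (Re (a t))) by (intros t; specialize (Hr t); destruct (a t); simpl in *; unfold RtoC; congruence).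
apply injective_projections.
- apply RInt_ext; intros t _. pose proof (Hr t) as E. unfold Re, Im in *. simpl.
  rewrite E, Z.opp_involutive, opp_IZR, Ropp_mult_distr_l_reverse, cos_neg. ring.
- assert (Hi : ex_RInt (fun t => Im (a t * expi (- n) t)%C) 0 (2 * PI)) by (apply cont_Im, cont_mult; auto using cont_expi).
  transitivity ((-1) * RInt (fun t => Im (a t * expi (- n) t)%C) 0 (2 * PI)).
  + rewrite <- RInt_scal' by auto.
    apply RInt_ext; intros t _. pose proof (Hr t) as E. unfold Re, Im in *. simpl.
    rewrite E, Z.opp_involutive, opp_IZR, Ropp_mult_distr_l_reverse, sin_neg. ring.
  + change ((-1) * RInt (fun t => Im (a t * expi (- n) t)%C) 0 (2 * PI) = - RInt (fun t => Im (a t * expi (- n) t)%C) 0 (2 * PI)). ring.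
Qed.

Lemma steklov_zeta_lim m a : (1 <= m)%nat -> smooth_on_circle a -> real_valued a ->
  Clim (fun N => ktr (zrange N) (kminus (wprod (zrange N) (toep (fourier_coef a)) (repeat false (2 * m)))
                                        (wprod (zrange N) (toep (fourier_coef a)) (alt false (2 * m)))))
       (steklov_zeta m a).
Proof.
intros Hm Ha Hr.
pose proof (trace_lim (fourier_coef a) (smooth_rapid a Ha) (fun n => real_coef a n (smooth_cont a Ha) Hr) m
  (fun j p i => fourier_coef (Nat.iter p (fun v => mult_op a (Lambda v)) (expi j)) i)
  (fun j p i => fourier_coef (Nat.iter p (fun v => mult_op a (Dop v)) (expi j)) i) Hm) as H.
unfold steklov_zeta, op_trace.
replace (fun n => fourier_coef (steklov_diff a (2 * m) (expi n)) n) with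
  (fun n => (fourier_coef (Nat.iter (2 * m) (fun v => mult_op a (Lambda v)) (expi n)) n -
             fourier_coef (Nat.iter (2 * m) (fun v => mult_op a (Dop v)) (expi n)) n)%C).
- apply H.
  + intros; apply fourier_coef_expi.
  + intros j p i. simpl Nat.iter. apply (step_Lambda a Ha). apply (iter_Lambda a Ha j p).
  + intros; apply fourier_coef_expi.
  + intros j p i. simpl Nat.iter. apply (step_D a Ha). apply (iter_D a Ha j p).
- apply functional_extensionality; intros n. symmetry. apply fourier_coef_minus.
  + apply (iter_Lambda a Ha n (2 * m)).
  + apply smooth_cont, (iter_D a Ha n (2 * m)).
Qed.

(** 2 Re z = z + conj z. *)
Lemma trig_form_expi a0 a1 t : RtoC (a0 + 2 * Re (a1 * expi 1 t)%C) = (RtoC a0 * expi 0 t + (a1 * expi 1 t + Cconj a1 * expi (- 1) t))%C.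
Proof.
rewrite <- (expi_conj 1), expi_0, <- Cconj_mult. destruct (a1 * expi 1 t)%C. unfold RtoC, Cplus, Cmult, Cconj; simpl. f_equal; ring.
Qed.

Lemma band_limited_iff a : smooth_on_circle a -> real_valued a ->
  ((forall n, (2 <= Z.abs n)%Z -> fourier_coef a n = RtoC 0) <->
   exists (a0 : R) (a1 : C), forall theta : R, a theta = RtoC (a0 + 2 * Re (a1 * expi 1 theta)%C)).
Proof.
intros Ha Hr. split.
- intros H. exists (Re (fourier_coef a 0)), (fourier_coef a 1). intros t. rewrite trig_form_expi.
  assert (E0 : fourier_coef a 0 = RtoC (Re (fourier_coef a 0))).
  { pose proof (real_coef a 0 (smooth_cont a Ha) Hr) as E. simpl in E. destruct (fourier_coef a 0) as [x y].
    unfold Cconj in E; simpl in E. injection E as E. unfold RtoC; simpl. f_equal. lra. }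
  rewrite <- E0, <- (real_coef a 1 (smooth_cont a Ha) Hr).
  eapply Clim_unique; [apply (fourier_inversion a t); [apply Ha|now apply smooth_cdiff]|].
  eapply Clim_ext_loc; [|apply Clim_const]. exists 1%nat. intros N HN.
  induction HN as [|N HN IH]; cbn [zrange csum].
  + simpl. ring.
  + rewrite <- IH, (H (Z.of_nat (S N))), (H (- Z.of_nat (S N))%Z) by lia. ring.
- intros [a0 [a1 Hf]] n Hn.
  replace a with (fun t => (RtoC a0 * expi 0 t + (a1 * expi 1 t + Cconj a1 * expi (- 1) t))%C)
    by (apply functional_extensionality; intros t; now rewrite Hf, trig_form_expi).
  assert (Hc : forall z k, cont (fun t => (z * expi k t)%C)) by (intros; apply cont_mult; [apply cont_const|apply cont_expi]).
  rewrite (fourier_coef_plus (fun t => (RtoC a0 * expi 0 t)%C)); [|apply Hc|apply cont_plus; apply Hc].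
  rewrite (fourier_coef_plus (fun t => (a1 * expi 1 t)%C)); [|apply Hc|apply Hc].
  rewrite !fourier_coef_scal, !fourier_coef_expi by apply cont_expi.
  repeat destruct Z.eq_dec; try lia. ring.
Qed.

Theorem theorem1p2 (m : nat) (a : R -> C) :
  (1 <= m)%nat -> smooth_on_circle a -> real_valued a ->
  (steklov_zeta m a = RtoC 0 <->
   exists (a0 : R) (a1 : C),
     forall theta : R, a theta = RtoC (a0 + 2 * Re (a1 * expi 1 theta)%C)).
Proof.
intros Hm Ha Hr. rewrite <- band_limited_iff by auto.
apply (trace_zero_iff (fourier_coef a) (smooth_rapid a Ha) (fun n => real_coef a n (smooth_cont a Ha) Hr) m); auto.
now apply steklov_zeta_lim.
Qed.
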